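(* Let $K\subset\mathbb R^d$ be a convex body with $0\in\operatorname{Int}K$, and assume that $K$ is strictly convex and regular. Let $\xi_1,\xi_2,\dots$ be independent random points uniformly distributed in $K$, and let $X_n:=\bigcap_{i=1}^n(K-\xi_i)$. Let $Z$ be the zero cell of the Poisson hyperplane tessellation associated with $K$ (see context). Then for every $m\in\mathbb N$ the random vector of convex bodies $$\bigl(n^{-1}(X_n^{o})^{[1]},\dots,n^{-1}(X_n^{o})^{[m]}\bigr)$$ converges in distribution, as $n\to\infty$, on the space $(\mathcal K^d_{(0)})^m$ endowed with the product topology, to $$\bigl((Z^{o})^{[1]},\dots,(Z^{o})^{[m]}\bigr).$$ Moreover, $\bigl(\mathrm{wr}^{[1]}(nX_n),\dots,\mathrm{wr}^{[m]}(nX_n)\bigr)$ converges in distribution to $\bigl(\mathrm{wr}^{[1]}(Z),\dots,\mathrm{wr}^{[m]}(Z)\bigr)$ as $n\to\infty$.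
   Context: **Spaces.** $\mathcal K^d_{(0)}$ is the family of compact convex sets in $\mathbb R^d$ containing the origin in the interior, with the Hausdorff metric. $\mathfrak K^d_{(0)}$ is the family of closed convex sets in $\mathbb R^d$ containing the origin in the interior. The polar of $A\subset\mathbb R^d$ is $A^{o}=\{y:\sup_{x\in A}\langle x,y\rangle\le 1\}$. $\overline{\mathrm{conv}}$ denotes the closed convex hull. **Regularity.** $K$ is regular if the normal cone $N(K,x)$ is one-dimensional for every $x\in\partial K$. **$m$-point peeling.** For a family $\mathcal L=\{L_i:i\in I\}$ of compact convex sets and $0\le m<|I|\le\infty$, $$\mathrm{conv}^{[m]}(\mathcal L)=\bigcap_{J\subset I,\,|J|=m}\overline{\mathrm{conv}}\Bigl(\bigcup_{i\in I\setminus J}L_i\Bigr).$$ **$m$-point wrapping.** For a family $\mathcal L=\{L_i:i\in I\}\subset\mathfrak K^d_{(0)}$ and $0\le m<|I|$, $$\mathrm{wr}^{[m]}(\mathcal L)=\overline{\mathrm{conv}}\Bigl(\bigcup_{J\subset I,\,|J|=m}\ \bigcap_{i\in I\setminus J}L_i\Bigr),$$ equivalently $\mathrm{wr}^{[m]}(\mathcal L)=\bigl(\mathrm{conv}^{[m]}(\{L_i^{o}:i\in I\})\bigr)^{o}$. **Limit object.** Let $\mathcal P_K=\{(t_i,u_i):i\ge1\}$ be a Poisson process on $(0,\infty)\times S^{d-1}$ with intensity measure $V_d(K)^{-1}\,dt\,S_{d-1}(K,du)$, where $V_d$ is volume and $S_{d-1}(K,\cdot)$ is the surface area measure of $K$.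 With $H_u^-(t)=\{x:\langle x,u\rangle\le t\}$, put $Z=\bigcap_{(t_i,u_i)\in\mathcal P_K}H^-_{u_i}(t_i)$. Let $\Pi_K=\{t_i^{-1}u_i:i\ge1\}$; then $Z^{o}=\mathrm{conv}\bigl(\bigcup_{x\in\Pi_K}[0,x]\bigr)$ almost surely. **Meaning of the peelings and wrappings of the represented sets.** They are taken with respect to the representing families (and for $n>m$): - $n^{-1}(X_n^{o})^{[r]}:=\mathrm{conv}^{[r]}\bigl(\{n^{-1}(K-\xi_i)^{o}:1\le i\le n\}\bigr)$; - $(Z^{o})^{[r]}:=\mathrm{conv}^{[r]}\bigl(\{[0,x]:x\in\Pi_K\}\bigr)$; - $\mathrm{wr}^{[r]}(nX_n)$ is the $r$-point wrapping of the family $\{n(K-\xi_i):1\le i\le n\}$; - $\mathrm{wr}^{[r]}(Z)$ is the $r$-point wrapping of the family $\{H^-_{u_i}(t_i):i\ge1\}$. *)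

(* Defs.v *)
From HB Require Import structures.
From mathcomp Require Import all_boot all_order all_algebra finmap.
From mathcomp Require Import all_classical all_reals all_analysis.
From mathcomp Require Import ring lra.

Set Implicit Arguments.
Unset Strict Implicit.
Unset Printing Implicit Defensive.

Import Order.TTheory GRing.Theory Num.Theory.
Import numFieldNormedType.Exports.

Local Open Scope classical_set_scope.
Local Open Scope ring_scope.

(* The norm `|x| which the library puts on 'rV[R]_d is the sup norm: it gives
   the right topology, but not the Euclidean distance. *)
Section euclidean.
Context {R : realType} {d : nat}.
Implicit Types x y z : 'rV[R]_d.

Definition dot x y : R := \sum_(i < d) x ord0 i * y ord0 i.

Definition enorm x : R := Num.sqrt (dot x x).

Lemma dot_ge0 x : 0 <= dot x x.
Proof. by apply: sumr_ge0 => i _; rewrite -expr2 sqr_ge0. Qed.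

Lemma enorm_ge0 x : 0 <= enorm x.
Proof. exact: sqrtr_ge0. Qed.

Lemma sqr_enorm x : enorm x ^+ 2 = dot x x.
Proof. by rewrite sqr_sqrtr// dot_ge0. Qed.

Lemma dot_comb (a b : R) x y : dot (a *: x + b *: y) (a *: x + b *: y) =
  a ^+ 2 * dot x x + 2 * (a * b) * dot x y + b ^+ 2 * dot y y.
Proof.
rewrite /dot !mulr_sumr -!big_split /=; apply: eq_bigr => i _.
by rewrite !mxE; ring.
Qed.

Lemma dot_eq0 x : dot x x = 0 -> x = 0.
Proof.
move=> /eqP; rewrite psumr_eq0 => [|i _]; last by rewrite -expr2 sqr_ge0.
move=> /allP x0; apply/rowP => i; rewrite mxE; apply/eqP.
by have := x0 i (mem_index_enum i); rewrite /= mulf_eq0 orbb.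
Qed.

Lemma cauchy_schwarz x y : dot x y <= enorm x * enorm y.
Proof.
have [y0|y0] := eqVneq (dot y y) 0.
  rewrite (dot_eq0 y0) {1}/dot big1 => [|i _]; last by rewrite mxE mulr0.
  by rewrite mulr_ge0 ?enorm_ge0.
have {}y0 : 0 < dot y y by rewrite lt_neqAle eq_sym y0 dot_ge0.
have := dot_ge0 (dot y y *: x + (- dot x y) *: y); rewrite dot_comb.
have -> : dot y y ^+ 2 * dot x x + 2 * (dot y y * - dot x y) * dot x y +
    (- dot x y) ^+ 2 * dot y y = dot y y * (dot x x * dot y y - dot x y ^+ 2).
  by ring.
rewrite pmulr_rge0// subr_ge0 -!sqr_enorm -exprMn => xy.
rewrite (le_trans (ler_norm _))// -(@ler_pXn2r _ 2)// ?nnegrE//.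
  by rewrite real_normK ?num_real.
by rewrite mulr_ge0 ?enorm_ge0.
Qed.

Lemma ler_enormD x y : enorm (x + y) <= enorm x + enorm y.
Proof.
rewrite -(@ler_pXn2r _ 2)// ?nnegrE ?addr_ge0 ?enorm_ge0//.
rewrite sqr_enorm -[x]scale1r -[y]scale1r dot_comb !scale1r.
have := cauchy_schwarz x y; rewrite sqrrD !sqr_enorm; lra.
Qed.

Lemma enorm0 : enorm 0 = 0.
Proof.
by rewrite /enorm /dot big1 ?sqrtr0// => i _; rewrite mxE mul0r.
Qed.

Lemma enormN x : enorm (- x) = enorm x.
Proof.
by congr Num.sqrt; apply: eq_bigr => i _; rewrite !mxE mulrNN.
Qed.

Lemma enormB x y : enorm (x - y) = enorm (y - x).
Proof. by rewrite -enormN opprB. Qed.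

Lemma ler_enorm_dist x y z : enorm (x - z) <= enorm (x - y) + enorm (y - z).
Proof. by rewrite (le_trans _ (ler_enormD _ _))// addrA subrK. Qed.

Lemma coord_le_enorm x i : `|x ord0 i| <= enorm x.
Proof.
rewrite -sqrtr_sqr ler_sqrt ?dot_ge0// /dot (bigD1 i)//= -expr2 lerDl.
by apply: sumr_ge0 => j _; rewrite -expr2 sqr_ge0.
Qed.

Lemma norm_le_enorm x : `|x| <= enorm x.
Proof.
rewrite /Num.norm/= mx_normrE; apply/bigmax_leP; split=> [|[i j] _ /=].
  exact: enorm_ge0.
by rewrite ord1 coord_le_enorm.
Qed.

Lemma enorm_le_norm x : enorm x <= Num.sqrt (d%:R) * `|x|.
Proof.
rewrite -(@ler_pXn2r _ 2)// ?nnegrE ?enorm_ge0 ?mulr_ge0 ?sqrtr_ge0//.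
rewrite sqr_enorm exprMn sqr_sqrtr// /dot.
rewrite (@le_trans _ _ (\sum_(i < d) `|x| ^+ 2))//.
  apply: ler_sum => i _; rewrite -expr2 -real_normK ?num_real//.
  rewrite ler_pXn2r ?nnegrE//.
  rewrite [leRHS]/Num.norm/= mx_normrE.
  by apply/bigmax_geP; right; exists (ord0, i).
by rewrite sumr_const card_ord mulr_natl.
Qed.

End euclidean.

Section convexity.
Context {R : realType} {d : nat}.
Local Notation V := 'rV[R]_d.
Implicit Types (A K : set V) (x u : V).

Definition boundary A := closure A `\` interior A.

Definition segment x y : set V := [set (1 - t) *: x + t *: y | t in `[0, 1]].

Definition translate x A : set V := [set y + x | y in A].

Definition dilate (a : R) A : set V := [set a *: y | y in A].

(* [smallest P A] is the intersection of all the [C] with [P C] and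
   [A `<=` C]. *)
Definition closed_conv A : set V :=
  smallest (fun C => closed C /\ @convex_set R V C) A.

Definition polar A : set V := [set y | forall x, A x -> dot x y <= 1].

Definition halfspace u (t : R) : set V := [set x | dot x u <= t].

Definition normal_cone K x : set V :=
  [set u | forall y, K y -> dot u (y - x) <= 0].

(* The dimension of the linear hull of [A] is [k]. *)
Definition has_dimension A (k : nat) := exists U : {vspace V},
  [/\ \dim U = k, A `<=` [set v | v \in U] &
      forall W : {vspace V}, A `<=` [set v | v \in W] -> (U <= W)%VS].

Definition regular K := forall x, boundary K x -> has_dimension (normal_cone K x) 1.

(* The boundary contains no nondegenerate segment. *)
Definition strictly_convex K :=
  forall x y, segment x y `<=` boundary K -> x = y.

(* A family [L] is indexed by the elements of a set [I] of a type [T];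
   [(J #= `I_m)%card] says that [J] has [m] elements. *)
Definition peeling (T : Type) (I : set T) (L : T -> set V) (m : nat) : set V :=
  \bigcap_(J in [set J | J `<=` I /\ (J #= `I_m)%card])
    closed_conv (\bigcup_(i in I `\` J) L i).

Definition wrapping (T : Type) (I : set T) (L : T -> set V) (m : nat) : set V :=
  closed_conv (\bigcup_(J in [set J | J `<=` I /\ (J #= `I_m)%card])
    \bigcap_(i in I `\` J) L i).

End convexity.

(* The space of compact convex sets of R^d with the origin in the interior. *)
Record body0 (R : realType) (d : nat) := Body0 {
  body_set :> set 'rV[R]_d;
  body_compact : compact body_set;
  body_convex : @convex_set R 'rV[R]_d body_set;
  body_int0 : interior body_set 0 }.
Arguments body_compact {R d} b : rename.
Arguments body_convex {R d} b : rename.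
Arguments body_int0 {R d} b : rename.

Section hausdorff.
Context {R : realType} {d : nat}.
Local Notation V := 'rV[R]_d.
Local Notation body := (body0 R d).
Implicit Types (A B C : set V) (K L M : body).

Definition dist_to x A : R := inf [set enorm (x - a) | a in A].

Definition excess A B : R := sup [set dist_to a B | a in A].

Definition hausdorff_dist A B : R := Num.max (excess A B) (excess B A).

Lemma body_ext K L : body_set K = body_set L -> K = L.
Proof.
case: K L => [A cA vA iA] [B cB vB iB] /= AB.
by subst B; congr Body0; exact: Prop_irrelevance.
Qed.

Lemma body_in0 K : body_set K 0.
Proof. exact: interior_subset (body_int0 K). Qed.

Lemma dist_to_lbound x A : has_lbound [set enorm (x - a) | a in A].
Proof. by exists 0 => _ [a _ <-]; exact: enorm_ge0. Qed.

Lemma dist_to_le x A a : A a -> dist_to x A <= enorm (x - a).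
Proof. by move=> Aa; apply: (ge_inf (dist_to_lbound x A)); exists a. Qed.

Lemma dist_to_ge x K c : (forall a, body_set K a -> c <= enorm (x - a)) ->
  c <= dist_to x K.
Proof.
move=> h; apply: lb_le_inf; first by exists (enorm (x - 0)), 0 => //; exact: body_in0.
by move=> _ [a Ka <-]; exact: h.
Qed.

Lemma dist_to_ge0 x K : 0 <= dist_to x K.
Proof. by apply: dist_to_ge => a _; exact: enorm_ge0. Qed.

Lemma excess_ubound K L : has_ubound [set dist_to a L | a in body_set K].
Proof.
have [N [_ /(_ (N + 1))]] := compact_bounded (body_compact K).
rewrite ltrDl ltr01 => /(_ isT) KN.
exists (Num.sqrt d%:R * (N + 1)) => _ [a Ka <-].
rewrite (le_trans (dist_to_le _ (body_in0 L)))// subr0.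
by rewrite (le_trans (enorm_le_norm _))// ler_wpM2l ?sqrtr_ge0//; exact: KN.
Qed.

Lemma excess_ge K L a : body_set K a -> dist_to a L <= excess K L.
Proof. by move=> Ka; apply: (ub_le_sup (excess_ubound K L)); exists a. Qed.

Lemma excess_le K L c :
  (forall a, body_set K a -> dist_to a L <= c) -> excess K L <= c.
Proof.
move=> h; apply: ge_sup; first by exists (dist_to 0 L), 0 => //; exact: body_in0.
by move=> _ [a Ka <-]; exact: h.
Qed.

Lemma excess_triangle K L M : excess K M <= excess K L + excess L M.
Proof.
apply: excess_le => a Ka; rewrite -lerBlDr (le_trans _ (excess_ge L Ka))//.
apply: dist_to_ge => b Lb; rewrite lerBlDr -lerBlDl.
rewrite (le_trans _ (excess_ge M Lb))//; apply: dist_to_ge => c Mc.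
by rewrite lerBlDl (le_trans (dist_to_le _ Mc))// ler_enorm_dist.
Qed.

Lemma excess_ge0 K L : 0 <= excess K L.
Proof. exact: le_trans (dist_to_ge0 _ _) (excess_ge _ (body_in0 K)). Qed.

Lemma excess_xx K : excess K K = 0.
Proof.
apply/eqP; rewrite eq_le excess_ge0 andbT; apply: excess_le => a Ka.
by rewrite (le_trans (dist_to_le _ Ka))// subrr enorm0.
Qed.

Lemma excess_subset K L : excess K L = 0 -> body_set K `<=` body_set L.
Proof.
move=> KL a Ka.
have cL : closed (body_set L).
  by apply: compact_closed (body_compact L); exact: norm_hausdorff.
apply: cL => U /nbhs_ballP[e /= e0 eU].
have : dist_to a L < e by rewrite (le_lt_trans (excess_ge L Ka))// KL.
move=> /inf_lt; case=> [|_ [b Lb <-] abe].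
  by exists (enorm (a - 0)), 0 => //; exact: body_in0.
exists b; split=> //; apply: eU; rewrite mx_norm_ball /ball_/=.
exact: le_lt_trans (norm_le_enorm _) abe.
Qed.

Lemma hausdorff_xx K : hausdorff_dist K K = 0.
Proof. by rewrite /hausdorff_dist excess_xx maxxx. Qed.

Lemma hausdorff_eq0 K L : hausdorff_dist K L = 0 -> K = L.
Proof.
rewrite /hausdorff_dist => KL; apply: body_ext; apply/seteqP.
have := excess_ge0 K L; have := excess_ge0 L K.
have : excess K L <= 0 by rewrite -KL le_max lexx.
have : excess L K <= 0 by rewrite -KL le_max lexx orbT.
by move=> ? ? ? ?; split; apply: excess_subset; lra.
Qed.

Lemma hausdorff_sym K L : hausdorff_dist K L = hausdorff_dist L K.
Proof. exact: maxC. Qed.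

Lemma hausdorff_triangle L K M :
  hausdorff_dist K M <= hausdorff_dist K L + hausdorff_dist L M.
Proof.
rewrite [leLHS]/hausdorff_dist ge_max; apply/andP; split.
  rewrite (le_trans (excess_triangle K L M))// lerD// /hausdorff_dist.
    by rewrite le_max lexx.
  by rewrite le_max lexx.
rewrite (le_trans (excess_triangle M L K))// addrC lerD// /hausdorff_dist.
  by rewrite le_max lexx orbT.
by rewrite le_max lexx orbT.
Qed.

Let cube : set V := [set x | `|x| <= 1].

Let cube_compact : compact cube.
Proof.
apply: bounded_closed_compact.
  by exists 1; split=> // M M1 x /= /le_trans; apply; exact: ltW.
apply: (@closed_comp _ _ (fun x : V => `|x|) [set y | y <= 1]).
  by move=> x _; exact: norm_continuous.
exact: closed_le.
Qed.

Let cube_convex : @convex_set R V cube.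
Proof.
apply/convex_setW => x y; rewrite !inE /cube/= => x1 y1 k k0 k1.
rewrite inE /= (le_trans (ler_normD _ _))// !normrZ.
have k1' : 0 <= 1 - k%:num by rewrite subr_ge0 ltW.
rewrite (ger0_norm (ltW k0)) (ger0_norm k1').
have := ler_wpM2l (ltW k0) x1; have := ler_wpM2l k1' y1; lra.
Qed.

Let cube_int0 : interior cube 0.
Proof.
apply/nbhs_ballP; exists 1 => //= x; rewrite mx_norm_ball /ball_/= sub0r normrN.
exact: ltW.
Qed.

HB.instance Definition _ := gen_eqMixin body.
HB.instance Definition _ := gen_choiceMixin body.
HB.instance Definition _ := isPointed.Build body
  (Body0 cube_compact cube_convex cube_int0).
HB.instance Definition _ := @isMetric.Build R body hausdorff_dist
  hausdorff_xx hausdorff_eq0 hausdorff_sym hausdorff_triangle.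

End hausdorff.

HB.instance Definition _ (I : Type) (T : ptopologicalType) :=
  isPointed.Build {ptws I -> T} (fun=> point).

Notation borel T := (g_sigma_algebraType (@open T)).

(* The d-dimensional Lebesgue measure of a Borel set, as the d-fold product of
   the one-dimensional one: the measure of the section at the first coordinate
   is integrated over that coordinate. *)
Fixpoint volume (R : realType) (d : nat) : set 'rV[R]_d -> \bar R :=
  match d with
  | 0 => fun A => (\1_A (0 : 'rV[R]_0))%:E
  | d'.+1 => fun A =>
      (\int[@lebesgue_measure R]_x
        volume [set y : 'rV[R]_d' | A (row_mx x%:M y : 'rV[R]_(1 + d'))])%E
  end.

Section surface_area.
Context {R : realType} {d : nat}.
Local Notation V := 'rV[R]_d.
Implicit Types (K w : set V) (r : R).

(* The points at distance in ]0, r] from [K], whose direction seen from their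
   nearest point in [K] is in [w]. *)
Definition local_parallel K w r : set V :=
  [set x | exists p u s, [/\ x = p + s *: u, w u /\ enorm u = 1,
    0 < s <= r, K p & forall q, K q -> enorm (x - p) <= enorm (x - q)]].

(* By the local Steiner formula, the volume of [local_parallel K w r] is
   sum_(j < d) r^(d - j) * 'C(d, j) / d * S_j(K, w) for the area measures S_j
   of K. The surface area measure S_(d-1) is the coefficient of [r]; for a
   convex body, S_(d-1)(K, w) is the (d-1)-dimensional Hausdorff measure of the
   set of the boundary points of K which have an outer unit normal in w. *)
Definition surface_area_measure K w : \bar R :=
  (lim ((volume (local_parallel K w r) * (r^-1)%:E) @[r --> 0^'+]))%E.

(* V_d(K)^-1 dt S_(d-1)(K, du) on ]0, +oo[ x S^(d-1) *)
Definition intensity K (B : set (measurableTypeR R * borel V)) : \bar R :=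
  (((fine (volume K))^-1)%:E * \int[@lebesgue_measure R]_(t in `]0%R, +oo[)
    surface_area_measure K [set u | B (t, u)])%E.

End surface_area.

Section probability.
Context {R : realType} {dO : measure_display} {Omega : measurableType dO}.
Variable P : probability Omega R.

Definition mutually_independent dT (T : measurableType dT)
    (X : nat -> Omega -> T) :=
  forall (J : {fset nat}) (B : nat -> set T),
    (forall j, j \in J -> measurable (B j)) ->
    P (\bigcap_(j in [set` J]) (X j @^-1` B j)) =
    (\prod_(j <- J) P (X j @^-1` B j))%E.

Definition uniformly_distributed d (K : set 'rV[R]_d)
    (X : Omega -> borel 'rV[R]_d) :=
  forall B : set (borel 'rV[R]_d), measurable B ->
    P (X @^-1` B) = (volume (K `&` B) * ((fine (volume K))^-1)%:E)%E.

(* A Poisson process given by a measurable enumeration of its points.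
   [poisson_prob a 0 [set k]] is the probability of [k] under the Poisson law of
   mean [a], which is the Dirac law at 0 when [a] is 0 (the second argument of
   [poisson_prob] is not used in its definition). *)
Definition poisson_process dT (T : measurableType dT) (L : set T -> \bar R)
    (x : nat -> Omega -> T) :=
  (forall i, measurable_fun setT (x i)) /\
  forall (k : nat) (B : 'I_k -> set T) (c : 'I_k -> nat),
    (forall j, measurable (B j)) -> trivIset setT B ->
    (forall j, L (B j) < +oo)%E ->
    P (\bigcap_j [set o | ([set i | B j (x i o)] #= `I_(c j))%card]) =
    (\prod_(j < k) poisson_prob (fine (L (B j))) 0 [set c j])%E.

End probability.

Section convergence.
Context {R : realType} {d m : nat}.
Context {dO dO' : measure_display}.
Context {Omega : measurableType dO} {Omega' : measurableType dO'}.
Variables (P : probability Omega R) (P' : probability Omega' R).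
Local Notation bodies := {ptws 'I_m -> body0 R d}.

Definition cvg_in_law (T : topologicalType) (Y_ : nat -> Omega -> T)
    (Y : Omega' -> T) :=
  forall f : T -> R, continuous f -> (exists M, forall y, `|f y| <= M) ->
    'E_P[f \o Y_ n]%E @[n --> \oo] --> 'E_P'[f \o Y]%E.

(* [Y] is a random element of the product of m copies of the space of bodies,
   with the Borel sigma-algebra of the product topology, and its components
   are almost surely the sets [U]. *)
Definition is_random_body_vector dO (Omega : measurableType dO)
    (P : probability Omega R) (U : Omega -> 'I_m -> set 'rV[R]_d)
    (Y : Omega -> borel bodies) :=
  measurable_fun setT Y /\ {ae P, forall o, forall r, U o r = Y o r}.

(* Convergence in distribution of vectors of random sets which are almost
   surely in the space of bodies, for n large enough in the case of [U_ n]. *)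
Definition cvg_in_law_bodies (U_ : nat -> Omega -> 'I_m -> set 'rV[R]_d)
    (U : Omega' -> 'I_m -> set 'rV[R]_d) :=
  exists (Y_ : nat -> Omega -> borel bodies) (Y : Omega' -> borel bodies),
    [/\ \forall n \near \oo, is_random_body_vector P (U_ n) (Y_ n),
        is_random_body_vector P' U Y &
        cvg_in_law (Y_ : nat -> Omega -> bodies) (Y : Omega' -> bodies)].

End convergence.

(* Main.v *)
(* A point x belongs to the r-th peeling of a family of sets containing the origin
   if and only if, for every direction u and every 0 <= c < <x, u>, more than r
   members of the family reach beyond the level c in the direction u. Thus two
   families have close peelings as soon as, up to a small shift of c, each member
   of one that passes a level can be matched with a member of the other.

   Let g be the gauge of K, which is C^1 off the origin since K is regular. The set
   n^-1 (K - x)^o is, above any positive level, close to the segment [0, t^-1 u],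
   where t = n (1 - g x) / |grad g x| and u is the unit vector along grad g x. For t
   in [a, b[ and u in a set w of directions, such x form a thin shell, of volume
   close to n^-1 (b - a) S(w), as S(w) = d * (integral of |grad g| over the cone
   spanned by the boundary points of K with normal in w). So the numbers of sample
   points in finitely many cells have a multinomial law, which converges to the
   law of the numbers of Poisson points in these cells. When the numbers agree and
   the cells are small, the peelings are close: the law of the peelings on either
   side is approximated by the same finitely many bodies with convergent weights.

   The wrapping of a family of polars is the polar of the peeling, and polarity is
   continuous for the Hausdorff metric. *)

From HB Require Import structures.
Require Import Defs.
From mathcomp Require Import all_boot all_order all_algebra finmap.
From mathcomp Require Import all_classical all_reals all_analysis.
From mathcomp Require Import measurable_realfun ring lra zify.

Set Implicit Arguments.
Unset Strict Implicit.
Unset Printing Implicit Defensive.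

Import Order.TTheory GRing.Theory Num.Theory.
Import numFieldNormedType.Exports.

Local Open Scope classical_set_scope.
Local Open Scope ring_scope.

(** * Convex sets and polarity *)

(** Levels turn into Hausdorff distance only through a ball inside the sets: a shift by e costs the
    factor 1 + e / rho when the ball of radius rho is inside. Such a rho cannot be read off the
    sample, where the evident radius is of order 1 / n. It comes from the Poisson points, since
    finitely many cells of directions with positive area see every direction, and equal counts carry
    it to the sample. An upper bound on the sets is obtained in the same way, from an empty cell of
    early times. The surface area measure is a limit, computed here only for sets of directions with
    null boundary; so the cells are boxes with thresholds chosen off a null set. The two probability
    spaces are unrelated: events on both sides are indexed by finite tables of counts, and a test
    function is replaced by its value at one reference outcome per table. Measurability of the
    random vectors is obtained from approximations with countably many values. *)

Section dot_product.
Context {R : realType} {d : nat}.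
Implicit Types x y z u : 'rV[R]_d.

Lemma dotC x y : dot x y = dot y x.
Proof. by apply: eq_bigr => i _; rewrite mulrC. Qed.

Lemma dotDl x y z : dot (x + y) z = dot x z + dot y z.
Proof. by rewrite /dot -big_split; apply: eq_bigr => i _; rewrite mxE mulrDl. Qed.

Lemma dotZl (a : R) x y : dot (a *: x) y = a * dot x y.
Proof. by rewrite /dot mulr_sumr; apply: eq_bigr => i _; rewrite mxE mulrA. Qed.

Lemma dotDr x y z : dot z (x + y) = dot z x + dot z y.
Proof. by rewrite dotC dotDl !(dotC z). Qed.

Lemma dotZr (a : R) x y : dot x (a *: y) = a * dot x y.
Proof. by rewrite dotC dotZl dotC. Qed.

Lemma dotNl x y : dot (- x) y = - dot x y.
Proof. by rewrite -scaleN1r dotZl mulN1r. Qed.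

Lemma dotNr x y : dot x (- y) = - dot x y.
Proof. by rewrite dotC dotNl dotC. Qed.

Lemma dotBl x y z : dot (x - y) z = dot x z - dot y z.
Proof. by rewrite dotDl dotNl. Qed.

Lemma dotBr x y z : dot z (x - y) = dot z x - dot z y.
Proof. by rewrite dotDr dotNr. Qed.

Lemma dot0l x : dot 0 x = 0.
Proof. by rewrite -(scale0r x) dotZl mul0r. Qed.

Lemma dot0r x : dot x 0 = 0.
Proof. by rewrite dotC dot0l. Qed.

Lemma dotxx x : dot x x = enorm x ^+ 2.
Proof. by rewrite sqr_enorm. Qed.

Lemma enormZ (a : R) x : enorm (a *: x) = `|a| * enorm x.
Proof.
by rewrite /enorm dotZl dotZr mulrA -expr2 sqrtrM ?sqr_ge0// sqrtr_sqr.
Qed.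

Lemma enorm_eq0 x : enorm x = 0 -> x = 0.
Proof. by move=> x0; apply: dot_eq0; rewrite dotxx x0 expr0n. Qed.

Lemma enorm_gt0 x : x != 0 -> 0 < enorm x.
Proof.
move=> x0; rewrite lt_neqAle enorm_ge0 andbT eq_sym.
by apply: contra_neq x0 => /enorm_eq0.
Qed.

Lemma ler_dot_enorm x y : `|dot x y| <= enorm x * enorm y.
Proof.
rewrite ler_norml cauchy_schwarz andbT lerNl -dotNl.
by rewrite (le_trans (cauchy_schwarz _ _))// enormN.
Qed.

Lemma enorm_dist_le x y : enorm x - enorm y <= enorm (x - y).
Proof. by rewrite lerBlDr -{1}(subrK y x) ler_enormD. Qed.

Lemma enorm_unit x : x != 0 -> enorm ((enorm x)^-1 *: x) = 1.
Proof.
move=> /enorm_gt0 x0; rewrite enormZ ger0_norm ?invr_ge0 ?enorm_ge0//.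
by rewrite mulVf// gt_eqF.
Qed.

Lemma dot_self_le_enorm x (r : R) : 0 <= r ->
  (forall u, enorm u = 1 -> dot x u <= r) -> enorm x <= r.
Proof.
move=> r0 h; have [->|x0] := eqVneq x 0; first by rewrite enorm0.
have := h _ (enorm_unit x0); rewrite dotZr dotxx expr2 mulrA mulVf ?mul1r//.
by rewrite gt_eqF ?enorm_gt0.
Qed.

Lemma dot_continuous y : continuous (fun x => dot x y).
Proof.
apply: continuous_big => [|i _]; first exact: add_continuous.
move=> x; apply: (@continuousM R _ (fun x : 'rV[R]_d => x ord0 i) (fun=> y ord0 i)).
  exact: coord_continuous.
exact: cst_continuous.
Qed.

Lemma dotxx_continuous : continuous (fun x => dot x x).
Proof.
apply: continuous_big => [|i _]; first exact: add_continuous.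
move=> x; apply: (@continuousM R _ (fun x : 'rV[R]_d => x ord0 i) (fun x : 'rV[R]_d => x ord0 i)); exact: coord_continuous.
Qed.

Lemma enorm_continuous : continuous (@enorm R d).
Proof.
move=> x; apply: (@continuous_comp _ _ _ (fun x => dot x x) Num.sqrt).
  exact: dotxx_continuous.
exact: sqrt_continuous.
Qed.

Lemma enormB_continuous x : continuous (fun y => enorm (y - x)).
Proof.
move=> y; apply: (@continuous_comp _ _ _ (fun z => z - x) (@enorm R d)).
  by apply: (@continuousB _ _ _ (fun z => z) (fun=> x)) => //; exact: cst_continuous.
exact: enorm_continuous.
Qed.

(** The topology of row vectors comes from the sup norm; comparing the two norms lets every later
    neighbourhood be a Euclidean ball. *)
Lemma nbhs_enormP x (A : set 'rV[R]_d) :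
  nbhs x A <-> exists2 e, 0 < e & forall y, enorm (y - x) < e -> A y.
Proof.
split=> [/nbhs_ballP[e /= e0 eA]|[e e0 eA]].
  exists e => // y yx; apply: eA; rewrite mx_norm_ball /ball_/= distrC.
  exact: le_lt_trans (norm_le_enorm _) yx.
have h : \forall y \near x, enorm (y - x) < e.
  have : nbhs (enorm (x - x)) [set t | t < e].
    by rewrite subrr enorm0; exact: lt_nbhsl.
  exact: (@enormB_continuous x x).
by apply: filterS h => y; exact: eA.
Qed.

Lemma continuous_enormP (f : 'rV[R]_d -> R) x :
  (forall e, 0 < e -> exists2 a, 0 < a & forall y, enorm (y - x) < a ->
    `|f x - f y| < e) -> {for x, continuous f}.
Proof.
move=> h A /nbhs_ballP[e /= e0 eA]; have [a a0 ha] := h e e0.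
by apply/nbhs_enormP; exists a => // y yx; apply: eA; exact: ha.
Qed.

Lemma bounded_enormP (A : set 'rV[R]_d) (M : R) :
  (forall x, A x -> enorm x <= M) -> bounded_set A.
Proof.
move=> AM; exists M; split; first exact: num_real.
move=> N MN x Ax /=; rewrite (le_trans (norm_le_enorm _))//.
by rewrite (le_trans (AM _ Ax))// ltW.
Qed.

Lemma compact_enorm (A : set 'rV[R]_d) : compact A ->
  exists2 M, 0 < M & forall x, A x -> enorm x <= M.
Proof.
move=> /compact_bounded[N [_ /(_ (N + 1))]]; rewrite ltrDl ltr01 => /(_ isT) KN.
exists (Num.sqrt d%:R * (`|N| + 1) + 1) => [|x Ax].
  by rewrite ltr_wpDl// mulr_ge0 ?sqrtr_ge0// addr_ge0.
rewrite (le_trans (enorm_le_norm _))// -[leLHS]addr0 lerD//.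
rewrite ler_wpM2l ?sqrtr_ge0// (le_trans (KN _ Ax))// lerD2r ler_norm//.
Qed.

End dot_product.

Section convex_sets.
Context {R : realType} {d : nat}.
Local Notation V := 'rV[R]_d.
Implicit Types (A C : set V) (x y u : V).

Lemma convexP A : @convex_set R V A <-> forall x y t, A x -> A y ->
  0 <= t -> t <= 1 -> A (t *: x + (1 - t) *: y).
Proof.
split=> [/convex_setW Ac x y t Ax Ay|Ac].
  rewrite le_eqVlt => /orP[/eqP <- _|t0].
    by rewrite scale0r add0r subr0 scale1r.
  rewrite le_eqVlt => /orP[/eqP ->|t1].
    by rewrite subrr scale0r addr0 scale1r.
  have t01 : Itv.spec (@Itv.num_sem R) (Itv.Real `[0%Z, 1%Z]) t.
    apply/and3P; split=> //; first exact: num_real.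
    by rewrite /= bnd_simp ltW.
    by rewrite /= bnd_simp ltW.
  have := Ac x y; rewrite !inE => /(_ Ax Ay (Itv.mk t01) t0 t1).
  by rewrite inE.
apply/convex_setW => x y; rewrite !inE => Ax Ay k k0 k1; rewrite inE.
exact: Ac Ax Ay (ltW k0) (ltW k1).
Qed.

Lemma closed_conv_closed A : closed (closed_conv A).
Proof.
rewrite /closed_conv /smallest; apply: closed_bigI => C [[]]//.
Qed.

Lemma closed_conv_convex A : @convex_set R V (closed_conv A).
Proof.
apply/convexP => x y t Ax Ay t0 t1 C [[cC vC] AC].
by apply: (convexP C).1 => //; [exact: Ax|exact: Ay].
Qed.

Lemma sub_closed_conv A : A `<=` closed_conv A.
Proof. by move=> x Ax C [_]; exact. Qed.

Lemma closed_conv_min A C : closed C -> @convex_set R V C -> A `<=` C ->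
  closed_conv A `<=` C.
Proof. by move=> cC vC AC x; apply. Qed.

Lemma closed_halfspace u (c : R) : closed (halfspace u c).
Proof.
apply: (@preimage_closed _ _ (fun x => dot x u) [set t | t <= c]).
  by move=> x _; exact: dot_continuous.
exact: closed_le.
Qed.

Lemma convex_halfspace u (c : R) : @convex_set R V (halfspace u c).
Proof.
apply/convexP => x y t; rewrite /halfspace/= dotDl !dotZl => xc yc t0 t1.
have t1' : 0 <= 1 - t by rewrite subr_ge0.
by have := ler_wpM2l t0 xc; have := ler_wpM2l t1' yc; lra.
Qed.

Lemma nearest_point C x : closed C -> C !=set0 ->
  exists2 p, C p & forall q, C q -> enorm (x - p) <= enorm (x - q).
Proof.
move=> cC [c0 Cc0].
pose f y := enorm (x - y).
have fc : continuous f.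
  rewrite (_ : f = fun y => enorm (y - x)); first exact: enormB_continuous.
  by apply/funext => y; exact: enormB.
(* [C] may be unbounded, so the minimum is taken over its points that are no farther from [x] than
   [c0]. *)
pose B := C `&` [set y | f y <= f c0].
have cB : compact B.
  apply: bounded_closed_compact.
    apply: (@bounded_enormP _ _ _ (f c0 + enorm x)) => y [_ /=].
    rewrite /f -{1}(opprB y) enormN => yc.
    by have := enorm_dist_le y x; lra.
  apply: closedI => //.
  apply: (@preimage_closed _ _ f [set t | t <= f c0]); last exact: closed_le.
  by move=> y _; exact: fc.
have B0 : B !=set0 by exists c0; split=> //=.
have [|p] := @compact_EVT_min _ _ f B B0 cB.
  exact: continuous_subspaceT.
rewrite inE => -[Cp fp] pmin; exists p => // q Cq.
have [qc|/ltW qc] := leP (f q) (f c0); first by apply: pmin; rewrite inE.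
exact: le_trans fp qc.
Qed.

Lemma nearest_point_normal C x p : @convex_set R V C -> C p ->
  (forall q, C q -> enorm (x - p) <= enorm (x - q)) ->
  forall q, C q -> dot (x - p) (q - p) <= 0.
Proof.
move=> /convexP vC Cp pmin q Cq; rewrite leNgt; apply/negP => a0.
set a := dot _ _ in a0; pose b := dot (q - p) (q - p).
have b0 : 0 <= b by exact: dot_ge0.
(* Moving from [p] to [q] by the fraction [t] changes the squared distance by [t * (t * b - 2 * a)],
   which is negative as [t * b <= a]; dividing by [a + b] keeps [t] at most 1 without a case
   distinction. *)
pose t := a / (a + b).
have ab : 0 < a + b by rewrite ltr_pwDl.
have t0 : 0 < t by rewrite divr_gt0.
have t1 : t <= 1 by rewrite ler_pdivrMr// mul1r lerDl.
have := pmin _ (vC _ _ _ Cq Cp (ltW t0) t1).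
rewrite -(@ler_pXn2r _ 2)// ?nnegrE ?enorm_ge0// !sqr_enorm.
have -> : x - (t *: q + (1 - t) *: p) = 1 *: (x - p) + (- t) *: (q - p).
  by apply/rowP => i; rewrite !mxE; ring.
rewrite dot_comb -/a -/b expr1n !mul1r sqrrN => h.
have : t * a < 0 \/ t * (t * b - 2 * a) < 0.
  right; rewrite pmulr_rlt0//.
  have : t * (a + b) = a by rewrite divfK// gt_eqF.
  have : 0 < t * a by rewrite mulr_gt0.
  lra.
case=> h'; first by have := mulr_gt0 t0 a0; lra.
by move: h'; rewrite mulrBr; lra.
Qed.

Lemma separation C x : closed C -> @convex_set R V C -> C !=set0 -> ~ C x ->
  exists u c, [/\ enorm u = 1, c < dot x u & forall y, C y -> dot y u <= c].
Proof.
move=> cC vC C0 Cx; have [p Cp pmin] := nearest_point x cC C0.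
have xp : x - p != 0 by rewrite subr_eq0; apply: contra_notN Cx => /eqP ->.
have n0 := enorm_gt0 xp.
exists ((enorm (x - p))^-1 *: (x - p)), (dot p ((enorm (x - p))^-1 *: (x - p))).
split; first exact: enorm_unit.
  rewrite -subr_gt0 -dotBl dotZr dotxx expr2 mulrA mulVf ?mul1r//.
  by rewrite gt_eqF.
move=> y Cy; rewrite -subr_le0 -dotBl dotZr dotC pmulr_rle0 ?invr_gt0//.
exact: nearest_point_normal Cy.
Qed.

Lemma polar_closed A : closed (polar A).
Proof.
rewrite (_ : polar A = \bigcap_(x in A) halfspace x 1).
  by apply: closed_bigI => x _; exact: closed_halfspace.
by apply/seteqP; split=> y Ay x Ax; have := Ay x Ax; rewrite /halfspace/= dotC.
Qed.

Lemma polar_convex A : @convex_set R V (polar A).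
Proof.
apply/convexP => x y t Ax Ay t0 t1 z Az; rewrite dotC.
by apply: (convexP (halfspace z 1)).1 => //;
  [exact: convex_halfspace|rewrite /halfspace/= dotC; exact: Ax|
   rewrite /halfspace/= dotC; exact: Ay].
Qed.

Lemma polar0 A : polar A 0.
Proof. by move=> x _; rewrite dot0r. Qed.

Lemma polarS A C : A `<=` C -> polar C `<=` polar A.
Proof. by move=> AC y Cy x /AC; exact: Cy. Qed.

Lemma bipolar C : closed C -> @convex_set R V C -> C 0 -> polar (polar C) = C.
Proof.
move=> cC vC C0; apply/seteqP; split=> [x h|x Cx y]; last first.
  by rewrite dotC; exact.
apply: contrapT => Cx.
have [u [c [u1 cx Cc]]] := separation cC vC (ex_intro _ _ C0) Cx.
have c0 : 0 <= c by have := Cc _ C0; rewrite dot0l.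
(* [c] may be 0, so the normal is divided by a level strictly between [c] and [dot x u], which is
   positive. *)
pose c' := (c + dot x u) / 2.
have cc' : c < c' by rewrite /c' ltr_pdivlMr//; lra.
have c'x : c' < dot x u by rewrite /c' ltr_pdivrMr//; lra.
have c'0 : 0 < c' by exact: le_lt_trans cc'.
have /h : polar C (c'^-1 *: u).
  move=> y Cy; rewrite dotZr mulrC ler_pdivrMr// mul1r.
  by rewrite (le_trans (Cc _ Cy))// ltW.
by rewrite dotZl dotC mulrC ler_pdivrMr// mul1r leNgt c'x.
Qed.

Lemma polar_closed_conv A : polar (closed_conv A) = polar A.
Proof.
apply/seteqP; split; first by apply: polarS; exact: sub_closed_conv.
move=> y Ay x; rewrite dotC => xA; move: x xA.
have : closed_conv A `<=` halfspace y 1.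
  apply: closed_conv_min; [exact: closed_halfspace|exact: convex_halfspace|].
  by move=> x Ax; exact: Ay.
by move=> h x /h; rewrite /halfspace/= dotC.
Qed.

End convex_sets.

(** * Peelings and level sets *)

Section cardinals.

Lemma card_le_inj (T U : Type) (A : set T) (B : set U) (f : T -> U) :
  {in A &, injective f} -> (forall x, A x -> B (f x)) -> (A #<= B)%card.
Proof.
move=> /inj_card_eq fA AB; rewrite -(card_le_eql fA).
by apply: subset_card_le => _ [x Ax <-]; exact: AB.
Qed.

(** Level sets can be infinite, so sizes are compared with initial segments of the naturals instead
    of being numbers. *)
Lemma card_gtVle (T : Type) (r : nat) (A : set T) :
  (`I_r.+1 #<= A)%card \/ exists2 n, (n <= r)%N & (A #= `I_n)%card.
Proof.
have [fA|iA] := pselect (finite_set A); last first.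
  left; move/infiniteP: iA => iA; apply: (card_le_trans _ iA).
  exact: card_leT.
have [n An] := (finite_setP A).1 fA.
have [nr|rn] := leqP n r; first by right; exists n.
by left; rewrite (card_le_eqr An) card_le_II.
Qed.

Lemma card_setU1 (T : eqType) (x : T) (A : set T) n : ~ A x ->
  (A #= `I_n)%card -> (x |` A #= `I_n.+1)%card.
Proof.
move=> Ax /card_set_bijP[f [fA finj fsurj]].
apply/card_set_bijP; exists (fun y => if y == x then n else f y); split.
- by move=> y [->|Ay] /=; rewrite ?eqxx//; case: eqP => //= _; apply: ltnW; exact: fA.
- move=> y z; rewrite !inE => -[->|Ay] [->|Az]//; rewrite ?eqxx.
  + case: eqP => // _ nz; have := fA _ Az; rewrite /= -nz ltnn//.
  + case: eqP => // _ nz; have := fA _ Ay; rewrite /= nz ltnn//.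
  + case: eqP => [yx|_]; first by rewrite yx in Ay.
    case: eqP => [zx|_]; first by rewrite zx in Az.
    by apply: finj; rewrite inE.
- move=> k /=; rewrite ltnS leq_eqVlt => /orP[/eqP ->|kn].
    by exists x; [left|rewrite /= eqxx].
  have [y Ay <-] := fsurj k kn; exists y; first by right.
  by case: eqP => // yx; rewrite yx in Ay.
Qed.

(** A peeling removes exactly [r] members, while a level set may have fewer: the missing ones are
    added one at a time, which the size of [I] allows. *)
Lemma card_extend (T : eqType) (A I : set T) s r : A `<=` I ->
  (A #= `I_s)%card -> (s <= r)%N -> (`I_r.+1 #<= I)%card ->
  exists J, [/\ A `<=` J, J `<=` I & (J #= `I_r)%card].
Proof.
move=> AI As /subnKC <-; move: (r - s)%N => k.
elim: k s A AI As => [|k IH] s A AI As; rewrite ?addn0 => Ir.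
  by exists A; split.
have [x Ix Ax] : exists2 x, I x & ~ A x.
  apply: contrapT => h.
  have IA : I `<=` A by move=> x Ix; apply: contrapT => Ax; apply: h; exists x.
  have := card_le_trans Ir (subset_card_le IA).
  by rewrite (card_le_eqr As) card_le_II; lia.
have xAI : x |` A `<=` I by move=> y [->//|]; exact: AI.
have [|J [AJ JI Jk]] := IH s.+1 _ xAI (card_setU1 Ax As).
  by rewrite addSnnS.
exists J; split=> //; last by rewrite addnS -addSn.
by move=> y Ay; apply: AJ; right.
Qed.

(** Each point of the left union is sent through the bijection of one cell that contains it.
    Disjointness of the [B j] recovers the cell from the image, so the map is injective even if the
    [A j] overlap. *)
Lemma card_le_bigcup (T U J : Type) (A : J -> set T) (B : J -> set U)
    (P Q : set J) : P `<=` Q -> trivIset setT B ->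
  (forall j, P j -> (A j #= B j)%card) ->
  (\bigcup_(j in P) A j #<= \bigcup_(j in Q) B j)%card.
Proof.
elim/Ppointed: U => U in B *.
  move=> PQ tB AB; have A0 : \bigcup_(j in P) A j = set0.
    apply/seteqP; split=> // x [j Pj Ajx].
    have := AB j Pj; rewrite card_eq_emptyr => /eqP Aj0.
    by rewrite Aj0 in Ajx.
  by rewrite A0 card_ge0.
move=> PQ tB AB.
have /choice[f fP] : forall j, exists f : T -> U, P j -> set_bij (A j) (B j) f.
  move=> j; have [Pj|] := pselect (P j); last by exists (fun=> point).
  by have /card_set_bijP[f fj] := AB j Pj; exists f.
pose S := \bigcup_(j in P) A j.
have /choice[h hP] : forall x, exists j : option J,
    S x -> exists2 k, j = Some k & P k /\ A k x.
  move=> x; have [[k Pk Akx]|] := pselect (S x); last by exists None.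
  by exists (Some k) => _; exists k.
pose g x := if h x is Some k then f k x else point.
apply: (@card_le_inj _ _ _ _ g).
  move=> x y; rewrite !inE => Sx Sy; rewrite /g.
  have [k hk [Pk Akx]] := hP _ Sx; have [l hl [Pl Aly]] := hP _ Sy.
  rewrite hk hl => fxy.
  have [fk ik _] := fP _ Pk; have [fl _ _] := fP _ Pl.
  have kl : k = l.
    by apply: tB => //; exists (f k x); split; [exact: fk|rewrite fxy; exact: fl].
  by subst l; apply: ik; rewrite ?inE.
move=> x Sx; rewrite /g; have [k -> [Pk Akx]] := hP _ Sx.
by exists k; [exact: PQ|have [fk _ _] := fP _ Pk; exact: fk].
Qed.

End cardinals.

Section peeling_levels.
Context {R : realType} {d : nat}.
Local Notation V := 'rV[R]_d.

Definition level (T : Type) (I : set T) (L : T -> set V) (u : V) (c : R) : set T :=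
  [set i | I i /\ exists2 y, L i y & c < dot y u].

(** The index type enters through cardinalities only, so cores of families over different types can
    be compared. Levels below 0 are left out: a member containing the origin passes them all. *)
Definition core (T : Type) (I : set T) (L : T -> set V) (r : nat) : set V :=
  [set x | forall u c, enorm u = 1 -> 0 <= c -> c < dot x u ->
    (`I_r.+1 #<= level I L u c)%card].

(** The counting form of a ball of radius [rho] inside the core; in this form it passes to a
    dominating family at the cost of the shift. *)
Definition deep (rho : R) (T : Type) (I : set T) (L : T -> set V) (r : nat) :=
  forall u c, enorm u = 1 -> 0 <= c -> c < rho ->
    (`I_r.+1 #<= level I L u c)%card.

(** As [r] does not occur, one comparison of counts at shifted levels serves the peelings of all
    orders at once. *)
Definition dominated (e : R) (T T' : Type) (I : set T) (L : T -> set V)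
    (I' : set T') (L' : T' -> set V) :=
  forall u c, enorm u = 1 -> 0 <= c ->
    (level I L u (c + e) #<= level I' L' u c)%card.

(** If at most [r] members pass a level, removing them leaves the hull of the others in a
    half-space. Conversely, a point outside the hull left by removing [J] is separated from it, and
    all members passing the separating level are in [J]. Some member remains, as there are more than
    [r]; it contains the origin, which makes that level nonnegative. *)
Lemma peelingE (T : eqType) (I : set T) (L : T -> set V) r :
  (forall i, I i -> L i 0) -> (`I_r.+1 #<= I)%card ->
  peeling I L r = core I L r.
Proof.
move=> L0 Ir; apply/seteqP; split=> x.
  move=> px u c u1 c0 cx; have [//|[s sr As]] := card_gtVle r (level I L u c).
  have [|J [AJ JI Jr]] := card_extend _ As sr Ir; first by move=> i [].
  have : halfspace u c x.
    move: (px J); apply => //; split.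
      by split; [exact: closed_halfspace|exact: convex_halfspace].
    move=> y [i [Ii Ji] Ly]; rewrite /halfspace/= leNgt; apply/negP => cy.
    by apply: Ji; apply: AJ; split=> //; exists y.
  by rewrite /halfspace/= leNgt cx.
move=> cx J [JI Jr]; apply: contrapT => nx.
set U := \bigcup_(i in _) _ in nx.
have U0 : U 0.
  apply: contrapT => nU0.
  have IJ : I `<=` J.
    move=> i Ii; apply: contrapT => Ji; apply: nU0; exists i => //; exact: L0.
  have := card_le_trans Ir (subset_card_le IJ).
  by rewrite (card_le_eqr Jr) card_le_II ltnn.
have [||u [c [u1 cxu Uc]]] := separation (closed_conv_closed (A := U)) _ _ nx.
- exact: closed_conv_convex.
- by exists 0; exact: sub_closed_conv.
have c0 : 0 <= c.
  by have := Uc _ (sub_closed_conv U0); rewrite dot0l.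
have := cx u c u1 c0 cxu; apply/negP.
have sJ : level I L u c `<=` J.
  move=> i [Ii [y Ly cy]]; apply: contrapT => Ji.
  have := Uc y; rewrite leNgt cy => h; suff : false by [].
  by apply: h; apply: sub_closed_conv; exists i.
apply/negP => h; have := card_le_trans h (subset_card_le sJ).
by rewrite (card_le_eqr Jr) card_le_II ltnn.
Qed.

Lemma level_image (T U : Type) (f : U -> T) (I : set U) (L : T -> set V) u c :
  {in I &, injective f} ->
  (level (f @` I) L u c #= level I (L \o f) u c)%card.
Proof.
move=> fI; have -> : level (f @` I) L u c = f @` level I (L \o f) u c.
  apply/seteqP; split=> [_ [[i Ii <-] [y Ly cy]]|_ [i [Ii [y Ly cy]] <-]].
    by exists i => //; split=> //; exists y.
  by split; [exists i|exists y].
apply: inj_card_eq => i j; rewrite !inE => -[Ii _] [Ij _].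
by apply: fI; rewrite inE.
Qed.

(** The limit peeling is indexed by the set of the points of the process, and the proof by their
    numbers in the enumeration. *)
Lemma core_image (T U : Type) (f : U -> T) (I : set U) (L : T -> set V) r :
  {in I &, injective f} -> core (f @` I) L r = core I (L \o f) r.
Proof.
move=> fI; apply/seteqP; split=> x cx u c u1 c0 cxu.
  by have := cx u c u1 c0 cxu; rewrite (card_le_eqr (level_image _ _ _ fI)).
by rewrite (card_le_eqr (level_image _ _ _ fI)); exact: cx.
Qed.

Section fixed_family.
Context {T : Type} (I : set T) (L : T -> set V).

Lemma level_anti u c c' : c <= c' -> level I L u c' `<=` level I L u c.
Proof.
by move=> cc i [Ii [y Ly cy]]; split=> //; exists y => //; exact: le_lt_trans cy.
Qed.

Lemma core_closed_convex r : closed (core I L r) /\ @convex_set R V (core I L r).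
Proof.
have E : core I L r = \bigcap_(p in [set p : V * R | [/\ enorm p.1 = 1, 0 <= p.2 &
    ~ (`I_r.+1 #<= level I L p.1 p.2)%card]]) halfspace p.1 p.2.
  apply/seteqP; split=> x h.
    move=> [u c] /= [u1 c0 nl]; rewrite /halfspace/= leNgt; apply/negP => cx.
    exact/nl/h.
  move=> u c u1 c0 cx; apply: contrapT => nl; have /= hc := h (u, c).
  by have := hc (And3 u1 c0 nl); rewrite /halfspace/= leNgt cx.
rewrite {}E; split; first by apply: closed_bigI => p _; exact: closed_halfspace.
apply/convexP => x y t hx hy t0 t1 p hp.
by apply: (convexP _).1 => //; [exact: convex_halfspace|exact: hx|exact: hy].
Qed.

Lemma core_bounded r M : 0 <= M ->
  (forall i y, I i -> L i y -> enorm y <= M) ->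
  forall x, core I L r x -> enorm x <= M.
Proof.
move=> M0 LM x cx; apply: dot_self_le_enorm => // u u1; rewrite leNgt; apply/negP => Mx.
have := cx u M u1 M0 Mx; rewrite (_ : level _ _ _ _ = set0).
  by move=> /card_le0P; rewrite -subset0 => /(_ 0%N); exact.
apply/seteqP; split=> // i [Ii [y Ly]].
rewrite ltNge => /negP; apply; rewrite (le_trans (cauchy_schwarz _ _))// u1 mulr1.
exact: LM Ly.
Qed.

Lemma deep_core rho r x : deep rho I L r -> enorm x <= rho -> core I L r x.
Proof.
move=> dL xr u c u1 c0 cx; apply: dL => //; apply: (lt_le_trans cx).
by rewrite (le_trans (cauchy_schwarz _ _))// u1 mulr1.
Qed.

Lemma deepS rho r s : (s <= r)%N -> deep rho I L r -> deep rho I L s.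
Proof.
move=> sr dL u c u1 c0 cr; apply: card_le_trans (dL u c u1 c0 cr).
by rewrite card_le_II.
Qed.

Lemma deep_dominated e rho r (T' : Type) (I' : set T') (L' : T' -> set V) :
  0 <= e -> deep rho I L r -> dominated e I L I' L' -> deep (rho - e) I' L' r.
Proof.
move=> e0 dL LL' u c u1 c0 cr; apply: card_le_trans (LL' u c u1 c0).
by apply: dL => //; [rewrite addr_ge0|rewrite -ltrBrDr].
Qed.

(** Depth of [L'] settles the levels below [rho]. Above [rho], dividing the point by [1 + e / rho]
    lowers its level by at least [e], which pays for the shift. *)
Lemma core_dominated e rho r (T' : Type) (I' : set T') (L' : T' -> set V) x :
  0 <= e -> 0 < rho -> deep rho I' L' r -> dominated e I L I' L' ->
  core I L r x -> core I' L' r ((1 + e / rho)^-1 *: x).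
Proof.
move=> e0 rho0 dL LL' cx u c u1 c0.
have k0 : 0 < 1 + e / rho by rewrite ltr_pwDl// divr_ge0// ltW.
rewrite dotZl mulrC ltr_pdivlMr// => cxu.
have [cr|rc] := ltP c rho; first exact: dL.
apply: card_le_trans (LL' u c u1 c0); apply: cx => //; first by rewrite addr_ge0.
apply: le_lt_trans cxu; rewrite mulrDr mulr1 lerD2l mulrCA ler_peMr//.
by rewrite ler_pdivlMr// mul1r.
Qed.

End fixed_family.

(** Consider the cells whose [L'] members all pass the level [c]. A member of [L] passing [c + e]
    lies in such a cell, and in each of these cells the two families have equally many members. *)
Lemma dominated_cells (T T' X : Type) (I : set T) (L : T -> set V)
    (I' : set T') (L' : T' -> set V) (p : T -> X) (p' : T' -> X)
    (J : Type) (B : J -> set X) e : trivIset setT B ->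
  (forall j, ([set i | I i /\ B j (p i)] #= [set i | I' i /\ B j (p' i)])%card) ->
  (forall u c i, enorm u = 1 -> 0 <= c -> level I L u (c + e) i ->
    exists2 j, B j (p i) & forall i', I' i' -> B j (p' i') -> level I' L' u c i') ->
  dominated e I L I' L'.
Proof.
move=> tB AB h u c u1 c0.
pose P := [set j | forall i', I' i' -> B j (p' i') -> level I' L' u c i'].
apply: (@card_le_trans _ _ _ (\bigcup_(j in P) [set i | I i /\ B j (p i)])).
  apply: subset_card_le => i Li; have [j Bj hj] := h u c i u1 c0 Li.
  by exists j => //; split=> //; case: Li.
apply: (@card_le_trans _ _ _ (\bigcup_(j in P) [set i | I' i /\ B j (p' i)])).
  apply: card_le_bigcup => // j k _ _ [i [[_ /= Bj] [_ /= Bk]]].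
  by apply: tB => //; exists (p' i).
by apply: subset_card_le => i [j Pj [Ii Bj]]; exact: Pj.
Qed.

End peeling_levels.

(** * Cores as bodies and their Hausdorff distance *)

Section bodies.
Context {R : realType} {d : nat}.
Local Notation V := 'rV[R]_d.
Local Notation body := (body0 R d).

(** Total by a default value: [point] is returned when [A] is not a body, so identities about
    [to_body A] need a proof that [A] is one. *)
Definition to_body (A : set V) : body := xget point [set K | body_set K = A].

Lemma to_bodyK (K : body) : to_body K = K.
Proof.
by apply: xget_unique => // L /body_ext.
Qed.

Lemma is_body (A : set V) (rho M : R) : 0 < rho -> closed A ->
  @convex_set R V A -> (forall x, enorm x <= rho -> A x) ->
  (forall x, A x -> enorm x <= M) -> body_set (to_body A) = A.
Proof.
move=> rho0 cA vA rA AM.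
have kA : compact A.
  by apply: bounded_closed_compact => //; exact: bounded_enormP AM.
have iA : interior A 0.
  apply/nbhs_enormP; exists rho => // y; rewrite subr0 => /ltW; exact: rA.
by rewrite (to_bodyK (Body0 kA vA iA)).
Qed.

Lemma core_is_body (T : Type) (I : set T) (L : T -> set V) r rho M :
  0 < rho -> 0 <= M -> deep rho I L r ->
  (forall i y, I i -> L i y -> enorm y <= M) ->
  body_set (to_body (core I L r)) = core I L r.
Proof.
move=> rho0 M0 dL LM; have [cc vc] := core_closed_convex I L r.
apply: (@is_body _ rho M) => //.
  by move=> x; exact: deep_core.
exact: core_bounded.
Qed.

Lemma excess_scale (K L : body) k M : 1 <= k -> (forall x, body_set K x -> enorm x <= M) ->
  (forall x, body_set K x -> body_set L (k^-1 *: x)) -> excess K L <= (k - 1) * M.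
Proof.
move=> k1 KM KL; apply: excess_le => x Kx.
have k0 : 0 < k by exact: lt_le_trans k1.
rewrite (le_trans (dist_to_le _ (KL _ Kx)))//.
have -> : x - k^-1 *: x = (1 - k^-1) *: x by rewrite scalerBl scale1r.
have e : 1 - k^-1 = (k - 1) / k by rewrite mulrBl divff ?mul1r// gt_eqF.
rewrite enormZ e ger0_norm ?divr_ge0 ?subr_ge0 ?(ltW k0)//.
rewrite ler_pM ?enorm_ge0 ?divr_ge0 ?subr_ge0 ?(ltW k0)//; last exact: KM.
by rewrite ler_pdivrMr// ler_peMr// subr_ge0.
Qed.

(** The margin [rho + rho] leaves depth [rho] for the second family after the shift [e <= rho], so
    one hypothesis of depth serves both inclusions. *)
Lemma hausdorff_core (T T' : Type) (I : set T) (L : T -> set V)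
    (I' : set T') (L' : T' -> set V) r rho M e :
  0 < rho -> 0 <= M -> 0 <= e -> e <= rho ->
  deep (rho + rho) I L r -> (forall i y, I i -> L i y -> enorm y <= M) ->
  (forall i y, I' i -> L' i y -> enorm y <= M) ->
  dominated e I L I' L' -> dominated e I' L' I L ->
  hausdorff_dist (to_body (core I L r)) (to_body (core I' L' r)) <= e / rho * M.
Proof.
move=> rho0 M0 e0 er dL LM LM' LL' L'L.
have dL' : deep rho I' L' r.
  have := deep_dominated e0 dL LL' => d' u c u1 c0 cr; apply: d' => //.
  by apply: (lt_le_trans cr); lra.
have {}dL : deep rho I L r.
  by move=> u c u1 c0 cr; apply: dL => //; apply: (lt_le_trans cr); lra.
have E := core_is_body rho0 M0 dL LM; have E' := core_is_body rho0 M0 dL' LM'.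
have k1 : 1 <= 1 + e / rho by rewrite lerDl divr_ge0// ltW.
have eE : e / rho * M = (1 + e / rho - 1) * M by rewrite addrAC subrr add0r.
rewrite /hausdorff_dist ge_max eE; apply/andP; split; apply: excess_scale => // x;
  rewrite ?E ?E'.
- exact: core_bounded.
- exact: core_dominated.
- exact: core_bounded.
- exact: core_dominated.
Qed.

End bodies.

(** * The gauge function of a regular body *)

Section body_bounds.
Context {R : realType} {d : nat}.
Local Notation V := 'rV[R]_d.
Implicit Types K : body0 R d.

Lemma body_ball K : exists2 r, 0 < r & forall x, enorm x <= r -> body_set K x.
Proof.
have /nbhs_enormP[e e0 eK] := body_int0 K.
exists (e / 2); first by rewrite divr_gt0.
move=> x xe; apply: eK; rewrite subr0 (le_lt_trans xe)// ltr_pdivrMr//; lra.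
Qed.

Lemma body_bound K : exists2 M, 0 < M & forall x, body_set K x -> enorm x <= M.
Proof. exact: compact_enorm (body_compact K). Qed.

Lemma body_closed K : closed (body_set K).
Proof. by apply: compact_closed (body_compact K); exact: norm_hausdorff. Qed.

Lemma body_bipolar K : polar (polar K) = K.
Proof. by apply: bipolar; [exact: body_closed|exact: body_convex|exact: body_in0]. Qed.

Lemma polar_ball_bound (A : set V) r : 0 < r ->
  (forall x, enorm x <= r -> A x) -> forall y, polar A y -> enorm y <= r^-1.
Proof.
move=> r0 rA y Ay; apply: dot_self_le_enorm; first by rewrite invr_ge0 ltW.
move=> u u1; rewrite -[leRHS]mul1r ler_pdivlMr// mulrC -dotZr dotC; apply: Ay.
by apply: rA; rewrite enormZ u1 mulr1 ger0_norm// ltW.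
Qed.

Lemma polar_bound_ball (A : set V) M : 0 < M ->
  (forall x, A x -> enorm x <= M) -> forall y, enorm y <= M^-1 -> polar A y.
Proof.
move=> M0 AM y yM x /AM xM; rewrite (le_trans (cauchy_schwarz _ _))//.
have -> : 1 = M * M^-1 by rewrite divff// gt_eqF.
by rewrite ler_pM ?enorm_ge0.
Qed.

Lemma polar_compact K : compact (polar K).
Proof.
have [r r0 rK] := body_ball K.
apply: bounded_closed_compact; last exact: polar_closed.
exact: bounded_enormP (polar_ball_bound r0 rK).
Qed.

End body_bounds.
Arguments polar_compact {R d} K.

Section gauge_function.
Context {R : realType} {d : nat}.
Local Notation V := 'rV[R]_d.
Variable K : body0 R d.

(* The gauge of [K] is the support function of the polar of [K]; its gradient
   at [x] is the point of the polar where the support function is attained. *)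
Definition ggrad (x : V) : V :=
  xget 0 [set v | polar K v /\ forall y, polar K y -> dot y x <= dot v x].

Definition gauge (x : V) : R := dot (ggrad x) x.

(** For a regular [K], the outer unit normal at the boundary point on the ray of [x]. *)
Definition gdir (x : V) : V := (enorm (ggrad x))^-1 *: ggrad x.

Lemma ggradP x : polar K (ggrad x) /\
  forall y, polar K y -> dot y x <= gauge x.
Proof.
apply: (@xgetPex _ 0 [set v | polar K v /\ forall y, polar K y -> dot y x <= dot v x]).
have P0 : polar K !=set0 by exists 0; exact: polar0.
have [|v] := @compact_EVT_max _ _ (fun y : V => dot y x) _ P0 (polar_compact K).
  by apply: continuous_subspaceT; exact: dot_continuous.
rewrite inE => Kv vmax; exists v; split=> // y Ky; apply: vmax.
by rewrite inE.
Qed.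

Lemma ggrad_polar x : polar K (ggrad x).
Proof. by case: (ggradP x). Qed.

Lemma gauge_ge x y : polar K y -> dot y x <= gauge x.
Proof. by case: (ggradP x) => _; exact. Qed.

(** The subgradient inequality. With the continuity of [ggrad] it does the work of
    differentiability: no derivative of the gauge is taken. *)
Lemma gauge_sub x y : gauge x - gauge y <= dot (ggrad x) (x - y).
Proof. by rewrite dotBr lerD2l lerN2 gauge_ge//; exact: ggrad_polar. Qed.

Lemma gauge0 : gauge 0 = 0. Proof. exact: dot0r. Qed.

Lemma gaugeD x y : gauge (x + y) <= gauge x + gauge y.
Proof. by rewrite {1}/gauge dotDr lerD// gauge_ge//; exact: ggrad_polar. Qed.

Lemma gaugeZ (a : R) x : 0 <= a -> gauge (a *: x) = a * gauge x.
Proof.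
rewrite le_eqVlt => /orP[/eqP <-|a0]; first by rewrite scale0r mul0r gauge0.
apply/eqP; rewrite eq_le; apply/andP; split.
  by rewrite {1}/gauge dotZr ler_pM2l// gauge_ge//; exact: ggrad_polar.
by rewrite -dotZr gauge_ge//; exact: ggrad_polar.
Qed.

Lemma gauge_le1 x : gauge x <= 1 <-> body_set K x.
Proof.
split=> [g1|Kx]; last by rewrite /gauge dotC; exact: (ggrad_polar x).
by rewrite -body_bipolar => y Ky; rewrite (le_trans _ g1)// gauge_ge.
Qed.

Lemma gauge_bounds : exists m M : R, [/\ 0 < m /\ 0 < M,
  forall x, m * enorm x <= gauge x,
  forall x, gauge x <= M * enorm x,
  forall x, enorm (ggrad x) <= M &
  forall x, x != 0 -> m <= enorm (ggrad x)].
Proof.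
have [r r0 rK] := body_ball K; have [M M0 KM] := body_bound K.
have vM x : enorm (ggrad x) <= r^-1.
  by apply: polar_ball_bound rK _ (ggrad_polar x).
have gm x : M^-1 * enorm x <= gauge x.
  have [->|x0] := eqVneq x 0; first by rewrite enorm0 mulr0 gauge0.
  have n0 := enorm_gt0 x0.
  have := gauge_ge x (polar_bound_ball M0 KM (y := M^-1 *: ((enorm x)^-1 *: x)) _).
  rewrite enormZ enorm_unit// mulr1 ger0_norm ?invr_ge0 ?(ltW M0)// => /(_ (lexx _)).
  by rewrite !dotZl dotxx expr2 (mulrA _ (enorm x)) mulVf ?mul1r// gt_eqF.
exists M^-1, r^-1; rewrite !invr_gt0; split=> //.
  move=> x; rewrite {1}/gauge (le_trans (cauchy_schwarz _ _))//.
  by rewrite ler_wpM2r ?enorm_ge0.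
move=> x x0; rewrite -(ler_pM2r (enorm_gt0 x0)) (le_trans (gm x))//.
exact: cauchy_schwarz.
Qed.

Lemma gauge_lip : exists2 M, 0 < M &
  forall x y, `|gauge x - gauge y| <= M * enorm (x - y).
Proof.
have [_ [M [[_ M0] _ _ vM _]]] := gauge_bounds; exists M => // x y.
have h z w : gauge z - gauge w <= M * enorm (z - w).
  rewrite (le_trans (gauge_sub _ _))// (le_trans (cauchy_schwarz _ _))//.
  by rewrite ler_wpM2r ?enorm_ge0.
by rewrite ler_norml h andbT lerNl opprB enormB h.
Qed.

Lemma gauge_continuous : continuous gauge.
Proof.
have [M M0 gM] := gauge_lip.
move=> x; apply: continuous_enormP => e e0.
exists (e / M) => [|y yx]; first by rewrite divr_gt0.
by rewrite (le_lt_trans (gM _ _))// enormB mulrC -ltr_pdivlMr.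
Qed.

Lemma gauge_gt0 x : x != 0 -> 0 < gauge x.
Proof.
move=> x0; have [m [M [[m0 _] mg _ _ _]]] := gauge_bounds.
by rewrite (lt_le_trans _ (mg x))// mulr_gt0// enorm_gt0.
Qed.

Lemma gauge_gt0_neq0 x : 0 < gauge x -> x != 0.
Proof. by move=> g0; apply/eqP => x0; move: g0; rewrite x0 gauge0 ltxx. Qed.

Lemma gauge1_boundary x : gauge x = 1 -> boundary K x.
Proof.
move=> g1; split; first by apply: subset_closure; apply/gauge_le1; rewrite g1.
move=> /nbhs_enormP[e e0 eK].
have x0 : x != 0 by apply: gauge_gt0_neq0; rewrite g1.
have n0 := enorm_gt0 x0.
pose t := e / (2 * enorm x).
have t0 : 0 < t by rewrite divr_gt0// mulr_gt0.
have /gauge_le1 : body_set K ((1 + t) *: x).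
  apply: eK; rewrite scalerDl scale1r addrAC subrr add0r enormZ gtr0_norm//.
  rewrite /t invfM mulrA mulfVK ?gt_eqF// ltr_pdivrMr//; lra.
rewrite gaugeZ ?g1 ?mulr1; last by rewrite addr_ge0// ltW.
by rewrite gerDl leNgt t0.
Qed.

Lemma ggrad_normal x v : 0 < gauge x -> polar K v -> dot v x = gauge x ->
  normal_cone K ((gauge x)^-1 *: x) v.
Proof.
move=> g0 Kv vx y Ky; rewrite dotBr dotZr vx mulVf ?gt_eqF// subr_le0 dotC.
exact: Kv.
Qed.

Hypothesis K_regular : regular K.

(** Regularity enters here: both vectors are in the normal cone at the boundary point on the ray of
    [x]. This cone is one-dimensional, so they are proportional, and equal products with [x] fix the
    factor. *)
Lemma ggrad_unique x v : x != 0 -> polar K v -> dot v x = gauge x -> v = ggrad x.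
Proof.
move=> x0 Kv vx; have g0 := gauge_gt0 x0.
have bx : boundary K ((gauge x)^-1 *: x).
  apply: gauge1_boundary; rewrite gaugeZ ?invr_ge0 ?(ltW g0)//.
  by rewrite mulVf// gt_eqF.
have [U [dU NU _]] := K_regular bx.
have Uv := NU _ (ggrad_normal g0 Kv vx).
have Ug := NU _ (ggrad_normal g0 (ggrad_polar x) erefl).
have gn0 : ggrad x != 0.
  by apply: contraTneq g0 => e; rewrite /gauge e dot0l ltxx.
have /vlineP[k vk] : v \in <[ggrad x]>%VS.
  have /eqP -> // : <[ggrad x]>%VS == U.
  by rewrite eqEdim -memvE Ug dU dim_vline gn0.
have : k * gauge x = gauge x by rewrite -{2}vx vk dotZl.
move=> /eqP; rewrite -subr_eq0 -[X in _ - X]mul1r -mulrBl mulf_eq0 (gt_eqF g0) orbF.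
by rewrite subr_eq0 => /eqP k1; rewrite vk k1 scale1r.
Qed.

Lemma ggradZ (a : R) x : 0 < a -> x != 0 -> ggrad (a *: x) = ggrad x.
Proof.
move=> a0 x0; apply/esym/ggrad_unique; last by rewrite dotZr -gaugeZ// ltW.
  by rewrite scaler_eq0 gt_eqF.
exact: ggrad_polar.
Qed.

Lemma gdirZ (a : R) x : 0 < a -> x != 0 -> gdir (a *: x) = gdir x.
Proof. by move=> a0 x0; rewrite /gdir ggradZ. Qed.

(** Away from [ggrad x], uniqueness and compactness of the polar keep the products with [x] below
    [gauge x] by a fixed gap. For [y] near [x], the product of [ggrad y] with [x] is within
    [2 * M * enorm (y - x)] of [gauge x], which is less than the gap. *)
Lemma ggrad_continuous x : x != 0 -> {for x, continuous ggrad}.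
Proof.
move=> x0 A /nbhs_enormP[e e0 eA].
pose C := polar K `&` [set y | e <= enorm (y - ggrad x)].
have [C0|nC0] := pselect (C !=set0); last first.
  apply/nbhs_enormP; exists 1 => // y _ /=; apply: eA; rewrite ltNge.
  apply/negP => h; apply: nC0; exists (ggrad y); split=> //; exact: ggrad_polar.
have cC : compact C.
  apply: (subclosed_compact _ (polar_compact K)) => [|y []//].
  apply: closedI; first exact: polar_closed.
  apply: (@preimage_closed _ _ (fun y : V => enorm (y - ggrad x)) [set t | e <= t]).
    by move=> y _; exact: enormB_continuous.
  exact: closed_ge.
have [|w] := @compact_EVT_max _ _ (fun y : V => dot y x) _ C0 cC.
  by apply: continuous_subspaceT; exact: dot_continuous.
rewrite inE => -[Kw wx] wmax.
have gap : 0 < gauge x - dot w x.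
  rewrite subr_gt0 lt_neqAle gauge_ge// andbT; apply/eqP => /ggrad_unique wE.
  by move: wx; rewrite /= wE// subrr enorm0 leNgt e0.
have [m [M [[m0 M0] _ gM vM _]]] := gauge_bounds.
apply/nbhs_enormP; exists ((gauge x - dot w x) / (2 * M)).
  by rewrite divr_gt0// mulr_gt0.
move=> y yx; apply: eA; rewrite ltNge; apply/negP => h.
have : dot (ggrad y) x <= dot w x.
  by apply: wmax; rewrite inE; split=> //; exact: ggrad_polar.
have := gauge_ge y (ggrad_polar x).
have := cauchy_schwarz (ggrad y) (y - x); have := cauchy_schwarz (ggrad x) (x - y).
rewrite !dotBr -/(gauge x) -/(gauge y) (enormB x).
have := ler_wpM2r (enorm_ge0 (y - x)) (vM x).
have := ler_wpM2r (enorm_ge0 (y - x)) (vM y).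
have : M * enorm (y - x) < (gauge x - dot w x) / 2.
  rewrite mulrC -ltr_pdivlMr//; apply: (lt_le_trans yx).
  by rewrite invfM mulrA mulrAC lexx.
lra.
Qed.

(** Only [x] is restricted to the compact shell; [y] is any nearby point, as needed for points
    pushed off [x] in a given direction. *)
Lemma ggrad_unif e : 0 < e -> exists2 a, 0 < a & forall x y,
  2^-1 <= gauge x -> gauge x <= 2 -> enorm (y - x) < a ->
  enorm (ggrad y - ggrad x) < e.
Proof.
move=> e0; pose A := [set x : V | 2^-1 <= gauge x] `&` [set x | gauge x <= 2].
have [m [M [[m0 M0] mg _ _ _]]] := gauge_bounds.
have cA : compact A.
  apply: bounded_closed_compact.
    apply: (@bounded_enormP _ _ _ (2 / m)) => x [_ /= x2].
    by rewrite ler_pdivlMr// mulrC (le_trans (mg x)).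
  apply: closedI.
    apply: (@preimage_closed _ _ gauge [set t | 2^-1 <= t]); last exact: closed_ge.
    by move=> x _; exact: gauge_continuous.
  apply: (@preimage_closed _ _ gauge [set t | t <= 2]); last exact: closed_le.
  by move=> x _; exact: gauge_continuous.
have /compact_near_coveringP cov := cA.
have := cov R (0^'+)
  (fun a x => forall y, enorm (y - x) < a -> enorm (ggrad y - ggrad x) < e) _.
case=> [x [x2 _]|].
  have x0 : x != 0 by apply: gauge_gt0_neq0; rewrite (lt_le_trans _ x2).
  have /nbhs_enormP[a a0 ha] : nbhs x (ggrad @^-1` [set z | enorm (z - ggrad x) < e / 2]).
    apply: ggrad_continuous => //; apply/nbhs_enormP; exists (e / 2) => //.
    by rewrite divr_gt0.
  exists ([set y | enorm (y - x) < a / 2], [set b | b < a / 2]); rewrite /=.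
    split; first by apply/nbhs_enormP; exists (a / 2) => //; rewrite divr_gt0.
    by apply: nbhs_right_lt; rewrite divr_gt0.
  move=> [z b] /= [zx ba] y yz.
  have h1 : enorm (ggrad z - ggrad x) < e / 2.
    by apply: ha; rewrite (lt_trans zx)// ltr_pdivrMr//; lra.
  have h2 : enorm (ggrad y - ggrad x) < e / 2.
    apply: ha; rewrite (le_lt_trans (ler_enorm_dist _ z _))//.
    by have := lt_trans yz ba; lra.
  rewrite (le_lt_trans (ler_enorm_dist _ (ggrad x) _))// (enormB _ (ggrad z)); lra.
move=> b /= b0 hb; exists (b / 2); first by rewrite divr_gt0.
move=> x y x1 x2 yx; apply: (hb (b / 2)) => //=; last by rewrite divr_gt0.
by rewrite sub0r normrN gtr0_norm ?divr_gt0// ltr_pdivrMr//; lra.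
Qed.

Lemma gdir_dist x y : x != 0 -> y != 0 ->
  enorm (gdir x - gdir y) <= 2 * enorm (ggrad x - ggrad y) / enorm (ggrad x).
Proof.
move=> x0 y0; have [m [M [[m0 M0] _ _ _ mv]]] := gauge_bounds.
have X0 := lt_le_trans m0 (mv x x0); have Y0 := lt_le_trans m0 (mv y y0).
rewrite /gdir; set a := ggrad x in X0 *; set b := ggrad y in Y0 *.
rewrite ler_pdivlMr// mulrC -[X in X * _](gtr0_norm X0) -enormZ scalerBr.
rewrite !scalerA divff ?gt_eqF// scale1r.
have -> : a - (enorm a / enorm b) *: b = (a - b) + (1 - enorm a / enorm b) *: b.
  by apply/rowP => i; rewrite !mxE; ring.
rewrite (le_trans (ler_enormD _ _))// mulrDl mul1r lerD2l enormZ.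
rewrite -[X in _ * X](gtr0_norm Y0) -normrM mulrBl mul1r divfK ?gt_eqF//.
rewrite ler_norml; have := enorm_dist_le a b; have := enorm_dist_le b a.
by rewrite (enormB b) => ? ?; apply/andP; split; lra.
Qed.

(** A ball inside [K] makes [dot u p] positive; divided by it, [u] lies in the polar and attains the
    gauge at [p], so uniqueness identifies it with the gradient. *)
Lemma normal_unit p u : body_set K p -> enorm u = 1 ->
  (forall q, body_set K q -> dot u (q - p) <= 0) ->
  [/\ gauge p = 1, p != 0 & gdir p = u].
Proof.
move=> Kp u1 nu; have [r r0 rK] := body_ball K.
have up : 0 < dot u p.
  have /nu : body_set K (r *: u) by apply: rK; rewrite enormZ u1 mulr1 gtr0_norm.
  rewrite dotBr dotZr dotxx u1 expr1n mulr1 subr_le0; exact: lt_le_trans.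
have Kw : polar K ((dot u p)^-1 *: u).
  move=> q Kq; rewrite dotZr mulrC ler_pdivrMr// mul1r dotC -subr_le0 -dotBr.
  exact: nu.
have wp : dot ((dot u p)^-1 *: u) p = 1 by rewrite dotZl mulVf// gt_eqF.
have gp : gauge p = 1.
  by apply/eqP; rewrite eq_le (gauge_le1 p).2// -wp gauge_ge.
have p0 : p != 0 by apply: gauge_gt0_neq0; rewrite gp.
split=> //; rewrite /gdir -(ggrad_unique p0 Kw) ?gp//.
rewrite enormZ u1 mulr1 gtr0_norm ?invr_gt0// invrK scalerA divff ?scale1r//.
by rewrite gt_eqF.
Qed.

Lemma gdir_surj u : enorm u = 1 -> exists2 p, p != 0 & gdir p = u.
Proof.
move=> u1; have K0 : body_set K !=set0 by exists 0; exact: body_in0.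
have [|p] := @compact_EVT_max _ _ (fun y : V => dot y u) _ K0 (body_compact K).
  by apply: continuous_subspaceT; exact: dot_continuous.
rewrite inE => Kp pmax; have [|_ p0 pu] := normal_unit Kp u1; last by exists p.
by move=> q Kq; rewrite dotC dotBl subr_le0; apply: pmax; rewrite inE.
Qed.

Lemma enorm_gdir x : x != 0 -> enorm (gdir x) = 1.
Proof.
move=> x0; have [m [M [[m0 M0] _ _ _ mv]]] := gauge_bounds.
apply: enorm_unit; have X0 := lt_le_trans m0 (mv x x0).
by apply: contraTneq X0 => ->; rewrite enorm0 ltxx.
Qed.

End gauge_function.
Arguments ggrad_polar {R d} K x.

(** * Rescaled polars of translates *)

Section segments_and_polars.
Context {R : realType} {d : nat}.
Local Notation V := 'rV[R]_d.
Implicit Types (K : body0 R d) (x y z u : V).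

Lemma translateE x (A : set V) : translate x A = [set z | A (z - x)].
Proof.
apply/seteqP; split=> [_ [y Ay <-]|z Az] /=; first by rewrite addrK.
by exists (z - x) => //; rewrite subrK.
Qed.

Lemma dilateE (a : R) (A : set V) : a != 0 -> dilate a A = [set z | A (a^-1 *: z)].
Proof.
move=> a0; apply/seteqP; split=> [_ [y Ay <-]|z Az] /=.
  by rewrite scalerA mulVf// scale1r.
by exists (a^-1 *: z) => //; rewrite scalerA divff// scale1r.
Qed.

Lemma translate_closed_convex K x :
  closed (translate x K) /\ @convex_set R V (translate x K).
Proof.
rewrite translateE; split.
  apply: (@preimage_closed _ _ (fun z : V => z - x) K); last exact: body_closed.
  move=> y _; apply: (@continuousB _ _ _ (fun z : V => z) (fun=> x)) => //.
  exact: cst_continuous.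
apply/convexP => y z t /= Ky Kz t0 t1.
have -> : t *: y + (1 - t) *: z - x = t *: (y - x) + (1 - t) *: (z - x).
  by apply/rowP => i; rewrite !mxE; ring.
exact: (convexP _).1 (body_convex K) _ _ _ Ky Kz t0 t1.
Qed.

Lemma bipolar_translate K x : body_set K x ->
  polar (polar (translate (- x) K)) = translate (- x) K.
Proof.
move=> Kx; have [cK vK] := translate_closed_convex K (- x).
by apply: bipolar => //; rewrite translateE /= opprK add0r.
Qed.

Lemma polar_dilate (a : R) (A : set V) : 0 < a ->
  polar (dilate a A) = dilate a^-1 (polar A).
Proof.
move=> a0; rewrite [in RHS]dilateE ?invr_neq0 ?gt_eqF// invrK; apply/seteqP; split.
  by move=> y h x Ax; rewrite dotZr -dotZl; apply: h; exists x.
by move=> y h _ [x Ax <-]; rewrite dotZl -dotZr; exact: h.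
Qed.

Lemma segment_level z u (c : R) : 0 <= c ->
  (exists2 y, segment 0 z y & c < dot y u) <-> c < dot z u.
Proof.
move=> c0; split=> [[_ [t + <-]]|cz].
  rewrite /= in_itv/= => /andP[t0 t1]; rewrite scaler0 add0r dotZl => ct.
  have z0 : 0 < dot z u.
    rewrite ltNge; apply/negP => z0.
    by have := mulr_ge0_le0 t0 z0; rewrite leNgt (le_lt_trans c0 ct).
  by rewrite (lt_le_trans ct)// ler_piMl// ltW.
exists z => //; exists 1; first by rewrite /= in_itv/= ler01 lexx.
by rewrite subrr scale0r add0r scale1r.
Qed.

Lemma segment0 z : segment 0 z 0.
Proof.
exists 0; first by rewrite /= in_itv/= lexx ler01.
by rewrite scaler0 scale0r addr0.
Qed.

Lemma segment_bound z y : segment 0 z y -> enorm y <= enorm z.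
Proof.
move=> [t]; rewrite /= in_itv/= => /andP[t0 t1] <-.
by rewrite scaler0 add0r enormZ ger0_norm// ler_piMl// enorm_ge0.
Qed.

Lemma polar_segment z : polar (segment 0 z) = halfspace z 1.
Proof.
apply/seteqP; split=> y; rewrite /halfspace/=.
  rewrite dotC; apply; exists 1; first by rewrite /= in_itv/= ler01 lexx.
  by rewrite subrr scale0r add0r scale1r.
move=> yz x [t]; rewrite /= in_itv/= => /andP[t0 t1] <-.
rewrite scaler0 add0r dotZl dotC; have := ler_wpM2l t0 yz; lra.
Qed.

End segments_and_polars.

(** * Levels passed by the rescaled polars *)

Section gauge_levels.
Context {R : realType} {d : nat}.
Local Notation V := 'rV[R]_d.
Variable K : body0 R d.
Local Notation g := (gauge K).
Local Notation v := (ggrad K).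

Definition polar_shift (n : nat) (x : V) : set V :=
  dilate n%:R^-1 (polar (translate (- x) K)).

(* To first order in [n^-1], the set [polar_shift n x] is the segment from 0 to
   [t^-1 *: u], where [(t, u)] is the tag of [x]. *)
Definition tag (n : nat) (x : V) : R * V :=
  (n%:R * (1 - g x) / enorm (v x), gdir K x).

Lemma tag_dot n x u : x != 0 ->
  dot ((tag n x).1^-1 *: (tag n x).2) u = dot (v x) u / (n%:R * (1 - g x)).
Proof.
move=> x0; have [m [M [[m0 _] _ _ _ mv]]] := gauge_bounds K.
have v0 := lt_le_trans m0 (mv x x0).
rewrite /tag /gdir/= !dotZl invf_div mulrACA divff ?gt_eqF// mul1r mulrC //.
Qed.

(** The support function of the polar of [K - x] exceeds [n * c] in the direction [u] exactly when
    [u / (n * c)] is outside [K - x]; one half needs the bipolar theorem. *)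
Lemma polar_shift_level n x u (c : R) : (0 < n)%N -> g x <= 1 -> 0 < c ->
  (exists2 y, polar_shift n x y & c < dot y u) <->
  1 < g (x + (n%:R * c)^-1 *: u).
Proof.
move=> n0 gx c0; have n0' : 0 < n%:R :> R by rewrite ltr0n.
have nc0 : 0 < n%:R * c by rewrite mulr_gt0.
have /gauge_le1 Kx := gx.
split=> [[_ [w Kw <-]]|].
  rewrite dotZl => cw; rewrite ltNge; apply/negP => /gauge_le1 Kxu.
  have : dot ((n%:R * c)^-1 *: u) w <= 1.
    by apply: Kw; rewrite translateE /= opprK addrC.
  rewrite dotZl dotC mulrC ler_pdivrMr// mul1r leNgt => /negP; apply.
  by rewrite mulrC -ltr_pdivlMr// mulrC.
move=> gxu; apply: contrapT => h.
have : translate (- x) K ((n%:R * c)^-1 *: u).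
  rewrite -bipolar_translate// => w Kw; rewrite dotZr mulrC ler_pdivrMr// mul1r.
  rewrite leNgt; apply/negP => cw; apply: h; exists (n%:R^-1 *: w); first by exists w.
  by rewrite dotZl mulrC ltr_pdivlMr// mulrC.
by rewrite translateE /= opprK addrC => /gauge_le1; rewrite leNgt gxu.
Qed.

(** No error and no large [n] in this direction: by the subgradient inequality the endpoint
    [t^-1 *: u] of the segment lies in [polar_shift n x]. *)
Lemma segment_polar_shift n x u (c : R) : (0 < n)%N -> g x < 1 -> x != 0 ->
  0 < c -> c < dot ((tag n x).1^-1 *: (tag n x).2) u ->
  1 < g (x + (n%:R * c)^-1 *: u).
Proof.
move=> n0 gx x0 c0; have n0' : 0 < n%:R :> R by rewrite ltr0n.
have nc0 : 0 < n%:R * c by rewrite mulr_gt0.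
have a0 : 0 < n%:R * (1 - g x) by rewrite mulr_gt0// subr_gt0.
rewrite tag_dot// ltr_pdivlMr// => h1.
have := gauge_ge (x + (n%:R * c)^-1 *: u) (ggrad_polar K x).
rewrite dotDr -/(g x) dotZr; apply: lt_le_trans; rewrite -ltrBlDl.
rewrite mulrC ltr_pdivlMr//; move: h1; lra.
Qed.

(** Subadditivity of the gauge bounds [1 - g x] by a multiple of [1 / (n * c)]. So a polar passing
    the level [c] has time below [C / c], and later times need no cells. *)
Lemma polar_shift_level_bound : exists2 C, 0 < C & forall n x u (c : R), (0 < n)%N ->
  g x < 1 -> x != 0 -> enorm u = 1 -> 0 < c ->
  1 < g (x + (n%:R * c)^-1 *: u) -> c * (tag n x).1 < C.
Proof.
have [m [M [[m0 M0] _ gM _ mv]]] := gauge_bounds K.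
exists (M / m) => [|n x u c n0 gx x0 u1 c0 h]; first by rewrite divr_gt0.
have n0' : 0 < n%:R :> R by rewrite ltr0n.
have nc0 : 0 < n%:R * c by rewrite mulr_gt0.
have v0 := lt_le_trans m0 (mv x x0).
have := lt_le_trans h (gaugeD K _ _).
rewrite gaugeZ ?invr_ge0 ?(ltW nc0)// => {}h.
have {}h : 1 - g x < (n%:R * c)^-1 * M.
  rewrite ltrBlDl (lt_le_trans h)// lerD2l ler_wpM2l ?invr_ge0 ?(ltW nc0)//.
  by have := gM u; rewrite u1 mulr1.
have h' : c * (n%:R * (1 - g x)) < M by rewrite mulrA (mulrC c) -ltr_pdivlMl.
rewrite /tag/= mulrA ltr_pdivrMr// (lt_le_trans h')// -mulrA ler_peMr ?(ltW M0)//.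
by rewrite mulrC ler_pdivlMr// mul1r mv.
Qed.

Hypothesis K_regular : regular K.

(** The subgradient at the displaced point [x + (n%:R * c)^-1 *: u] is compared with the one at [x];
    the displacement tends to 0 uniformly as [n] grows, since the levels are at least [e]. *)
Lemma polar_shift_segment (e a b : R) : 0 < e -> 0 < a -> exists n0, forall n x u (c : R),
  (n0 <= n)%N -> g x < 1 -> x != 0 -> a <= (tag n x).1 -> (tag n x).1 <= b ->
  enorm u = 1 -> e <= c -> 1 < g (x + (n%:R * c)^-1 *: u) ->
  c - e < dot ((tag n x).1^-1 *: (tag n x).2) u.
Proof.
move=> e0 a0; have [m [M [[m0 M0] _ gM vM mv]]] := gauge_bounds K.
(* The error on the gradient is divided by [n * (1 - g x)], which is at least [a * m], hence this
   tolerance for a final error [e]. *)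
have w0 : 0 < e * a * m by rewrite !mulr_gt0.
have [q q0 hq] := ggrad_unif K_regular w0.
(* The first term makes [1 - g x] at most one half, to stay in the shell of uniform continuity; the
   second brings the displaced point within [q] of [x]. *)
exists (Num.truncn (2 * (`|b| * M)) + Num.truncn (e * q)^-1).+1.
move=> n x u c n0n gx x0 aT Tb u1 ec h.
have n0 : (0 < n)%N by rewrite (leq_trans _ n0n).
have n0' : 0 < n%:R :> R by rewrite ltr0n.
have c0 : 0 < c by exact: lt_le_trans ec.
have nc0 : 0 < n%:R * c by rewrite mulr_gt0.
have v0 := lt_le_trans m0 (mv x x0).
have nbM : 2 * (`|b| * M) < n%:R.
  rewrite (lt_le_trans (truncnS_gt _))// ler_nat (leq_trans _ n0n)//.
  by rewrite ltnS leq_addr.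
have neq : (e * q)^-1 < n%:R.
  rewrite (lt_le_trans (truncnS_gt _))// ler_nat (leq_trans _ n0n)//.
  by rewrite ltnS leq_addl.
have T1 : n%:R * (1 - g x) <= `|b| * M.
  move: Tb; rewrite /tag/= ler_pdivrMr// => /le_trans; apply.
  rewrite (@le_trans _ _ (`|b| * enorm (v x)))//.
    by rewrite ler_wpM2r ?enorm_ge0// ler_norm.
  by rewrite ler_wpM2l.
have g2 : 2^-1 <= g x.
  have : n%:R * (1 - g x) * 2 < n%:R by rewrite (le_lt_trans _ nbM)// mulrC ler_pM2l.
  by rewrite -mulrA gtr_pMr// => ?; lra.
pose y := x + (n%:R * c)^-1 *: u.
have yx : enorm (y - x) < q.
  rewrite /y addrAC subrr add0r enormZ u1 mulr1 gtr0_norm ?invr_gt0//.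
  rewrite invf_plt ?posrE// (lt_le_trans (y := n%:R * e))//; last by rewrite ler_pM2l.
  by move: neq; rewrite invfM mulrC -ltr_pdivlMr ?invr_gt0// invrK.
have hv : enorm (v y - v x) < e * a * m by apply: hq => //; lra.
have := gauge_ge x (ggrad_polar K y).
have -> : dot (v y) x = g y - (n%:R * c)^-1 * dot (v y) u.
  by rewrite /(gauge K y) {2}/y dotDr dotZr addrK.
have := cauchy_schwarz (v y - v x) u; rewrite u1 mulr1 dotBl => h1 h2.
have h3 : 1 - g x < (n%:R * c)^-1 * dot (v y) u by move: h h2; rewrite -/y; lra.
have h4 : n%:R * (1 - g x) * c < dot (v x) u + e * a * m.
  have h5 : n%:R * c * (1 - g x) < dot (v y) u by rewrite -ltr_pdivlMl.
  rewrite mulrAC; lra.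
have T0 : 0 < n%:R * (1 - g x) by rewrite mulr_gt0// subr_gt0.
rewrite tag_dot// ltr_pdivlMr// mulrBl ltrBlDr mulrC (lt_le_trans h4)// lerD2l.
move: aT; rewrite /tag/= ler_pdivlMr// => aT.
rewrite -mulrA ler_pM2l// (le_trans _ aT)// ler_pM2l//; exact: mv.
Qed.

End gauge_levels.

(** * Local parallel sets between gauge shells *)

Section local_parallel_sandwich.
Context {R : realType} {d : nat}.
Local Notation V := 'rV[R]_d.
Variable K : body0 R d.
Hypothesis K_regular : regular K.
Local Notation g := (gauge K).
Local Notation v := (ggrad K).
Implicit Types (w : set V) (r e : R).

Lemma gdir_near e : 0 < e -> exists2 a, 0 < a & forall p x, g p = 1 ->
  x != 0 -> enorm (x - p) < a ->
  enorm (gdir K x - gdir K p) <= e /\ `|enorm (v x) - enorm (v p)| <= e.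
Proof.
move=> e0; have [m [M [[m0 M0] _ _ _ mv]]] := gauge_bounds K.
pose e' := Num.min e (e * m / 2).
have e'0 : 0 < e' by rewrite lt_min e0 divr_gt0// mulr_gt0.
have [q q0 hq] := ggrad_unif K_regular e'0.
exists q => // p x gp x0 xp.
have p0 : p != 0 by apply: (@gauge_gt0_neq0 _ _ K); rewrite gp.
have /ltW : enorm (v x - v p) < e'.
  by apply: hq => //; lra.
rewrite le_min => /andP[he he'].
split.
  rewrite (le_trans (gdir_dist _ x0 p0))// ler_pdivrMr; last first.
    exact: lt_le_trans (mv x x0).
  rewrite mulrC -ler_pdivlMr// (le_trans he')// ler_pM2r ?invr_gt0//.
  by rewrite ler_pM2l//; exact: mv.
rewrite ler_norml lerNl opprB; have := enorm_dist_le (v x) (v p).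
have := enorm_dist_le (v p) (v x); rewrite (enormB (v p)) => h1 h2.
by apply/andP; split; lra.
Qed.

(** The nearest point [p] has gauge 1 and normal [u], so the subgradient inequality at
    [x = p + s *: u] gives [g x - 1 <= s * enorm (v x)]. *)
Lemma local_parallel_outer e : 0 < e -> exists2 r0, 0 < r0 & forall w r, r < r0 ->
  local_parallel K w r `<=` [set x | [/\ 1 < g x, g x <= 1 + r * enorm (v x) &
    exists2 u, w u & enorm (gdir K x - u) <= e]].
Proof.
move=> e0; have [a a0 ha] := gdir_near e0.
exists a => // w r ra x [p [u [s [xE [wu u1] /andP[s0 sr] Kp pmin]]]].
have xpE : x - p = s *: u by rewrite xE addrAC subrr add0r.
have nu q : body_set K q -> dot u (q - p) <= 0.
  move=> Kq; have := nearest_point_normal (body_convex K) Kp pmin Kq.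
  by rewrite xpE dotZl pmulr_rle0.
have [gp p0 pu] := normal_unit K_regular Kp u1 nu.
have [m [M [[m0 M0] _ _ _ mv]]] := gauge_bounds K.
have vp0 := lt_le_trans m0 (mv p p0).
have vpE : v p = enorm (v p) *: u.
  by rewrite -pu /gdir scalerA divff ?scale1r// gt_eqF.
have gx1 : 1 < g x.
  have := gauge_ge x (ggrad_polar K p).
  have -> : dot (v p) x = 1 + s * enorm (v p).
    by rewrite xE dotDr -/(g p) gp dotZr {1}vpE dotZl dotxx u1 expr1n mulr1.
  by apply: lt_le_trans; rewrite ltrDl mulr_gt0.
have x0 : x != 0 by apply: (@gauge_gt0_neq0 _ _ K); exact: lt_trans gx1.
split=> //.
  rewrite -lerBlDl -gp (le_trans (gauge_sub _ _ _))// xpE dotZr.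
  rewrite (@le_trans _ _ (s * enorm (v x)))//.
    rewrite ler_pM2l// (le_trans (cauchy_schwarz _ _))// u1 mulr1//.
  by rewrite ler_wpM2r ?enorm_ge0.
exists u => //; rewrite -pu; apply: (ha _ _ gp x0 _).1.
by rewrite xpE enormZ u1 mulr1 gtr0_norm// (le_lt_trans sr).
Qed.

(** The converse inclusion uses the subgradient at the nearest point [p], whose norm differs from
    the one at [x] by at most [e]; the width of the shell is reduced accordingly. *)
Lemma local_parallel_inner e : 0 < e -> exists2 r0, 0 < r0 & forall w r,
  0 < r -> r < r0 ->
  [set x | [/\ 1 < g x, g x <= 1 + r * (enorm (v x) - e) &
    forall u, enorm (gdir K x - u) <= e -> w u]] `<=` local_parallel K w r.
Proof.
move=> e0; have [a a0 ha] := gdir_near e0.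
have [m [M [[m0 M0] mg _ vM mv]]] := gauge_bounds K.
(* Comparing with the boundary point on the ray of [x], the distance from [x] to [K] is at most
   [(g x - 1) / m], hence below [r * M / m], which this bound keeps under [a]. *)
exists (a * m / M) => [|w r r0 ra x [gx1 gxr hw]].
  by rewrite divr_gt0// mulr_gt0.
have x0 : x != 0 by apply: (@gauge_gt0_neq0 _ _ K); exact: lt_trans gx1.
have gx0 : 0 < g x by exact: lt_trans gx1.
have K0 : body_set K !=set0 by exists 0; exact: body_in0.
have [p Kp pmin] := nearest_point x (@body_closed _ _ K) K0.
pose s := enorm (x - p).
have s0 : 0 < s.
  apply: enorm_gt0; rewrite subr_eq0; apply/eqP => xp.
  by move: gx1; rewrite ltNge => /negP; apply; apply/gauge_le1; rewrite xp.
pose u := s^-1 *: (x - p).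
have u1 : enorm u = 1 by rewrite enormZ gtr0_norm ?invr_gt0// mulVf ?gt_eqF.
have xpE : x - p = s *: u by rewrite /u scalerA divff ?scale1r// gt_eqF.
have nu q : body_set K q -> dot u (q - p) <= 0.
  move=> Kq; have := nearest_point_normal (body_convex K) Kp pmin Kq.
  by rewrite xpE dotZl pmulr_rle0.
have [gp p0 pu] := normal_unit K_regular Kp u1 nu.
have vp0 := lt_le_trans m0 (mv p p0).
have vpE : v p = enorm (v p) *: u.
  by rewrite -pu /gdir scalerA divff ?scale1r// gt_eqF.
have sa : s < a.
  have : body_set K ((g x)^-1 *: x).
    by apply/gauge_le1; rewrite gaugeZ ?invr_ge0 ?(ltW gx0)// mulVf// gt_eqF.
  move=> /pmin /le_lt_trans; apply.
  have -> : x - (g x)^-1 *: x = ((g x - 1) / g x) *: x.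
    by rewrite mulrBl divff ?gt_eqF// mul1r scalerBl scale1r.
  rewrite enormZ gtr0_norm; last by rewrite divr_gt0// subr_gt0.
  apply: (@le_lt_trans _ _ ((g x - 1) / m)).
    rewrite -!mulrA ler_wpM2l ?subr_ge0 ?(ltW gx1)//.
    by rewrite mulrC ler_pdivrMr// mulrC ler_pdivlMr// mulrC.
  rewrite ltr_pdivrMr//.
  have : r * enorm (v x) < a * m.
    rewrite (@le_lt_trans _ _ (r * M))//; first by rewrite ler_pM2l.
    by rewrite -ltr_pdivlMr.
  have := mulr_gt0 r0 e0; move: gxr; rewrite mulrBr; lra.
have [h1 h2] := ha _ _ gp x0 sa.
exists p, u, s; split=> //; first by rewrite -xpE addrC subrK.
  by split=> //; apply: hw; rewrite -pu.
rewrite s0/= -(ler_pM2r vp0).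
have := gauge_ge x (ggrad_polar K p).
have -> : dot (v p) x = 1 + s * enorm (v p).
  by rewrite -[x](subrK p) addrC xpE dotDr -/(g p) gp dotZr {1}vpE dotZl dotxx
     u1 expr1n mulr1.
move=> h3; have : r * (enorm (v x) - e) <= r * enorm (v p).
  by rewrite ler_pM2l//; move: h2; rewrite ler_norml => /andP[]; lra.
lra.
Qed.

End local_parallel_sandwich.

(** * Lebesgue measure on the Borel sets *)

Section borel_rV.
Context {R : realType}.

Lemma borel_open d (A : set 'rV[R]_d) : open A -> measurable (A : set (borel 'rV[R]_d)).
Proof. by move=> oA; exact: sub_sigma_algebra. Qed.

Lemma borel_closed d (A : set 'rV[R]_d) : closed A -> measurable (A : set (borel 'rV[R]_d)).
Proof.
move=> cA; rewrite -(setCK A); apply: measurableC; apply: borel_open.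
exact: closed_openC.
Qed.

Lemma continuous_borel d (f : 'rV[R]_d -> R) : continuous f ->
  measurable_fun setT (f : borel 'rV[R]_d -> measurableTypeR R).
Proof.
move=> cf; apply: (measurability _ (measurable_realfun.RGenOpens.measurableE R)).
move=> _ [_ [a [b ->] <-]]; rewrite setTI; apply: borel_open.
apply: open_comp; last exact: interval_open.
by move=> x _; exact: cf.
Qed.

Definition rat_box d (p : 'rV[rat]_d * 'rV[rat]_d) : set 'rV[R]_d :=
  [set x | forall j, ratr (p.1 ord0 j) < x ord0 j /\ x ord0 j < ratr (p.2 ord0 j)].

Lemma open_rat_box d (A : set 'rV[R]_d) : open A ->
  A = \bigcup_(p in [set p | rat_box p `<=` A]) rat_box p.
Proof.
move=> oA; apply/seteqP; split=> [x Ax|x [p /= pA px]]; last exact: pA.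
have /nbhs_ballP[e /= e0 eA] : nbhs x A by exact: open_nbhs_nbhs.
have /choice[a ha] : forall j, exists q : rat, x ord0 j - e < ratr q < x ord0 j.
  move=> j; have [|q] := @rat_in_itvoo R (x ord0 j - e) (x ord0 j).
    by rewrite gtrBl.
  by rewrite in_itv/= => hq; exists q.
have /choice[b hb] : forall j, exists q : rat, x ord0 j < ratr q < x ord0 j + e.
  move=> j; have [|q] := @rat_in_itvoo R (x ord0 j) (x ord0 j + e).
    by rewrite ltrDl.
  by rewrite in_itv/= => hq; exists q.
exists (\row_j a j, \row_j b j) => [y hy|j] /=; last first.
  by rewrite !mxE; have /andP[_ ->] := ha j; have /andP[-> _] := hb j.
apply: eA; split=> // i j; rewrite ord1; have [] := hy j.
rewrite /= !mxE /ball/= => h1 h2; rewrite ltr_norml.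
have /andP[h3 h4] := ha j; have /andP[h5 h6] := hb j; apply/andP; split; lra.
Qed.

(** The Borel sets are generated by open sets, each a countable union of rational boxes, and a box
    is a finite intersection of conditions on coordinates. *)
Lemma measurable_rV dT (T : measurableType dT) d (f : T -> borel 'rV[R]_d) :
  (forall j, measurable_fun setT (fun t => f t ord0 j : measurableTypeR R)) ->
  measurable_fun setT f.
Proof.
move=> mf; apply: (@measurability _ _ T (borel 'rV[R]_d) setT f (@open 'rV[R]_d)) => // _ [A oA <-].
rewrite setTI (open_rat_box oA) preimage_bigcup.
rewrite [X in measurable X](_ : _ = \bigcup_p
  (if `[< rat_box p `<=` A >] then f @^-1` (rat_box p) else set0)).
  apply: countable_bigcupT_measurable => // p; case: asboolP => // _.
  rewrite (_ : _ @^-1` _ = \bigcap_(j in [set: 'I_d])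
     [set t | ratr (p.1 ord0 j) < f t ord0 j /\ f t ord0 j < ratr (p.2 ord0 j)]).
    apply: fin_bigcap_measurable => // j _.
    have := mf j measurableT `]ratr (p.1 ord0 j), ratr (p.2 ord0 j)[%classic.
    rewrite setTI => /(_ (measurable_itv _)); congr measurable.
    apply/seteqP; split=> t; rewrite /= in_itv/=; first by move/andP.
    by move=> [-> ->].
  by apply/seteqP; split=> [t h j _|t h j]; exact: h.
apply/seteqP; split=> [t [p /= pA pt]|t [p _]].
  by exists p => //; case: asboolP.
by case: asboolP => // pA pt; exists p.
Qed.

Lemma measurable_coord d j :
  measurable_fun setT (fun x : borel 'rV[R]_d => x ord0 j : measurableTypeR R).
Proof. by apply: continuous_borel; exact: coord_continuous. Qed.

Lemma measurable_rV_comp d d' (f : 'rV[R]_d -> 'rV[R]_d') :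
  (forall j, continuous (fun x => f x ord0 j)) ->
  measurable_fun setT (f : borel 'rV[R]_d -> borel 'rV[R]_d').
Proof. by move=> cf; apply: measurable_rV => j; exact: continuous_borel. Qed.

End borel_rV.

Section volume_measure.
Context {R : realType}.

(** With [uncons_rV], the measurable isomorphism that carries the product of Lebesgue measure and
    the measure of dimension [d] to dimension [d.+1]. *)
Definition cons_rV d (p : measurableTypeR R * borel 'rV[R]_d) : borel 'rV[R]_(d.+1) :=
  row_mx (p.1)%:M p.2 : 'rV[R]_(1 + d).

Definition uncons_rV d (x : borel 'rV[R]_(d.+1)) : measurableTypeR R * borel 'rV[R]_d :=
  ((x : 'rV[R]_(1 + d)) ord0 ord0, rsubmx (x : 'rV[R]_(1 + d))).

Lemma cons_rVE d p (j : 'I_(1 + d)) : (cons_rV p : 'rV[R]_(1 + d)) ord0 j =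
  match fintype.split j with inl _ => p.1 | inr k => (p.2 : 'rV[R]_d) ord0 k end.
Proof.
rewrite /cons_rV; case: fintype.splitP => [k jk|k jk].
  have -> : j = lshift d k by apply: val_inj.
  by rewrite row_mxEl mxE !ord1 eqxx.
have -> : j = rshift 1 k by apply: val_inj.
by rewrite row_mxEr.
Qed.

Lemma cons_rVK d : cancel (@cons_rV d) (@uncons_rV d).
Proof.
move=> [a y]; rewrite /uncons_rV /cons_rV /= row_mxKr; congr (_, _).
have -> : ord0 = lshift d (ord0 : 'I_1) :> 'I_(1 + d) by apply: val_inj.
by rewrite row_mxEl mxE eqxx.
Qed.

Lemma measurable_cons_rV d : measurable_fun setT (@cons_rV d).
Proof.
apply: measurable_rV => j.
rewrite (_ : (fun t => _) = fun p : measurableTypeR R * borel 'rV[R]_d =>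
  match fintype.split (j : 'I_(1 + d)) with inl _ => p.1 | inr k => (p.2 : 'rV[R]_d) ord0 k end); last first.
  by apply/funext => p; rewrite cons_rVE.
case: (fintype.split _) => k; first exact: measurable_fst.
by apply: (@measurableT_comp _ _ _ _ _ _ (fun y : borel 'rV[R]_d => (y : 'rV[R]_d) ord0 k : measurableTypeR R));
  [exact: measurable_coord|exact: measurable_snd].
Qed.

Lemma measurable_uncons_rV d : measurable_fun setT (@uncons_rV d).
Proof.
apply: measurable_fun_pair; first exact: measurable_coord.
apply: measurable_rV_comp => j.
rewrite (_ : (fun x : 'rV[R]_d.+1 => _) = fun x : 'rV[R]_(1 + d) => x ord0 (rshift 1 j)).
  exact: coord_continuous.
by apply/funext => x; rewrite mxE.
Qed.

Section succ.
Variables (d : nat) (mu : {sigma_finite_measure set (borel 'rV[R]_d) -> \bar R}).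
Local Notation nu := (@lebesgue_measure R \x mu)%E.

Definition vol_succ : set (borel 'rV[R]_(d.+1)) -> \bar R :=
  fun A => nu (@cons_rV d @^-1` A).

Let mc (A : set (borel 'rV[R]_(d.+1))) : measurable A ->
  measurable (@cons_rV d @^-1` A).
Proof. by move=> mA; rewrite -[X in measurable X]setTI; exact: measurable_cons_rV. Qed.

Let vol0 : vol_succ set0 = 0%E.
Proof. by rewrite /vol_succ preimage_set0 measure0. Qed.

Let vol_ge0 A : (0 <= vol_succ A)%E.
Proof. exact: measure_ge0. Qed.

Let vol_sigma_additive : semi_sigma_additive vol_succ.
Proof.
move=> F mF tF mUF; rewrite /vol_succ preimage_bigcup.
apply: measure_semi_sigma_additive.
- by move=> n; exact: mc.
- apply/trivIsetP => /= i j _ _ ij; rewrite -preimage_setI.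
  by move/trivIsetP : tF => /(_ _ _ _ _ ij) ->//; rewrite preimage_set0.
- by rewrite -preimage_bigcup; exact: mc.
Qed.

HB.instance Definition _ := isMeasure.Build _ _ _ vol_succ
  vol0 vol_ge0 vol_sigma_additive.

Let vol_sigma_finite : sigma_finite setT vol_succ.
Proof.
have /sigma_finiteP[G [TG ndG Goo]] := sigma_finiteT (@lebesgue_measure R).
have /sigma_finiteP[H [TH ndH Hoo]] := sigma_finiteT mu.
pose F k := G k `*` H k.
have TF : setT = \bigcup_k F k.
  rewrite -setXTT TG TH predeqE => -[x y]; split; last first.
    by move=> [n _ []/= ? ?]; split; exists n.
  move=> [/= [n _ Gnx] [k _ Hky]]; exists (maxn n k) => //; split.
  - by move: x Gnx; exact/subsetPset/ndG/leq_maxl.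
  - by move: y Hky; exact/subsetPset/ndH/leq_maxr.
have Foo k : measurable (F k) /\ (nu (F k) < +oo)%E.
  have [? ?] := Goo k; have [? ?] := Hoo k; split; first exact: measurableX.
  by rewrite product_measure1E// lte_mul_pinfty// ge0_fin_numE.
exists (fun k => @uncons_rV d @^-1` F k).
  by rewrite -preimage_bigcup -TF preimage_setT.
move=> k; have [mF Fk] := Foo k; split.
  by rewrite -[X in measurable X]setTI; exact: measurable_uncons_rV.
rewrite /vol_succ -comp_preimage (_ : _ \o _ = id) ?preimage_id//.
by apply/funext => x /=; rewrite cons_rVK.
Qed.

HB.instance Definition _ := Measure_isSigmaFinite.Build _ _ _ vol_succ
  vol_sigma_finite.

Definition vol_succ_measure : {sigma_finite_measure set (borel 'rV[R]_(d.+1)) -> \bar R} :=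
  vol_succ.

End succ.

(** [volume] is a bare set function; [vol] is the same function with the structure of a sigma-finite
    measure. *)
Fixpoint vol d : {sigma_finite_measure set (borel 'rV[R]_d) -> \bar R} :=
  match d with
  | 0 => @dirac _ (borel 'rV[R]_0) 0 R
  | d'.+1 => vol_succ_measure (vol d')
  end.

(** Valid for every set: the product measure is itself defined as the integral of the measures of
    the sections. *)
Lemma volE d (A : set 'rV[R]_d) : vol d A = volume A.
Proof.
elim: d A => [|d IH] A /=; first by rewrite diracE indicE.
rewrite /vol_succ /product_measure1; apply: eq_integral => x _ /=.
rewrite IH; congr volume; apply/seteqP; split=> y /=;
  by rewrite /xsection/= inE.
Qed.

End volume_measure.

Section volume_monotone.
Context {R : realType}.
Local Open Scope ereal_scope.

(* The integral of a nonnegative function is defined, measurable or not, as the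
   supremum of the integrals of the simple functions below it. *)
Lemma le_integral_nonneg dT (T : measurableType dT) (mu : {measure set T -> \bar R})
    (f1 f2 : T -> \bar R) : (forall x, 0 <= f1 x) -> (forall x, f1 x <= f2 x) ->
  \int[mu]_x f1 x <= \int[mu]_x f2 x.
Proof.
move=> f10 f12; rewrite !ge0_integralTE//; last first.
  by move=> x; exact: le_trans (f12 x).
apply: ge_ereal_sup => _ [h /= hf <-]; apply: ereal_sup_ubound; exists h => //= x.
exact: le_trans (f12 x).
Qed.

Lemma volume_ge0 d (A : set 'rV[R]_d) : 0 <= volume A.
Proof.
elim: d A => [|d IH] A /=; first by rewrite lee_fin indicE.
by apply: integral_ge0 => x _; exact: IH.
Qed.

(** Stated for all sets, because local parallel sets will only be sandwiched between measurable
    ones. *)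
Lemma volumeS d (A B : set 'rV[R]_d) : A `<=` B -> volume A <= volume B.
Proof.
elim: d A B => [|d IH] A B AB /=.
  rewrite lee_fin !indicE ler_nat; case: (boolP (_ \in A)) => //.
  by rewrite inE => /AB; rewrite -inE => ->.
apply: le_integral_nonneg => [x|x]; first exact: volume_ge0.
by apply: IH => y; exact: AB.
Qed.

End volume_monotone.

Section volume_scaling.
Context {R : realType}.
Local Open Scope ereal_scope.

Lemma measurable_scale (a : R) :
  measurable_fun setT ((fun x => a * x)%R : measurableTypeR R -> measurableTypeR R).
Proof. by apply: measurable_funM => //; exact: measurable_cst. Qed.

(** The rescaled pushforward gives intervals the right length, and Lebesgue measure is the only
    measure doing so. *)
Lemma lebesgue_measure_scale (a : R) (A : set R) : (0 < a)%R -> measurable A ->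
  lebesgue_measure ((fun x => a^-1 * x)%R @^-1` A) = a%:E * lebesgue_measure A.
Proof.
move=> a0 mA; pose phi := (fun x => a^-1 * x)%R : measurableTypeR R -> measurableTypeR R.
have mphi : measurable_fun setT phi by exact: measurable_scale.
have ai : (0 <= a^-1)%R by rewrite invr_ge0 ltW.
have H : lebesgue_measure A = pushforward (mscale (NngNum ai) (@lebesgue_measure R)) phi A.
  apply: lebesgue_measure_unique => //= _ [[b c]] _ <-.
  rewrite /pushforward /mscale/=.
  have -> : phi @^-1` `]b, c]%classic = `](a * b)%R, (a * c)%R]%classic.
    apply/seteqP; split=> x; rewrite /phi /= !in_itv/= ltr_pdivlMl// ler_pdivrMl//.
  rewrite !lebesgue_measure_itv/= !lte_fin ltr_pM2l//; case: ifPn => _; last by rewrite mule0.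
  by rewrite -!EFinB -EFinM -mulrBr mulrA mulVf ?mul1r// gt_eqF.
by rewrite {}H /pushforward /mscale/= muleA -EFinM divff ?mul1e// gt_eqF.
Qed.

Lemma ge0_integral_scale (a : R) (f : R -> \bar R) : (0 < a)%R ->
  measurable_fun setT (f : measurableTypeR R -> \bar R) -> (forall x, 0 <= f x) ->
  \int[@lebesgue_measure R]_x f (a^-1 * x)%R = a%:E * \int[@lebesgue_measure R]_x f x.
Proof.
move=> a0 mf f0.
pose phi := (fun x => a^-1 * x)%R : measurableTypeR R -> measurableTypeR R.
have mphi : measurable_fun setT phi by exact: measurable_scale.
have an : (0 <= a)%R by exact: ltW.
transitivity (\int[pushforward (@lebesgue_measure R) phi]_x f x).
  by rewrite ge0_integral_pushforward// preimage_setT.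
rewrite -[a]/((NngNum an)%:num) -ge0_integral_mscale//.
apply: eq_measure_integral => //= A mA _.
by rewrite /mscale/= -lebesgue_measure_scale.
Qed.

Lemma preimage_measurable dT dU (T : measurableType dT) (U : measurableType dU)
    (f : T -> U) (A : set U) :
  measurable_fun setT f -> measurable A -> measurable (f @^-1` A).
Proof. by move=> mf mA; rewrite -[X in measurable X]setTI; exact: mf. Qed.

Lemma vol_scale d (a : R) (A : set (borel 'rV[R]_d)) : (0 < a)%R -> measurable A ->
  vol d ((fun x : 'rV[R]_d => a^-1 *: x)%R @^-1` A) = (a ^+ d)%:E * vol d A.
Proof.
move=> a0; elim: d A => [|d IH] A mA.
  rewrite expr0 mul1e /= !diracE; congr (nat_of_bool _)%:R%:E.
  by apply/idP/idP; rewrite !inE /= scaler0.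
have mcA : measurable (@cons_rV R d @^-1` A).
  by apply: preimage_measurable mA; exact: measurable_cons_rV.
rewrite /= /vol_succ /product_measure1.
transitivity (\int[@lebesgue_measure R]_x
  ((a ^+ d)%:E * vol d (xsection (@cons_rV R d @^-1` A) (a^-1 * x)%R))).
  apply: eq_integral => x _ /=; rewrite -IH; last exact: measurable_xsection.
  have E y : (a^-1 *: row_mx x%:M y)%R = row_mx (a^-1 * x)%:M (a^-1 *: y)%R :> 'rV[R]_(1 + d).
    by rewrite scale_row_mx scale_scalar_mx.
  by congr (vol d _); apply/seteqP; split=> y; rewrite /xsection /= !inE /= /cons_rV/= E.
rewrite ge0_integralZl//; last 2 first.
- apply: (measurableT_comp (measurable_fun_xsection _ mcA)); exact: measurable_scale.
- by rewrite lee_fin exprn_ge0// ltW.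
rewrite (ge0_integral_scale a0 (f := fun x => vol d (xsection (@cons_rV R d @^-1` A) x)))//.
  by rewrite muleA -EFinM -exprSr.
exact: measurable_fun_xsection.
Qed.

Lemma vol_ball_gt0 d (x : 'rV[R]_d) (e : R) : (0 < e)%R ->
  0 < vol d [set y : 'rV[R]_d | forall j, `|y ord0 j - x ord0 j| < e]%R.
Proof.
move=> e0; elim: d x => [|d IH] x.
  rewrite /= diracE mem_set ?lte_fin//=; case=> //.
rewrite /= /vol_succ.
have -> : @cons_rV R d @^-1` [set y : 'rV[R]_d.+1 | forall j, `|y ord0 j - x ord0 j| < e]%R =
   `](x ord0 ord0 - e)%R, (x ord0 ord0 + e)%R[%classic `*`
   [set y : 'rV[R]_d | forall j, `|y ord0 j - (rsubmx (x : 'rV_(1 + d))) ord0 j| < e]%R.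
  apply/seteqP; split=> [[t y] /= h|[t y] /= [h1 h2] j].
    split=> [|j].
      have := h (lshift d (ord0 : 'I_1) : 'I_(1 + d)).
      rewrite cons_rVE (unsplitK (inl _)) /= in_itv/= ltr_distl.
      by rewrite (_ : lshift d (ord0 : 'I_1) = ord0 :> 'I_d.+1)//; exact: val_inj.
    have := h (rshift 1 j : 'I_(1 + d)).
    by rewrite cons_rVE (unsplitK (inr _)) /= mxE.
  rewrite cons_rVE; case: fintype.splitP => [k jk|k jk].
    rewrite (_ : j = ord0) ?ltr_distl; last by apply: val_inj; rewrite /= jk ord1.
    by move: h1; rewrite in_itv.
  have := h2 k; rewrite mxE (_ : j = rshift 1 k :> 'I_d.+1)//; exact: val_inj.
rewrite product_measure1E//; last first.
  rewrite (_ : [set y | _] = \bigcap_(j in [set: 'I_d]) [set y : 'rV[R]_d |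
      `|y ord0 j - (rsubmx (x : 'rV_(1 + d))) ord0 j| < e]%R).
    apply: fin_bigcap_measurable => // j _; apply: borel_open.
    apply: (@open_comp _ _ (fun y : 'rV[R]_d => y ord0 j)
      [set t | `|t - (rsubmx (x : 'rV_(1 + d))) ord0 j| < e]%R).
      by move=> y _; exact: coord_continuous.
    rewrite (_ : [set t | _] = ball ((rsubmx (x : 'rV_(1 + d))) ord0 j) e).
      exact: ball_open.
    by apply/seteqP; split=> t; rewrite /= /ball/= distrC.
  by apply/seteqP; split=> [y h j _|y h j]; exact: h.
apply: mule_gt0; last exact: IH.
rewrite [ltRHS](lebesgue_measure_itv `](x ord0 ord0 - e)%R, (x ord0 ord0 + e)%R[).
rewrite /= lte_fin ltrD2l gtrN// -EFinB lte_fin; lra.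
Qed.

End volume_scaling.

(** * Volumes of thin shells *)

Section power_estimates.
Context {R : realType}.

Lemma subX_le (d : nat) (x y T : R) : 0 <= x -> x <= y -> y <= T ->
  y ^+ d - x ^+ d <= d%:R * T ^+ d.-1 * (y - x).
Proof.
move=> x0 xy yT; have T0 : 0 <= T by lra.
case: d => [|d]; first by rewrite !expr0 subrr !mul0r.
rewrite subrXX mulrC ler_wpM2r ?subr_ge0//=.
have : \sum_(i < d.+1) y ^+ (d.+1.-1 - i) * x ^+ i <= \sum_(i < d.+1) T ^+ d.
  apply: ler_sum => i _ /=.
  have -> : T ^+ d = T ^+ (d - i) * T ^+ i by rewrite -exprD subnK// -ltnS.
  have y0 : 0 <= y by lra.
  by rewrite ler_pM ?exprn_ge0// lerXn2r ?nnegrE//; lra.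
by rewrite sumr_const card_ord mulr_natl.
Qed.

(** The constant depends on [d] and [T] only, so the remainder stays quadratic in [s] after
    integration over a cone. *)
Lemma expr1D_taylor (d : nat) (T : R) : 0 <= T -> exists2 C, 0 <= C &
  forall s t, 0 <= s -> s <= 1 -> `|t| <= T ->
  `|(1 + s * t) ^+ d - 1 - d%:R * s * t| <= C * s ^+ 2.
Proof.
move=> T0; elim: d => [|d [C C0 hC]].
  by exists 0 => // s t _ _ _; rewrite expr0 subrr !mul0r subrr normr0.
exists ((1 + T) * C + d%:R * T ^+ 2) => [|s t s0 s1 tT].
  by rewrite addr_ge0 ?mulr_ge0 ?addr_ge0// sqr_ge0.
have := hC s t s0 s1 tT; set E := _ - _ - _ => hE.
have -> : (1 + s * t) ^+ d.+1 - 1 - d.+1%:R * s * t =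
    (1 + s * t) * E + d%:R * s ^+ 2 * t ^+ 2.
  by rewrite /E exprS -natr1; ring.
apply: (le_trans (ler_normD _ _)); rewrite [leRHS]mulrDl; apply: lerD.
  rewrite normrM -mulrA ler_pM//.
  rewrite (le_trans (ler_normD _ _))// normr1 lerD2l normrM ger0_norm//.
  by rewrite -[leRHS]mul1r ler_pM.
rewrite ger0_norm; last by apply: mulr_ge0; [apply: mulr_ge0|]; rewrite ?sqr_ge0.
rewrite mulrAC ler_wpM2r ?sqr_ge0// ler_wpM2l// -(real_normK (num_real t)).
by rewrite lerXn2r ?nnegrE.
Qed.

End power_estimates.

Section cone_volume.
Context {R : realType} {d : nat}.
Local Notation V := 'rV[R]_d.
Variable K : body0 R d.
Hypothesis K_regular : regular K.
Hypothesis K_fin : (volume K < +oo)%E.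
Local Notation g := (gauge K).
Local Notation v := (ggrad K).
Local Notation bV := (borel V).

(** [ggrad] is an arbitrary choice at the origin, whose contribution to a preimage is empty or a
    singleton. *)
Lemma measurable_off0 (f : V -> R) : (forall x, x != 0 -> {for x, continuous f}) ->
  measurable_fun setT (f : bV -> measurableTypeR R).
Proof.
move=> cf; apply: (measurability _ (RGenOpens.measurableE R)).
move=> _ [_ [a [b ->] <-]]; rewrite setTI.
set O : set R := `]a, b[%classic.
rewrite (_ : f @^-1` O = ([set x | x != 0] `&` f @^-1` O) `|` ([set 0] `&` f @^-1` O)).
  apply: measurableU.
    apply: borel_open; rewrite openE => x [/= x0 Ox].
    have h : nbhs x [set x : V | x != 0].
      apply/nbhs_enormP; exists (enorm x) => [|y yx] /=; first exact: enorm_gt0.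
      by apply: contraTneq yx => ->; rewrite sub0r enormN ltxx.
    have hf : nbhs x (f @^-1` O).
      apply: cf => //; apply: open_nbhs_nbhs; split=> //; exact: interval_open.
    exact: filterI h hf.
  have [zO|nO0] := pselect (O (f 0)).
    rewrite (_ : _ `&` _ = [set 0]).
      by apply: borel_closed; apply: compact_closed; [exact: norm_hausdorff|exact: compact_set1].
    by apply/seteqP; split=> [x []|x ->].
  by rewrite (_ : _ `&` _ = set0)//; apply/seteqP; split=> // x [-> /nO0].
apply/seteqP; split=> [x Ox|x [[_ ?]|[_ ?]]]//.
by have [x0|x0] := eqVneq x 0; [right|left]; split.
Qed.

Lemma measurable_gauge : measurable_fun setT (g : bV -> measurableTypeR R).
Proof. by apply: continuous_borel; exact: gauge_continuous. Qed.

Lemma measurable_enorm_ggrad :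
  measurable_fun setT ((fun x => enorm (v x)) : bV -> measurableTypeR R).
Proof.
apply: measurable_off0 => x x0; apply: (@continuous_comp _ _ _ v (@enorm R d)).
  exact: ggrad_continuous.
exact: enorm_continuous.
Qed.

Lemma measurable_gdir : measurable_fun setT (gdir K : bV -> bV).
Proof.
apply: measurable_rV => j; apply: measurable_off0 => x x0.
rewrite (_ : (fun x => gdir K x ord0 j) = fun x => (enorm (v x))^-1 * v x ord0 j); last first.
  by apply/funext => y; rewrite /gdir mxE.
have [m [M [[m0 _] _ _ _ mv]]] := gauge_bounds K.
apply: (@continuousM R _ (fun x => (enorm (v x))^-1) (fun x => v x ord0 j)).
  apply: (@continuousV R _ (fun x => enorm (v x))).
    by rewrite gt_eqF// (lt_le_trans m0)// mv.
  apply: (@continuous_comp _ _ _ v (@enorm R d)); first exact: ggrad_continuous.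
  exact: enorm_continuous.
apply: (@continuous_comp _ _ _ v (fun y : V => y ord0 j)).
  exact: ggrad_continuous.
exact: coord_continuous.
Qed.

Definition cone (A : set V) := forall a x, 0 < a -> A (a *: x) <-> A x.

Definition homog0 (f : V -> R) := forall a x, 0 < a -> x != 0 -> f (a *: x) = f x.

(** The part of [A] below the radial graph [g = psi]. The origin is excluded, as directions make no
    sense there. *)
Definition under (A : set V) (psi : V -> R) : set bV :=
  [set x | [/\ A x, 0 < g x & g x <= psi x]].

Definition mvol (A : set bV) : R := fine (vol d A).

Lemma measurable_under (A : set bV) (psi : V -> R) : measurable A ->
  measurable_fun setT (psi : bV -> measurableTypeR R) -> measurable (under A psi).
Proof.
move=> mA mpsi.
rewrite (_ : under A psi = A `&` [set x | 0 < g x] `&` [set x | 0 <= psi x - g x]).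
  apply: measurableI; first apply: measurableI => //.
    have := @measurable_gauge measurableT `]0, +oo[%classic (measurable_itv _).
    rewrite setTI; congr measurable; apply/seteqP; split=> x /=; rewrite in_itv/= andbT//.
  have mgB := measurable_funB mpsi measurable_gauge.
  have := mgB measurableT `[0, +oo[%classic (measurable_itv _).
  rewrite setTI; congr measurable; apply/seteqP; split=> x /=; rewrite in_itv/= andbT//.
by apply/seteqP; split=> [x [Ax gx0 gp]|x [[Ax gx0]]]; rewrite /= ?subr_ge0.
Qed.

Lemma under_scale (A : set bV) (psi : V -> R) a : cone A -> homog0 psi -> 0 < a ->
  under A (fun x => a * psi x) = (fun x => a^-1 *: x) @^-1` under A psi.
Proof.
move=> cA hpsi a0; have ai0 : 0 < a^-1 by rewrite invr_gt0.
apply/seteqP; split=> x /= [].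
  move=> Ax g0 gx; have x0 := gauge_gt0_neq0 g0.
  rewrite /under/= gaugeZ ?(ltW ai0)// hpsi// pmulr_rgt0// g0 ler_pdivrMl//.
  by split=> //; apply/cA.
rewrite gaugeZ ?(ltW ai0)// pmulr_rgt0// ler_pdivrMl// => Ax g0.
by have x0 := gauge_gt0_neq0 g0; rewrite hpsi//; split=> //; move/cA : Ax; exact.
Qed.

Lemma vol_under1 a (A : set bV) : cone A -> measurable A -> 0 < a ->
  vol d (under A (fun=> a)) = ((a ^+ d)%:E * vol d (under A (fun=> 1%R)))%E.
Proof.
move=> cA mA a0; rewrite -vol_scale//; last exact: measurable_under.
by rewrite -under_scale// mulr1.
Qed.

Lemma vol_under_fin a (A : set bV) : (vol d (under A (fun=> a)) < +oo)%E.
Proof.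
have [a0|a0] := ltP 0 a; last first.
  rewrite (_ : under _ _ = set0) ?measure0//.
  apply/seteqP; split=> // x [_ h1 h2].
  by move: (lt_le_trans h1 (le_trans h2 a0)); rewrite ltxx.
have cT : cone setT by [].
apply: (@le_lt_trans _ _ (vol d (under setT (fun=> a)))).
  by rewrite !volE; apply: volumeS => x [Ax ? ?].
rewrite vol_under1// lte_mul_pinfty ?lee_fin ?exprn_ge0 ?(ltW a0)//.
apply: le_lt_trans K_fin; rewrite -volE !volE; apply: volumeS => x [_ _].
by move/gauge_le1.
Qed.

Lemma under_fin (A : set bV) (psi : V -> R) T : (forall x, psi x <= T) ->
  (vol d (under A psi) < +oo)%E.
Proof.
move=> pT; apply: le_lt_trans (vol_under_fin T A); rewrite !volE; apply: volumeS.
by move=> x [Ax g0 gx]; split=> //; exact: le_trans (pT x).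
Qed.

Lemma mvolU (A B : set bV) : measurable A -> measurable B -> A `&` B = set0 ->
  (vol d A < +oo)%E -> (vol d B < +oo)%E -> mvol (A `|` B) = mvol A + mvol B.
Proof.
move=> mA mB AB fA fB; rewrite /mvol measureU// fineD//.
  by rewrite ge0_fin_numE.
by rewrite ge0_fin_numE.
Qed.

Lemma mvolS (A B : set bV) : A `<=` B -> (vol d B < +oo)%E -> mvol A <= mvol B.
Proof.
move=> AB fB; have AleB : (vol d A <= vol d B)%E by rewrite !volE; exact: volumeS.
rewrite /mvol fine_le// ge0_fin_numE//.
  exact: le_lt_trans fB.
Qed.

Lemma mvol_ge0 (A : set bV) : 0 <= mvol A.
Proof. by rewrite /mvol fine_ge0// volE volume_ge0. Qed.

Definition cvol (A : set V) : R := mvol (under A (fun=> 1)).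

Lemma mvol_under1 a (A : set bV) : cone A -> measurable A -> 0 <= a ->
  mvol (under A (fun=> a)) = a ^+ d * cvol A \/ a = 0.
Proof.
move=> cA mA; rewrite le_eqVlt => /orP[/eqP <-|a0]; first by right.
left; rewrite /cvol /mvol vol_under1// fineM//.
by rewrite ge0_fin_numE//; exact: vol_under_fin.
Qed.

Definition cint (A : set V) (f : V -> R) : R :=
  fine (\int[vol d]_(x in under A (fun=> 1%R)) (f x)%:E)%E.

Lemma cint_integrable (A : set bV) (f : V -> R) T : measurable A ->
  measurable_fun setT (f : bV -> measurableTypeR R) -> (forall x, `|f x| <= T) ->
  (vol d).-integrable (under A (fun=> 1)) (EFin \o f).
Proof.
move=> mA mf fT; apply: measurable_bounded_integrable.
- exact: measurable_under.
- exact: vol_under_fin.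
- exact: measurable_funTS.
- by exists T; split=> [|M TM x _]; [exact: num_real|exact: le_trans (fT x) (ltW TM)].
Qed.

Lemma cintU (A B : set bV) (f : V -> R) T : measurable A -> measurable B ->
  A `&` B = set0 ->
  measurable_fun setT (f : bV -> measurableTypeR R) -> (forall x, `|f x| <= T) ->
  cint (A `|` B) f = cint A f + cint B f.
Proof.
move=> mA mB AB mf fT.
have E : under (A `|` B) (fun=> 1) = under A (fun=> 1) `|` under B (fun=> 1).
  apply/seteqP; split=> x; first by move=> [[Ax|Bx] ? ?]; [left|right].
  by move=> [[Ax ? ?]|[Bx ? ?]]; split=> //; [left|right].
have iA := cint_integrable mA mf fT; have iB := cint_integrable mB mf fT.
rewrite /cint E integral_setU//.
- rewrite fineD//; first by apply: integrable_fin_num iA; exact: measurable_under.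
  by apply: integrable_fin_num iB; exact: measurable_under.
- exact: measurable_under.
- exact: measurable_under.
- by apply/measurable_EFinP; exact: measurable_funTS.
- apply/eqP; apply/seteqP; split=> // x [[Ax _ _] [Bx _ _]].
  by have : set0 x by rewrite -AB.
Qed.

Lemma cint_bounds (A : set bV) (f : V -> R) T a b : measurable A ->
  measurable_fun setT (f : bV -> measurableTypeR R) -> (forall x, `|f x| <= T) ->
  (forall x, x != 0 -> A x -> a <= f x /\ f x <= b) ->
  a * cvol A <= cint A f /\ cint A f <= b * cvol A.
Proof.
move=> mA mf fT hab; have iA := cint_integrable mA mf fT.
have mU : measurable (under A (fun=> 1)) by exact: measurable_under.
have fin (c : R) : (vol d).-integrable (under A (fun=> 1)) (EFin \o cst c).
  apply: (@cint_integrable _ _ `|c|) => //; exact: measurable_cst.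
have cE (c : R) : c * cvol A = fine (\int[vol d]_(x in under A (fun=> 1%R)) c%:E)%E.
  rewrite integral_cst// fineM// ge0_fin_numE//; exact: vol_under_fin.
rewrite !cE; split; apply: fine_le.
- by apply: integrable_fin_num (fin a); exact: measurable_under.
- by apply: integrable_fin_num iA; exact: measurable_under.
- apply: le_integral => //; first exact: fin.
  move=> x; rewrite inE => -[Ax g0 _]; rewrite lee_fin.
  by have [] := hab x (gauge_gt0_neq0 g0) Ax.
- by apply: integrable_fin_num iA; exact: measurable_under.
- by apply: integrable_fin_num (fin b); exact: measurable_under.
- apply: le_integral => //; first exact: fin.
  move=> x; rewrite inE => -[Ax g0 _]; rewrite lee_fin.
  by have [] := hab x (gauge_gt0_neq0 g0) Ax.
Qed.

End cone_volume.

(** * Volumes of cones cut by radial graphs *)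

Section cone_formula.
Context {R : realType} {d : nat}.
Local Notation V := 'rV[R]_d.
Variable K : body0 R d.
Hypothesis d_gt0 : (0 < d)%N.
Hypothesis K_fin : (volume K < +oo)%E.
Local Notation g := (gauge K).
Local Notation v := (ggrad K).
Local Notation bV := (borel V).
Local Notation under := (under K).
Local Notation cvol := (cvol K).
Local Notation cint := (cint K).

Lemma cvol_ge0 (A : set V) : 0 <= cvol A. Proof. exact: mvol_ge0. Qed.

Lemma cvol_le (A : set V) : cvol A <= cvol setT.
Proof. by apply: mvolS; [move=> x []|exact: vol_under_fin]. Qed.

Lemma mvol_under_cst a (A : set bV) : cone A -> measurable A -> 0 <= a ->
  mvol (under A (fun=> a)) = a ^+ d * cvol A.
Proof.
move=> cA mA a0; have [//|->] := mvol_under1 K_fin cA mA a0.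
rewrite expr0n gtn_eqF// mul0r (_ : under _ _ = set0) ?/mvol ?measure0//.
by apply/seteqP; split=> // x [_ /lt_le_trans h /h]; rewrite ltxx.
Qed.

Lemma cintD (A : set bV) (f h : V -> R) T T' : measurable A ->
  measurable_fun setT (f : bV -> measurableTypeR R) -> (forall x, `|f x| <= T) ->
  measurable_fun setT (h : bV -> measurableTypeR R) -> (forall x, `|h x| <= T') ->
  cint A (fun x => f x + h x) = cint A f + cint A h.
Proof.
move=> mA mf fT mh hT.
have fi := cint_integrable K_fin mA mf fT; have hi := cint_integrable K_fin mA mh hT.
have mU : measurable (under A (fun=> 1)) by exact: measurable_under.
rewrite /cint -fineD; last 2 first.
- exact: integrable_fin_num fi.
- exact: integrable_fin_num hi.
by congr fine; rewrite -integralD.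
Qed.

Lemma cintZ (A : set bV) (f : V -> R) T (k : R) : measurable A ->
  measurable_fun setT (f : bV -> measurableTypeR R) -> (forall x, `|f x| <= T) ->
  cint A (fun x => k * f x) = k * cint A f.
Proof.
move=> mA mf fT; have fi := cint_integrable K_fin mA mf fT.
have mU : measurable (under A (fun=> 1)) by exact: measurable_under.
rewrite /cint; under eq_integral do rewrite EFinM.
rewrite integralZl// fineM//; exact: integrable_fin_num fi.
Qed.

Lemma cint_cst (A : set bV) (k : R) : measurable A -> cint A (fun=> k) = k * cvol A.
Proof.
move=> mA; have mU : measurable (under A (fun=> 1)) by exact: measurable_under.
by rewrite /cint integral_cst// fineM// ge0_fin_numE//; exact: vol_under_fin.
Qed.

Lemma underU (A B : set V) psi : under (A `|` B) psi = under A psi `|` under B psi.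
Proof.
apply/seteqP; split=> x; first by move=> [[Ax|Bx] ? ?]; [left|right].
by move=> [[Ax ? ?]|[Bx ? ?]]; split=> //; [left|right].
Qed.

Lemma mvol_underU (A B : set bV) psi T : measurable A -> measurable B ->
  A `&` B = set0 -> measurable_fun setT (psi : bV -> measurableTypeR R) ->
  (forall x, psi x <= T) ->
  mvol (under (A `|` B) psi) = mvol (under A psi) + mvol (under B psi).
Proof.
move=> mA mB AB mpsi pT; rewrite underU mvolU//.
- exact: measurable_under.
- exact: measurable_under.
- apply/seteqP; split=> // x [[Ax _ _] [Bx _ _]].
  by have : set0 x by rewrite -AB.
- exact: under_fin pT.
- exact: under_fin pT.
Qed.

Section radial.
Variables (psi : V -> R) (T : R).
Hypotheses (mpsi : measurable_fun setT (psi : bV -> measurableTypeR R))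
  (hpsi : homog0 psi) (psi0 : forall x, 0 <= psi x) (psiT : forall x, psi x <= T).

Let T0 : 0 <= T. Proof. exact: le_trans (psi0 0) (psiT 0). Qed.

Let mpsid : measurable_fun setT ((fun x => psi x ^+ d) : bV -> measurableTypeR R).
Proof. exact: measurable_funX. Qed.

Let psidT x : `|psi x ^+ d| <= T ^+ d.
Proof. by rewrite ger0_norm ?exprn_ge0// lerXn2r ?nnegrE. Qed.

Let D (A : set V) := mvol (under A psi) - cint A (fun x => psi x ^+ d).

Let D_small (A : set bV) t e : cone A -> measurable A -> 0 <= t -> 0 <= e ->
  t + e <= T + 1 -> (forall x, x != 0 -> A x -> t <= psi x /\ psi x <= t + e) ->
  `|D A| <= d%:R * (T + 1) ^+ d.-1 * e * cvol A.
Proof.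
move=> cA mA t0 e0 te hA.
have [h1 h2] : t ^+ d * cvol A <= cint A (fun x => psi x ^+ d) /\
    cint A (fun x => psi x ^+ d) <= (t + e) ^+ d * cvol A.
  apply: (cint_bounds K_fin) psidT _ => // x x0 /(hA _ x0)[? ?].
  by split; apply: lerXn2r; rewrite ?nnegrE ?addr_ge0.
have [h3 h4] : t ^+ d * cvol A <= mvol (under A psi) /\
    mvol (under A psi) <= (t + e) ^+ d * cvol A.
  rewrite -!mvol_under_cst ?addr_ge0//; split; apply: mvolS.
  - move=> x [Ax g0 gt]; split=> //; apply: (le_trans gt).
    by have [] := hA x (gauge_gt0_neq0 g0) Ax.
  - exact: under_fin psiT.
  - move=> x [Ax g0 gt]; split=> //; apply: (le_trans gt).
    by have [] := hA x (gauge_gt0_neq0 g0) Ax.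
  - exact: vol_under_fin.
have te' : t <= t + e by rewrite lerDl.
have := subX_le d t0 te' te; rewrite addrAC subrr add0r.
move=> /(ler_wpM2r (cvol_ge0 A)); rewrite mulrBl => h5.
by rewrite ler_norml /D; apply/andP; split; lra.
Qed.

(** Both terms of [D] are additive over disjoint cones. The induction splits off the top level set,
    where [psi] is between [N * e] and [(N + 1) * e] and [D_small] applies. *)
Let D_bound (N : nat) (e : R) (A : set bV) : cone A -> measurable A -> 0 < e ->
  e <= T + 1 -> N%:R * e <= T + 1 ->
  (forall x, x != 0 -> A x -> psi x < N%:R * e) ->
  `|D A| <= d%:R * (T + 1) ^+ d.-1 * e * cvol A.
Proof.
move=> + + e0 eT; elim: N A => [|N IH] A cA mA NT hA.
  apply: (@D_small _ 0) => //; rewrite ?add0r ?(ltW e0)// => x x0 /(hA _ x0).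
  by rewrite mul0r ltNge psi0.
have mlt : measurable ([set x | psi x < N%:R * e] : set bV).
  have := mpsi measurableT (measurable_itv `]-oo, (N%:R * e)[).
  by rewrite setTI; congr measurable; apply/seteqP; split=> x /=; rewrite in_itv.
have mge : measurable ([set x | N%:R * e <= psi x] : set bV).
  have := mpsi measurableT (measurable_itv `[(N%:R * e), +oo[).
  by rewrite setTI; congr measurable; apply/seteqP; split=> x /=; rewrite in_itv/= andbT.
have chom (P : R -> Prop) : cone (A `&` [set x | P (psi x)]).
  move=> a x a0; have [->|x0] := eqVneq x 0; first by rewrite scaler0.
  by rewrite /= hpsi//; split=> -[/(cA _ _ a0)? ?].
pose A1 := A `&` [set x | psi x < N%:R * e].
pose A2 := A `&` [set x | N%:R * e <= psi x].
have AE : A = A1 `|` A2.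
  apply/seteqP; split=> [x Ax|x [[]|[]]//].
  by have [h|h] := ltP (psi x) (N%:R * e); [left|right].
have A12 : A1 `&` A2 = set0.
  by apply/seteqP; split=> // x [[_ /= h1] [_ /= h2]]; move: h1; rewrite ltNge h2.
have mA1 : measurable (A1 : set bV) by exact: measurableI.
have mA2 : measurable (A2 : set bV) by exact: measurableI.
have DE : D A = D A1 + D A2.
  rewrite /D {1 2}AE (mvol_underU mA1 mA2 A12 mpsi psiT).
  by rewrite (cintU K_fin mA1 mA2 A12 mpsid psidT); lra.
have cE : cvol A = cvol A1 + cvol A2.
  by rewrite {1}AE /cvol (@mvol_underU _ _ _ 1).
have NT' : N%:R * e <= T + 1.
  by apply: le_trans NT; rewrite ler_pM2r// ler_nat.
rewrite DE cE mulrDr (le_trans (ler_normD _ _))// lerD//.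
  by apply: IH => //; [exact: chom (fun t => t < N%:R * e)|move=> x _ []].
apply: (@D_small _ (N%:R * e)) => //.
- exact: chom (fun t => N%:R * e <= t).
- by rewrite mulr_ge0// ltW.
- exact: ltW.
- by move: NT; rewrite -natr1 mulrDl mul1r.
- move=> x x0 [Ax /= h]; split=> //.
  by have := hA x x0 Ax; rewrite -natr1 mulrDl mul1r => /ltW.
Qed.

(** Integration in polar coordinates without the coordinates: on a cone where [psi] varies by at
    most [e], the scaling of volume puts both sides between the same bounds, and cutting by the
    values of [psi] makes the total error a multiple of [e]. *)
Lemma mvol_radial (A : set bV) : cone A -> measurable A ->
  mvol (under A psi) = cint A (fun x => psi x ^+ d).
Proof.
move=> cA mA; apply/eqP; rewrite -subr_eq0 -normr_le0 -/(D A).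
have T1 : 0 < T + 1 by rewrite ltr_wpDl.
pose L := d%:R * (T + 1) ^+ d.-1 * (T + 1) * cvol A.
have hN (N : nat) : `|D A| * N.+1%:R <= L.
  pose e := (T + 1) / N.+1%:R.
  have e0 : 0 < e by rewrite divr_gt0.
  have Ne : N.+1%:R * e = T + 1 by rewrite mulrC divfK// pnatr_eq0.
  have hD : `|D A| <= d%:R * (T + 1) ^+ d.-1 * e * cvol A.
    apply: (@D_bound N.+1) => //; rewrite ?Ne//.
      by rewrite ler_pdivrMr// ler_peMr// ?ler1n// ltW.
    by move=> x _ _; rewrite (le_lt_trans (psiT x))// ltrDl.
  have := ler_wpM2r (ler0n R N.+1) hD; move/le_trans; apply.
  rewrite /L; set P := _ ^+ _.
  have -> : d%:R * P * e * cvol A * N.+1%:R = d%:R * P * (N.+1%:R * e) * cvol A by ring.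
  by rewrite Ne.
rewrite leNgt; apply/negP => D0.
have := hN (Num.truncn (L / `|D A|)); rewrite leNgt => /negP; apply.
by rewrite mulrC -ltr_pdivrMr// truncnS_gt.
Qed.

End radial.

Definition shell (A : set V) (f1 f2 : V -> R) (s : R) : set bV :=
  [set x | [/\ A x, 1 + s * f1 x < g x & g x <= 1 + s * f2 x]].

Section shells.
Variables (f1 f2 : V -> R) (T : R).
Hypotheses (m1 : measurable_fun setT (f1 : bV -> measurableTypeR R))
  (m2 : measurable_fun setT (f2 : bV -> measurableTypeR R))
  (h1 : homog0 f1) (h2 : homog0 f2)
  (b1 : forall x, `|f1 x| <= T) (b2 : forall x, `|f2 x| <= T)
  (f12 : forall x, x != 0 -> f1 x <= f2 x).

Let T0 : 0 <= T. Proof. exact: le_trans (b1 0). Qed.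

Let mpsi (f : V -> R) s : measurable_fun setT (f : bV -> measurableTypeR R) ->
  measurable_fun setT ((fun x => 1 + s * f x) : bV -> measurableTypeR R).
Proof.
move=> mf; apply: measurable_funD; first exact: measurable_cst.
by apply: measurable_funM => //; exact: measurable_cst.
Qed.

Let psiB (f : V -> R) s x : (forall x, `|f x| <= T) -> 0 <= s -> s * T <= 1 ->
  0 <= 1 + s * f x /\ 1 + s * f x <= 2.
Proof.
move=> bf s0 sT; have := bf x; rewrite ler_norml => /andP[fa fb].
have := ler_wpM2l s0 fa; have := ler_wpM2l s0 fb; rewrite mulrN => ? ?.
by split; lra.
Qed.

Lemma measurable_shell (A : set bV) s : measurable A -> 0 <= s -> s * T <= 1 ->
  measurable (shell A f1 f2 s).
Proof.
move=> mA s0 sT.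
rewrite (_ : shell A f1 f2 s = under A (fun x => 1 + s * f2 x) `\` under A (fun x => 1 + s * f1 x)).
  by apply: measurableD; apply: measurable_under => //; exact: mpsi.
apply/seteqP; split=> x.
  move=> [Ax lo hi]; have [p0 _] := psiB x b1 s0 sT.
  have g0 : 0 < g x by exact: le_lt_trans lo.
  by split=> // -[_ _]; rewrite leNgt lo.
move=> [[Ax g0 hi] nlo]; split=> //; rewrite ltNge; apply/negP => lo.
exact: nlo.
Qed.

Lemma mvol_shell (A : set bV) s : cone A -> measurable A -> 0 <= s -> s * T <= 1 ->
  mvol (shell A f1 f2 s) =
  cint A (fun x => (1 + s * f2 x) ^+ d) - cint A (fun x => (1 + s * f1 x) ^+ d).
Proof.
move=> cA mA s0 sT.
have rad (f : V -> R) : measurable_fun setT (f : bV -> measurableTypeR R) -> homog0 f ->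
    (forall x, `|f x| <= T) ->
    mvol (under A (fun x => 1 + s * f x)) = cint A (fun x => (1 + s * f x) ^+ d).
  move=> mf hf bf; apply: (@mvol_radial (fun x => 1 + s * f x) 2) => //.
  - exact: mpsi.
  - by move=> a x a0 x0; rewrite hf.
  - by move=> x; have [] := psiB x bf s0 sT.
  - by move=> x; have [] := psiB x bf s0 sT.
rewrite -!rad//; apply/eqP; rewrite eq_sym subr_eq eq_sym; apply/eqP.
have mU1 : measurable (under A (fun x => 1 + s * f1 x)).
  by apply: measurable_under => //; exact: mpsi.
have fU (f : V -> R) : (forall x, `|f x| <= T) -> (vol d (under A (fun x => 1 + s * f x)%R) < +oo)%E.
  by move=> bf; apply: (@under_fin _ _ _ K_fin _ _ 2) => x; have [] := psiB x bf s0 sT.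
rewrite -mvolU//.
- congr mvol; apply/seteqP; split=> x; last first.
    move=> [Ax g0 hi]; have [lo|lo] := ltP (1 + s * f1 x) (g x); first by left.
    by right.
  move=> [[Ax lo hi]|[Ax g0 lo]].
    have [p0 _] := psiB x b1 s0 sT.
    by split=> //; exact: le_lt_trans lo.
  split=> //; apply: (le_trans lo); rewrite lerD2l ler_wpM2l// f12//.
  exact: gauge_gt0_neq0 g0.
- exact: measurable_shell.
- by apply/seteqP; split=> // x [[_ lo _] [_ _]]; rewrite leNgt lo.
- apply: le_lt_trans (fU _ b2); rewrite !volE; apply: volumeS => x [Ax lo hi].
  have [p0 _] := psiB x b1 s0 sT.
  by split=> //; exact: le_lt_trans lo.
- exact: fU.
Qed.

End shells.

(** Expand the radial formula to first order. [C] depends neither on the cone nor on the two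
    profiles, and the lemma serves both the shells of width of order [r] outside [K] and those of
    width of order [1 / n] inside. *)
Lemma shell_limit T : 0 <= T -> exists2 C, 0 <= C & forall (A : set bV) (f1 f2 : V -> R) s,
  measurable_fun setT (f1 : bV -> measurableTypeR R) ->
  measurable_fun setT (f2 : bV -> measurableTypeR R) ->
  homog0 f1 -> homog0 f2 -> (forall x, `|f1 x| <= T) -> (forall x, `|f2 x| <= T) ->
  (forall x, x != 0 -> f1 x <= f2 x) -> cone A -> measurable A ->
  0 < s -> s * T <= 1 -> s <= 1 ->
  `|s^-1 * mvol (shell A f1 f2 s) - d%:R * (cint A f2 - cint A f1)| <= C * s.
Proof.
move=> T0; have [C C0 hC] := expr1D_taylor d T0.
exists (2 * C * cvol setT) => [|A f1 f2 s m1 m2 h1 h2 b1 b2 f12 cA mA s0 sT s1].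
  by rewrite !mulr_ge0// cvol_ge0.
have est (f : V -> R) : measurable_fun setT (f : bV -> measurableTypeR R) ->
    (forall x, `|f x| <= T) ->
    `|cint A (fun x => (1 + s * f x) ^+ d) - cvol A - d%:R * s * cint A f| <=
      C * s ^+ 2 * cvol A.
  move=> mf bf; pose E x := (1 + s * f x) ^+ d - 1 - d%:R * s * f x.
  have mE : measurable_fun setT (E : bV -> measurableTypeR R).
    apply: measurable_funB; last by apply: measurable_funM => //; exact: measurable_cst.
    apply: measurable_funB; last exact: measurable_cst.
    apply: measurable_funX; apply: measurable_funD; first exact: measurable_cst.
    by apply: measurable_funM => //; exact: measurable_cst.
  have bE x : `|E x| <= C * s ^+ 2 by apply: hC => //; exact: ltW.
  have msf : measurable_fun setT ((fun x => d%:R * s * f x) : bV -> measurableTypeR R).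
    by apply: measurable_funM => //; exact: measurable_cst.
  have bsf x : `|d%:R * s * f x| <= d%:R * s * T.
    by rewrite normrM ger0_norm ?mulr_ge0 ?(ltW s0)// ler_wpM2l ?mulr_ge0 ?(ltW s0).
  have -> : cint A (fun x => (1 + s * f x) ^+ d) =
      cint A E + (cint A (fun=> 1) + cint A (fun x => d%:R * s * f x)).
    have m1' : measurable_fun setT ((fun=> 1) : bV -> measurableTypeR R).
      exact: measurable_cst.
    have b1' (x : V) : `|1 : R| <= 1 by rewrite normr1.
    have b2' (x : V) : `|1 + d%:R * s * f x| <= 1 + d%:R * s * T.
      by apply: (le_trans (ler_normD _ _)); apply: lerD; [rewrite normr1|exact: bsf].
    rewrite -(cintD mA m1' b1' msf bsf).
    rewrite -(cintD mA mE bE (measurable_funD m1' msf) b2').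
    by congr (cint A _); apply/funext => x; rewrite /E /=; set P := _ ^+ d; ring.
  rewrite cint_cst// mul1r (cintZ _ mA mf bf).
  rewrite (_ : _ - _ - _ = cint A E); last by ring.
  have [e1 e2] := @cint_bounds _ _ _ K_fin A E _ (- (C * s ^+ 2)) (C * s ^+ 2) mA mE bE
    (fun x _ _ => (andP (eq_ind _ is_true (bE x) _ (ler_norml _ _)))).
  by rewrite ler_norml -mulNr e1 e2.
rewrite (@mvol_shell f1 f2 T)//; last exact: ltW.
have := est f1 m1 b1; have := est f2 m2 b2.
set c1 := cint A (fun x => (1 + s * f1 x) ^+ d).
set c2 := cint A (fun x => (1 + s * f2 x) ^+ d).
set i1 := cint A f1; set i2 := cint A f2.
rewrite !ler_norml => /andP[a1 a2] /andP[a3 a4].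
have cT : C * s ^+ 2 * cvol A <= C * s ^+ 2 * cvol setT.
  by rewrite ler_wpM2l ?cvol_le// mulr_ge0// sqr_ge0.
have E (z : R) : s^-1 * z - d%:R * (i2 - i1) =
    (z - d%:R * s * (i2 - i1)) / s.
  by field; rewrite gt_eqF.
rewrite E -ler_norml normrM (ger0_norm (x := s^-1)) ?invr_ge0 ?(ltW s0)//.
rewrite ler_pdivrMr// ler_norml.
have -> : 2 * C * cvol setT * s * s = 2 * (C * s ^+ 2 * cvol setT) by ring.
by rewrite mulrBr; apply/andP; split; lra.
Qed.

End cone_formula.

(** The losses of one third each are the expansion error, the reduced width of the inner shell and
    the gap between the two approximating sets of directions. *)
Lemma squeeze_dist {R : realFieldType} (x lo hi s s1 s2 c r e : R) :
  lo <= x -> x <= hi -> `|lo - (s1 - c)| <= r -> `|hi - s2| <= r ->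
  r <= e / 3 -> c <= e / 3 -> s1 <= s -> s <= s2 -> s2 <= s1 + e / 3 ->
  `|x - s| <= e.
Proof.
rewrite !ler_norml => ? ? /andP[? ?] /andP[? ?] ? ? ? ? ?.
by apply/andP; split; lra.
Qed.

(** * The surface area measure *)

Section surface_area.
Context {R : realType} {d : nat}.
Local Notation V := 'rV[R]_d.
Variable K : body0 R d.
Hypothesis d_gt0 : (0 < d)%N.
Hypothesis K_fin : (volume K < +oo)%E.
Hypothesis K_regular : regular K.
Local Notation g := (gauge K).
Local Notation v := (ggrad K).
Local Notation bV := (borel V).
Local Notation phi := (fun x => enorm (ggrad K x)).
Implicit Types w : set bV.

Definition dircone (w : set V) : set V := [set x | x != 0 /\ w (gdir K x)].

Lemma cone_dircone w : cone (dircone w).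
Proof.
move=> a x a0; rewrite /dircone/= scaler_eq0 gt_eqF//=.
by split=> -[x0]; rewrite gdirZ.
Qed.

Lemma measurable_neq0 : measurable ([set x | x != 0] : set bV).
Proof.
rewrite (_ : [set x | _] = ~` [set 0]).
  apply: measurableC; apply: borel_closed.
  by apply: compact_closed; [exact: norm_hausdorff|exact: compact_set1].
by apply/seteqP; split=> x /=; move/eqP.
Qed.

Lemma measurable_dircone w : measurable w -> measurable (dircone w : set bV).
Proof.
move=> mw; apply: measurableI; first exact: measurable_neq0.
by apply: preimage_measurable mw; exact: measurable_gdir.
Qed.

Lemma homog0_phi : homog0 phi.
Proof. by move=> a x a0 x0; rewrite ggradZ. Qed.

(* As [1 / enorm (ggrad x)] is the distance from 0 to the supporting hyperplane
   with normal [ggrad x], the cone from 0 over a boundary element of area dS has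
   volume [dS / (d * enorm (ggrad x))]. *)
Definition sarea w : R := d%:R * cint K (dircone w) phi.

Lemma phi_bound : exists2 M, 0 < M & forall x, `|phi x| <= M.
Proof.
have [_ [M [[_ M0] _ _ vM _]]] := gauge_bounds K; exists M => // x.
by rewrite ger0_norm ?enorm_ge0.
Qed.

Lemma sarea_ge0 w : measurable w -> 0 <= sarea w.
Proof.
move=> mw; have [M M0 pM] := phi_bound.
have [h _] := @cint_bounds _ _ K K_fin (dircone w) phi M 0 M (measurable_dircone mw)
  (measurable_enorm_ggrad K_regular) pM (fun x _ _ => conj (enorm_ge0 _)
   (le_trans (ler_norm _) (pM x))).
by rewrite mulr_ge0//; move: h; rewrite mul0r.
Qed.

Lemma dirconeU w1 w2 : dircone (w1 `|` w2) = dircone w1 `|` dircone w2.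
Proof.
by apply/seteqP; split=> x; [move=> [x0 []]; [left|right]|move=> [] []; split=> //; [left|right]].
Qed.

Lemma sareaU w1 w2 : measurable w1 -> measurable w2 -> w1 `&` w2 = set0 ->
  sarea (w1 `|` w2) = sarea w1 + sarea w2.
Proof.
move=> m1 m2 w12; have [M M0 pM] := phi_bound.
rewrite /sarea dirconeU (@cintU _ _ K K_fin _ _ _ M) ?mulrDr//.
- exact: measurable_dircone.
- exact: measurable_dircone.
- by apply/seteqP; split=> // x [[_ a] [_ b]]; have : set0 (gdir K x) by rewrite -w12.
- exact: measurable_enorm_ggrad.
Qed.

Lemma sarea_le_cvol : exists2 C, 0 < C & forall w, measurable w ->
  sarea w <= C * cvol K (dircone w).
Proof.
have [M M0 pM] := phi_bound; exists (d%:R * M); first by rewrite mulr_gt0// ltr0n.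
move=> w mw; rewrite /sarea -mulrA ler_wpM2l//.
by have [_ h] := @cint_bounds _ _ K K_fin (dircone w) phi M 0 M (measurable_dircone mw)
  (measurable_enorm_ggrad K_regular) pM (fun x _ _ => conj (enorm_ge0 _)
   (le_trans (ler_norm _) (pM x))).
Qed.

Lemma le_sarea w1 w2 : measurable w1 -> measurable w2 -> w1 `<=` w2 ->
  sarea w1 <= sarea w2 /\ sarea w2 - sarea w1 = sarea (w2 `\` w1).
Proof.
move=> m1 m2 w12; have mD : measurable (w2 `\` w1) by exact: measurableD.
have E : sarea w2 = sarea w1 + sarea (w2 `\` w1).
  by rewrite -sareaU ?setDUK//; apply/seteqP; split=> // x [? []].
by rewrite E addrAC subrr add0r lerDl sarea_ge0.
Qed.

(* The condition on the boundary of [w] under which the limit defining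
   [surface_area_measure K w] exists. *)
Definition sandwiched w := forall e : R, 0 < e -> exists (w1 w2 : set bV) (a : R),
  [/\ measurable w1 /\ measurable w2, 0 < a,
    forall u, w1 u -> forall u', enorm (u - u') <= a -> w u',
    forall u u', w u' -> enorm (u - u') <= a -> w2 u &
    sarea w2 <= sarea w1 + e].

Lemma sandwiched_sub w w1 w2 a : 0 < a ->
  (forall u, w1 u -> forall u', enorm (u - u') <= a -> w u') ->
  (forall u u', w u' -> enorm (u - u') <= a -> w2 u) -> w1 `<=` w /\ w `<=` w2.
Proof.
move=> a0 h1 h2; split=> u wu.
  by apply: (h1 u) => //; rewrite subrr enorm0 ltW.
by apply: (h2 u u) => //; rewrite subrr enorm0 ltW.
Qed.

Lemma surface_area_limit w : measurable w -> sandwiched w ->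
  forall e, 0 < e -> exists2 r0, 0 < r0 & forall r, 0 < r -> r < r0 ->
    `|r^-1 * fine (volume (local_parallel K w r)) - sarea w| <= e /\
    (volume (local_parallel K w r) < +oo)%E.
Proof.
move=> mw sw e e0.
have e3 : 0 < e / 3 by rewrite divr_gt0.
have [w1 [w2 [a [[mw1 mw2] a0 h1 h2 h12]]]] := sw _ e3.
have [w1w ww2] := sandwiched_sub a0 h1 h2.
have [M M0 pM] := phi_bound.
have [m [_ [[m0 _] _ _ _ mv]]] := gauge_bounds K.
pose c := cvol K setT; have c0 : 0 <= c by exact: cvol_ge0.
(* At most [a] for the directions, at most [m] so that [phi - a'] is nonnegative, and small enough
   that the reduced width costs at most [e / 3]. *)
pose a' := Num.min a (Num.min m (e / (3 * (d%:R * (c + 1))))).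
have dc : 0 < d%:R * (c + 1) by rewrite mulr_gt0 ?ltr0n// ltr_wpDl.
have a'0 : 0 < a' by rewrite !lt_min a0 m0 divr_gt0// mulr_gt0.
have [a'a [a'm a'e]] : a' <= a /\ a' <= m /\ a' <= e / (3 * (d%:R * (c + 1))).
  by rewrite /a' !ge_min !lexx !orbT.
have [r1 r10 houter] := local_parallel_outer K_regular a'0.
have [r2 r20 hinner] := local_parallel_inner K_regular a'0.
have M1 : 0 <= M + m by rewrite addr_ge0// ltW.
have [C C0 hC] := shell_limit d_gt0 K_fin M1.
have mphi := measurable_enorm_ggrad K_regular.
(* The radii of the two inclusions, the two conditions of [shell_limit], and an expansion error of
   at most [e / 3]. *)
exists (Num.min (Num.min r1 r2) (Num.min (Num.min 1 (M + m)^-1) (e / (3 * (C + 1))))).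
  by rewrite !lt_min r10 r20 ltr01 invr_gt0 ltr_wpDl ?(ltW M0)//= divr_gt0// mulr_gt0// ltr_wpDl.
move=> r r0; rewrite !lt_min => /andP[/andP[rr1 rr2] /andP[/andP[r_1 rM] rC]].
have {}rM : r * (M + m) <= 1.
  by rewrite -ler_pdivlMr ?div1r ?ltW// ltr_wpDl// ltW.
have {}rC : C * r <= e / 3.
  move: rC; rewrite ltr_pdivlMr ?mulr_gt0// ?ltr_wpDl// => h.
  by rewrite ler_pdivlMr//; have := ltW r0; lra.
have m0' : measurable_fun setT ((fun=> 0) : bV -> measurableTypeR R) by exact: measurable_cst.
have mphi' : measurable_fun setT ((fun x => phi x - a') : bV -> measurableTypeR R).
  by apply: measurable_funB => //; exact: measurable_cst.
have b0 (x : V) : `|0 : R| <= M + m by rewrite normr0.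
have bphi x : `|phi x| <= M + m by rewrite (le_trans (pM x))// lerDl ltW.
have bphi' x : `|phi x - a'| <= M + m.
  rewrite (le_trans (ler_normB _ _))// lerD//.
  by rewrite ger0_norm// ltW.
have hphi' : homog0 (fun x => phi x - a').
  by move=> b x b0' x0; rewrite homog0_phi.
have phia x : x != 0 -> 0 <= phi x - a' by move=> x0; rewrite subr_ge0 (le_trans a'm)// mv.
have /= H1 := hC (dircone w1) (fun=> 0) (fun x => phi x - a') r m0' mphi' (fun _ _ _ _ => erefl)
  hphi' b0 bphi' phia (cone_dircone w1) (measurable_dircone mw1) r0 rM (ltW r_1).
have /= H2 := hC (dircone w2) (fun=> 0) phi r m0' mphi (fun _ _ _ _ => erefl)
  homog0_phi b0 bphi (fun x _ => enorm_ge0 _) (cone_dircone w2) (measurable_dircone mw2)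
  r0 rM (ltW r_1).
have mD1 := measurable_dircone mw1; have mD2 := measurable_dircone mw2.
have S2f : (vol d (shell K (dircone w2) (fun=> 0%R) phi r) < +oo)%E.
  apply: le_lt_trans (@vol_under_fin _ _ K K_fin 2 (dircone w2)); rewrite !volE.
  apply: volumeS => x [Ax lo hi]; split=> //.
    by apply: lt_trans lo; rewrite mulr0 addr0.
  have pM' : phi x <= M + m by exact: le_trans (ler_norm _) (bphi x).
  by apply: (le_trans hi); rewrite -[2]/(1 + 1) lerD2l (le_trans _ rM)// ler_wpM2l// ltW.
have sub2 : local_parallel K w r `<=` shell K (dircone w2) (fun=> 0) phi r.
  move=> x lx; have [g1 gr [u wu ux]] := houter w r rr1 x lx.
  have x0 : x != 0 by apply: (@gauge_gt0_neq0 _ _ K); exact: lt_trans g1.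
  split; rewrite ?mulr0 ?addr0//; split=> //.
  by apply: h2 wu _; exact: le_trans a'a.
have sub1 : shell K (dircone w1) (fun=> 0) (fun x => phi x - a') r `<=` local_parallel K w r.
  move=> x [[x0 w1x] lo hi]; apply: hinner => //; split=> //.
    by move: lo; rewrite mulr0 addr0.
  by move=> u xu; apply: (h1 _ w1x); exact: le_trans a'a.
have Pf : (volume (local_parallel K w r) < +oo)%E.
  by apply: le_lt_trans S2f; rewrite volE; exact: volumeS.
split=> //.
have U : r^-1 * fine (volume (local_parallel K w r)) <=
    r^-1 * mvol (shell K (dircone w2) (fun=> 0) phi r).
  rewrite ler_pM2l ?invr_gt0// -volE; exact: mvolS.
have L : r^-1 * mvol (shell K (dircone w1) (fun=> 0) (fun x => phi x - a') r) <=
    r^-1 * fine (volume (local_parallel K w r)).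
  by rewrite ler_pM2l ?invr_gt0// -volE; apply: mvolS => //; rewrite volE.
have z0 A : measurable (A : set bV) -> cint K A (fun=> 0) = 0.
  by move=> mA; rewrite cint_cst// mul0r.
have za : cint K (dircone w1) (fun x => phi x - a') =
    cint K (dircone w1) phi - a' * cvol K (dircone w1).
  have ma : measurable_fun setT ((fun=> - a') : bV -> measurableTypeR R) by exact: measurable_cst.
  rewrite (cintD K_fin mD1 mphi bphi ma (T' := `|- a'|))//.
  by rewrite cint_cst// mulNr.
rewrite (z0 _ mD1) za subr0 mulrBr -/(sarea w1) in H1.
rewrite (z0 _ mD2) subr0 -/(sarea w2) in H2.
have ca : d%:R * (a' * cvol K (dircone w1)) <= e / 3.
  have cc : cvol K (dircone w1) <= c + 1.
    by rewrite (le_trans (cvol_le K_fin _))// lerDl.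
  have h : a' * (d%:R * (c + 1)) <= e / 3 by rewrite -ler_pdivlMr// -mulrA -invfM.
  apply: (le_trans _ h); rewrite mulrCA ler_wpM2l ?(ltW a'0)// ler_wpM2l//.
have [s1 _] := le_sarea mw1 mw w1w; have [s2 _] := le_sarea mw mw2 ww2.
exact: squeeze_dist L U H1 H2 rC ca s1 s2 h12.
Qed.

Lemma surface_areaE w : measurable w -> sandwiched w ->
  surface_area_measure K w = (sarea w)%:E.
Proof.
move=> mw sw; rewrite /surface_area_measure; apply: cvg_lim => //.
have H := surface_area_limit mw sw.
apply: (@cvg_trans _ ((r^-1 * fine (volume (local_parallel K w r)))%:E @[r --> 0^'+])).
  apply: near_eq_cvg; have [r0 r00 h] := H 1 ltr01.
  near=> r; have [||_ hr] := h r; [by []|by near: r; exact: nbhs_right_lt|].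
  by rewrite mulrC EFinM fineK// ge0_fin_numE// volume_ge0.
apply: cvg_EFin; first by near=> r.
apply/cvgrPdist_le => e e0; have [r0 r00 h] := H e e0.
near=> r; rewrite /= distrC; have [||hr _] := h r; [by []|by near: r; exact: nbhs_right_lt|].
exact: hr.
Unshelve. all: by end_near. Qed.

Lemma sandwiched_setT : sandwiched setT.
Proof.
move=> e e0; exists setT, setT, 1; split=> //; by rewrite lerDl ltW.
Qed.

Lemma surface_area0 : surface_area_measure K set0 = 0%E.
Proof.
rewrite surface_areaE//.
  rewrite /sarea (_ : dircone set0 = set0); last by apply/seteqP; split=> // x [].
  rewrite /cint (_ : under K set0 _ = set0) ?integral_set0 ?mulr0//.
  by apply/seteqP; split=> // x [].
by move=> e e0; exists set0, set0, 1; split=> //; rewrite lerDl ltW.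
Qed.

(** Half-open in time, so that consecutive cells partition an interval. *)
Definition tcell (a b : R) w : set (measurableTypeR R * bV) :=
  [set p | [/\ a <= p.1, p.1 < b & w p.2]].

Lemma measurable_tcell a b w : measurable w -> measurable (tcell a b w).
Proof.
move=> mw; rewrite (_ : tcell a b w = `[a, b[%classic `*` w).
  by apply: measurableX => //; exact: measurable_itv.
by apply/seteqP; split=> [[t u] [/= h1 h2 h3]|[t u] [/=]]; rewrite in_itv/=;
  [rewrite h1 h2|move=> /andP[]].
Qed.

Lemma intensity_tcell a b w : 0 <= a -> a <= b -> measurable w -> sandwiched w ->
  intensity K (tcell a b w) = ((fine (volume K))^-1 * ((b - a) * sarea w))%:E.
Proof.
move=> a0 ab mw sw; rewrite /intensity.
suff -> : (\int[@lebesgue_measure R]_(t in `]0%R, +oo[)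
    surface_area_measure K [set u | tcell a b w (t, u)])%E = ((b - a) * sarea w)%:E.
  by rewrite -EFinM.
rewrite (_ : (fun t => surface_area_measure K _) =
    (fun t => if (a <= t) && (t < b) then (sarea w)%:E else 0%E)); last first.
  apply/funext => t; case: ifPn => [/andP[h1 h2]|h].
    rewrite -surface_areaE//; congr surface_area_measure.
    by apply/seteqP; split=> u; [move=> []|move=> wu; split].
  rewrite (_ : [set u | _] = set0) ?surface_area0//.
  by apply/seteqP; split=> // u [/= h1 h2 _]; move: h; rewrite h1 h2.
transitivity (\int[@lebesgue_measure R]_(t in `]0%R, +oo[) ((cst (sarea w)%:E) \_ `[a, b[) t)%E.
  apply: eq_integral => t _; rewrite patchE; case: ifPn => [h|h].
    by rewrite ifT// inE/= in_itv.
  by rewrite ifF//; apply/negbTE; apply: contra h; rewrite inE/= in_itv.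
rewrite -integral_mkcondr integral_cst; last by apply: measurableI; exact: measurable_itv.
rewrite [X in (_ * X)%E](_ : _ = (b - a)%:E); first by rewrite -EFinM mulrC.
have E : lebesgue_measure (`[a, b[%classic : set R) = (b - a)%:E.
  rewrite lebesgue_measure_itv/= lte_fin; case: ifPn => [_|]; first by rewrite EFinB.
  rewrite -leNgt => ba; have -> : a = b by apply/eqP; rewrite eq_le ab ba.
  by rewrite subrr.
(* For [a = 0] the time 0 is outside the domain of integration, which changes a null set only. *)
have [a0'|a0'] := eqVneq a 0; last first.
  rewrite (_ : _ `&` _ = `[a, b[%classic); [exact: E|]; apply/seteqP; split=> t; first by case.
  move=> /= tab; split=> //; move: tab; rewrite !in_itv/= => /andP[h1 h2].
  by rewrite andbT (lt_le_trans _ h1)// lt_neqAle eq_sym a0' a0.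
rewrite (_ : _ `&` _ = `]a, b[%classic).
  have E' : lebesgue_measure (`]a, b[%classic : set R) = (b - a)%:E.
    by rewrite -E !lebesgue_measure_itv.
  exact: E'.
apply/seteqP; split=> t /=; rewrite !in_itv/= a0' ?andbT.
  by move=> [-> /andP[_ ->]].
by move=> /andP[t0 tb]; rewrite t0 tb (ltW t0).
Qed.

End surface_area.

Lemma negligible_bigcup_ord d (T : sigmaRingType d) (R : realFieldType)
    (mu : {measure set T -> \bar R}) n (F : 'I_n -> set T) :
  (forall i, mu.-negligible (F i)) -> mu.-negligible (\bigcup_i F i).
Proof.
move=> hF; pose G (k : nat) := if insub k is Some i then F i else set0.
apply: (@negligibleS _ _ _ _ (\bigcup_k G k)).
  by move=> x [i _ Fx]; exists (val i) => //; rewrite /G valK.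
apply: negligible_bigcup => k; rewrite /G; case: insubP => [i _ _|_]; first exact: hF.
exact: negligible_set0.
Qed.

(** By Tonelli, the measures of the level sets of [h] integrate over [t] to the integral over [x] of
    the Lebesgue measure of the point [h x], which is 0. *)
Lemma xsection_negligible {R : realType} dT (T : measurableType dT)
    (mu : {sigma_finite_measure set T -> \bar R}) (U : set T) (h : T -> R) :
  measurable U -> measurable_fun setT (h : T -> measurableTypeR R) ->
  (@lebesgue_measure R).-negligible [set t | mu (U `&` [set x | h x = t]) != 0%E].
Proof.
move=> mU mh; pose A : set (measurableTypeR R * T) := [set p | U p.2 /\ h p.2 = p.1].
have mA : measurable A.
  rewrite (_ : A = (setT `*` U) `&` [set p | h p.2 - p.1 = 0]).
    apply: measurableI; first exact: measurableX.
    have mD : measurable_fun setT ((fun p => h p.2 - p.1) :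
        measurableTypeR R * T -> measurableTypeR R).
      apply: measurable_funB; last exact: measurable_fst.
      by apply: (measurableT_comp mh); exact: measurable_snd.
    have := mD measurableT [set 0] (measurable_set1 _).
    by rewrite setTI; congr measurable; apply/seteqP; split.
  apply/seteqP; split=> -[t x] /=.
    by move=> [Ux ->]; rewrite subrr.
  by move=> [[_ Ux] /eqP]; rewrite subr_eq0 => /eqP.
have := indic_fubini_tonelli (@lebesgue_measure R) mu mA.
rewrite indic_fubini_tonelli_FE// indic_fubini_tonelli_GE//.
rewrite [RHS]integral0_eq; last first.
  move=> x _ /=; apply/eqP; rewrite -measure_le0.
  have : ysection A x `<=` [set h x] by move=> t; rewrite /ysection/= inE => -[_ ->].
  move=> /(le_measure (@lebesgue_measure R)) h1; rewrite (le_trans (h1 _ _))//.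
  - by rewrite inE; exact: measurable_ysection.
  - by rewrite inE; exact: measurable_set1.
  - have e : (@lebesgue_measure R [set h x] <= 0)%E by rewrite lebesgue_measure_set1.
    exact: e.
move=> h0; have mF : measurable_fun setT (mu \o xsection A) by exact: measurable_fun_xsection.
have : (\int[@lebesgue_measure R]_(t in setT) `|(mu \o xsection A) t| = 0)%E.
  by rewrite -[RHS]h0; apply: eq_integral => t _; rewrite gee0_abs.
move=> /(ae_eq_integral_abs (@lebesgue_measure R) measurableT mF); apply: negligibleS.
move=> t /= /eqP ht h1; apply: ht; have := h1 Logic.I.
rewrite (_ : xsection A t = U `&` [set x | h x = t])//.
by apply/seteqP; split=> x; rewrite /xsection/= inE.
Qed.

(** * Boxes of directions with null boundary *)

Section cells.
Context {R : realType} {d : nat}.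
Local Notation V := 'rV[R]_d.
Variable K : body0 R d.
Hypothesis d_gt0 : (0 < d)%N.
Hypothesis K_fin : (volume K < +oo)%E.
Hypothesis K_regular : regular K.
Local Notation g := (gauge K).
Local Notation bV := (borel V).

(** Asked for every coordinate, so that a threshold can be used for any side of a box. *)
Definition null_threshold (t : R) :=
  forall j, vol d (under K (dircone K [set u : V | u ord0 j = t]) (fun=> 1%R)) = 0%E.

Lemma null_threshold_ex (a b : R) : a < b -> exists2 t, a < t < b & null_threshold t.
Proof.
move=> ab; apply: contrapT => h.
pose U := under K [set x : V | x != 0] (fun=> 1).
have mU : measurable U by apply: measurable_under => //; exact: measurable_neq0.
have UE j t : under K (dircone K [set u : V | u ord0 j = t]) (fun=> 1) =
    U `&` [set x | gdir K x ord0 j = t].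
  by apply/seteqP; split=> x; [move=> [[? ?] ? ?]|move=> [[? ? ?] ?]].
pose bad j : set (measurableTypeR R) :=
  [set t | vol d (U `&` [set x | gdir K x ord0 j = t]) != 0%E].
have N j : (@lebesgue_measure R).-negligible (bad j).
  apply: xsection_negligible => //.
  apply: (@measurableT_comp _ _ _ _ _ _ (fun y : bV => (y : V) ord0 j : measurableTypeR R)).
    exact: measurable_coord.
  exact: measurable_gdir.
have sub : (`]a, b[%classic : set (measurableTypeR R)) `<=` \bigcup_j bad j.
  move=> t /=; rewrite in_itv/= => tab; apply: contrapT => hn; apply: h; exists t => // j.
  by rewrite UE; apply: contrapT => hj; apply: hn; exists j => //; apply/eqP.
have hn := @negligibleS _ (measurableTypeR R) R (@lebesgue_measure R) _ _ sub
  (negligible_bigcup_ord N).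
have : @lebesgue_measure R `]a, b[%classic = 0%E.
  by apply: (negligibleP _ _).1 hn; exact: measurable_itv.
move=> /eqP; rewrite lebesgue_measure_itv/= lte_fin ab.
by rewrite -EFinB eqe subr_eq0 gt_eqF.
Qed.

Definition box (a b : 'I_d -> R) : set bV :=
  [set u : V | forall j, a j < u ord0 j /\ u ord0 j <= b j].

Lemma measurable_box a b : measurable (box a b).
Proof.
rewrite (_ : box a b = \bigcap_(j in [set: 'I_d]) [set u : V | a j < u ord0 j /\ u ord0 j <= b j]).
  apply: fin_bigcap_measurable => // j _.
  have := @measurable_coord R d j measurableT `]a j, b j]%classic (measurable_itv _).
  rewrite setTI; congr measurable; apply/seteqP; split=> u /=; rewrite in_itv/=.
    by move/andP.
  by move=> [-> ->].
by apply/seteqP; split=> u h j; [move=> _|]; exact: h.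
Qed.

(** Moving the sides by [1 / (n + 1)] inwards and outwards gives layers that decrease to a subset of
    the hyperplanes bounding the box. The volumes of their cones tend to 0, and [sarea] is at most a
    multiple of these volumes. *)
Lemma sandwiched_box a b : (forall j, null_threshold (a j)) ->
  (forall j, null_threshold (b j)) -> sandwiched K (box a b).
Proof.
move=> na nb e e0.
pose i n : R := n.+1%:R^-1.
have i0 n : 0 < i n by rewrite invr_gt0.
pose w1 n := box (fun j => a j + i n) (fun j => b j - i n).
pose w2 n := box (fun j => a j - i n) (fun j => b j + i n).
pose D n := w2 n `\` w1 n.
have mD n : measurable (D n) by apply: measurableD; exact: measurable_box.
have le_i m n : (m <= n)%N -> i n <= i m.
  by move=> mn; rewrite lef_pV2 ?posrE// ler_nat.
have D0 : \bigcap_n D n `<=` (\bigcup_j [set u : V | u ord0 j = a j]) `|`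
    (\bigcup_j [set u : V | u ord0 j = b j]).
  move=> u uD; apply: contrapT => /not_orP[ua ub].
  have hj j : exists n, a j + i n < u ord0 j /\ u ord0 j <= b j - i n.
    have small x y : (forall n, x < y + i n) -> x <= y.
      move=> h; rewrite leNgt; apply/negP => yx.
      have := h (Num.truncn (x - y)^-1); rewrite ltNge => /negP; apply.
      rewrite -lerBrDl /i -[leRHS]invrK lef_pV2 ?posrE ?invr_gt0 ?subr_gt0//.
      exact/ltW/truncnS_gt.
    have aj : a j < u ord0 j.
      rewrite lt_neqAle; apply/andP; split.
        by apply/eqP => h; apply: ua; exists j.
      by apply: small => n; have [/(_ j)[+ _] _] := uD n Logic.I; rewrite ltrBlDr.
    have bj : u ord0 j < b j.
      rewrite lt_neqAle; apply/andP; split.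
        by apply/eqP => h; apply: ub; exists j.
      apply: (small (u ord0 j) (b j)) => n.
      have [/(_ j)[_ h] _] := uD n.+1 Logic.I; apply: (le_lt_trans h).
      by rewrite ltrD2l ltf_pV2 ?posrE// ltr_nat.
    pose c := Num.min (u ord0 j - a j) (b j - u ord0 j).
    have c0 : 0 < c by rewrite lt_min !subr_gt0 aj bj.
    exists (Num.truncn c^-1).
    have : i (Num.truncn c^-1) < c.
      by rewrite /i invf_plt ?posrE// truncnS_gt.
    by rewrite lt_min => /andP[]; split; lra.
  have /choice[n hn] := hj; pose m := (\max_j n j)%N.
  have [_] := uD m Logic.I; apply => j; have [h1 h2] := hn j.
  have := le_i (n j) m (leq_bigmax j); split; lra.
have n0 : vol d (under K (dircone K (\bigcap_n D n)) (fun=> 1%R)) = 0%E.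
  apply/negligibleP.
    apply: measurable_under => //; apply: measurable_dircone => //.
    exact: bigcapT_measurable.
  have mE j t : measurable (under K (dircone K [set u : V | u ord0 j = t]) (fun=> 1)).
    apply: measurable_under => //; apply: measurable_dircone => //.
    have := @measurable_coord R d j measurableT [set t] (measurable_set1 _).
    by rewrite setTI.
  pose E (t : 'I_d -> R) := \bigcup_j under K (dircone K [set u : V | u ord0 j = t j]) (fun=> 1).
  apply: (@negligibleS _ _ _ _ (E a `|` E b)).
    move=> x [[x0 /D0[[j _ h]|[j _ h]]] ? ?]; [left|right]; exists j => //.
  apply: negligibleU; apply: negligible_bigcup_ord => j; apply/negligibleP => //.
  - exact: na.
  - exact: nb.
have [C C0 hC] := sarea_le_cvol d_gt0 K_fin K_regular.
pose F n : set bV := under K (dircone K (D n)) (fun=> 1).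
have mF n : measurable (F n) by apply: measurable_under => //; exact: measurable_dircone.
have FE : \bigcap_n F n = under K (dircone K (\bigcap_n D n)) (fun=> 1).
  apply/seteqP; split=> x.
    by move=> h; have [[x0 _] ? ?] := h 0%N Logic.I; split=> //; split=> // n _;
      have [[]] := h n Logic.I.
  by move=> [[x0 h] ? ?] n _; split=> //; split=> //; exact: h.
have : vol d (F n) @[n --> \oo] --> vol d (\bigcap_n F n).
  apply: nonincreasing_cvg_mu => //.
  - exact: vol_under_fin.
  - exact: bigcapT_measurable.
  - move=> m n mn; apply/subsetPset => x [[x0 [h1 h2]] ? ?]; split=> //; split=> //.
    have im := le_i _ _ mn; split.
      by move=> j; have [] := h1 j; split; lra.
    by move=> h; apply: h2 => j; have [] := h j; split; lra.
rewrite FE n0 => /fine_cvgP[_] /cvgrPdist_lt /(_ (e / C)) [|N _ hN]; first by rewrite divr_gt0.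
have := hN N (leqnn N); rewrite /= sub0r normrN ger0_norm; last first.
  exact: mvol_ge0.
move=> hN'.
exists (w1 N), (w2 N), (i N); split.
- by split; exact: measurable_box.
- by [].
- move=> u wu u' uu' j; have [] := wu j.
  have := le_trans (coord_le_enorm (u - u') j) uu'.
  by rewrite !mxE ler_norml => /andP[]; split; lra.
- move=> u u' wu uu' j; have [] := wu j.
  have := le_trans (coord_le_enorm (u - u') j) uu'.
  by rewrite !mxE ler_norml => /andP[]; split; lra.
have w12 : w1 N `<=` w2 N.
  by move=> u h j; have [] := h j; have := i0 N; split; lra.
have [_ h12] := le_sarea K_fin K_regular (measurable_box _ _) (measurable_box _ _) w12.
rewrite -lerBlDl h12 (le_trans (hC _ (mD N)))//.
by move: hN'; rewrite ltr_pdivlMr// mulrC => /ltW.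
Qed.

End cells.

(** * Cells of times and directions *)

Section direction_cells.
Context {R : realType} {d : nat}.
Local Notation V := 'rV[R]_d.
Variable K : body0 R d.
Hypothesis d_gt0 : (0 < d)%N.
Hypothesis K_fin : (volume K < +oo)%E.
Hypothesis K_regular : regular K.
Local Notation g := (gauge K).
Local Notation bV := (borel V).

Lemma thresholds_ex (eta : R) : 0 < eta -> eta <= 1 -> exists (N : nat) (th : nat -> R),
  [/\ th 0%N < -1, 1 < th N, forall i, null_threshold K (th i),
    forall i, th i < th i.+1 & forall i, th i.+1 - th i <= eta].
Proof.
(* One threshold is taken in each interval of length [eta / 2], so neighbours differ by at most
   [eta]; the grid starts at -2 to have a threshold below -1, and more than [6 / eta] steps lead
   beyond 1. *)
move=> e0 e1; pose c (i : nat) : R := -2 + i%:R * (eta / 2).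
have c_lt i : c i < c i.+1.
  by rewrite /c ltrD2l ltr_pM2r ?divr_gt0// ltr_nat.
have /choice[th hth] : forall i, exists t, c i < t < c i.+1 /\ null_threshold K t.
  by move=> i; have [t ? ?] := null_threshold_ex K_regular (c_lt i); exists t.
exists (Num.truncn (6 / eta)).+1, th; split.
- have [/andP[_ h] _] := hth 0%N; apply: (lt_trans h); rewrite /c mul1r.
  by have := e1; lra.
- have [/andP[h _] _] := hth (Num.truncn (6 / eta)).+1; apply: le_lt_trans h.
  have : 6 / eta < (Num.truncn (6 / eta)).+1%:R by exact: truncnS_gt.
  rewrite ltr_pdivrMr// /c; lra.
- by move=> i; have [] := hth i.
- move=> i; have [/andP[_ h] _] := hth i; have [/andP[h' _] _] := hth i.+1.
  exact: lt_trans h'.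
- move=> i; have [/andP[h1 _] _] := hth i; have [/andP[_ h2] _] := hth i.+1.
  move: h1 h2; rewrite /c -[i.+2%:R]natr1 -[i.+1%:R]natr1; lra.
Qed.

Lemma dir_cells (eta : R) : 0 < eta -> exists (q : nat) (w : 'I_q -> set bV),
  [/\ forall i, measurable (w i) /\ sandwiched K (w i), trivIset setT w,
    forall u : V, enorm u = 1 -> exists i, w i u &
    forall i u u', w i u -> w i u' -> enorm (u - u') <= eta].
Proof.
(* Dividing by [Num.sqrt d%:R] turns the bound on coordinates into one on the Euclidean norm; the
   bound 1 is for [thresholds_ex]. *)
move=> eta0; pose e := Num.min 1 (eta / Num.sqrt d%:R).
have sd0 : 0 < Num.sqrt d%:R :> R by rewrite sqrtr_gt0 ltr0n.
have e0 : 0 < e by rewrite lt_min ltr01 divr_gt0.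
have [|N [th [th0 thN nth tht the]]] := thresholds_ex e0; first by rewrite ge_min lexx.
have th_le i k : (i <= k)%N -> th i <= th k.
  move=> /subnK <-; elim: (k - i)%N => [|l IH]; first by rewrite add0n.
  by rewrite addSn (le_trans IH)// ltW.
have th_uniq i k (t : R) : th i < t -> t <= th i.+1 -> th k < t -> t <= th k.+1 -> i = k.
  move=> h1 h2 h3 h4; have [ik|ki|//] := ltngtP i k.
    by have := lt_le_trans h3 h2; rewrite ltNge th_le.
  by have := lt_le_trans h1 h4; rewrite ltNge th_le.
pose T := {ffun 'I_d -> 'I_N}.
pose w (i : 'I_#|T|) : set bV := let k : T := enum_val i in
  box (fun j => th (k j)) (fun j => th (k j).+1).
exists #|T|, w; split.
- move=> i; split; first exact: measurable_box.
  by apply: sandwiched_box => // j; exact: nth.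
- move=> i i' _ _ [u [h h']]; apply: enum_val_inj; apply/ffunP => j; apply: val_inj.
  have [h1 h2] := h j; have [h3 h4] := h' j.
  exact: th_uniq h1 h2 h3 h4.
- move=> u u1.
  have /choice[k hk] : forall j, exists k : 'I_N, th k < u ord0 j /\ u ord0 j <= th k.+1.
    move=> j; have := coord_le_enorm u j; rewrite u1 ler_norml => /andP[uj1 uj2].
    have h0 : th 0%N < u ord0 j by lra.
    have hN : u ord0 j <= th N by lra.
    have : exists2 k, (k < N)%N & th k < u ord0 j /\ u ord0 j <= th k.+1.
      elim: N hN {thN T w} => [|n IH] hN; first by have := lt_le_trans h0 hN; rewrite ltxx.
      have [hn|hn] := leP (u ord0 j) (th n); last by exists n.
      by have [k kn hk] := IH hn; exists k => //; exact: ltnW.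
    by move=> [k kN hk]; exists (Ordinal kN).
  exists (enum_rank [ffun j => k j]) => j; rewrite enum_rankK !ffunE; exact: hk.
- move=> i u u' wu wu'; rewrite (le_trans (enorm_le_norm _))//.
  have : `|u - u'| <= eta / Num.sqrt d%:R.
    rewrite [leLHS]/Num.norm/= mx_normrE; apply/bigmax_leP; split=> [|[r j] _ /=].
      by rewrite divr_ge0// ltW.
    rewrite ord1 !mxE; have [h1 h2] := wu j; have [h3 h4] := wu' j.
    have := the (val ((enum_val i : T) j)).
    have : e <= eta / Num.sqrt d%:R by rewrite ge_min lexx orbT.
    by rewrite ler_norml; move=> ? ?; apply/andP; split; lra.
  by rewrite ler_pdivlMr// mulrC.
Qed.

(** The points of [K] whose direction has product more than 1/2 with [u] contain a cube, so they
    have positive volume. Finitely many cones over cells cover them; if all these cells had area 0,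
    the points would form a null set. The passage from 1/2 to 1/4 is the diameter of a cell. *)
Lemma positive_direction_cell q (w : 'I_q -> set bV) :
  (forall i, measurable (w i)) ->
  (forall u : V, enorm u = 1 -> exists i, w i u) ->
  (forall i u u', w i u -> w i u' -> enorm (u - u') <= 4^-1) ->
  forall u, enorm u = 1 -> exists i, 0 < sarea K (w i) /\
    forall u', w i u' -> 4^-1 < dot u' u.
Proof.
move=> mw cover small u u1.
have [p p0 pu] := gdir_surj K_regular u1.
have gp := gauge_gt0 K p0.
(* Gauge one half leaves room inside [K] for a neighbourhood and is in the range of [ggrad_unif]. *)
pose x0 := (2 * g p)^-1 *: p.
have gp2 : 0 < (2 * g p)^-1 by rewrite invr_gt0 mulr_gt0.
have x00 : x0 != 0 by rewrite scaler_eq0 gt_eqF.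
have gx0 : g x0 = 2^-1.
  by rewrite /x0 gaugeZ ?(ltW gp2)// invfM mulfVK// gt_eqF.
have ux0 : gdir K x0 = u by rewrite /x0 gdirZ.
pose A : set bV := [set x | [/\ x != 0, g x <= 1 & 2^-1 < dot (gdir K x) u]].
have nA : nbhs x0 A.
  have [a a0 ha] : exists2 a, 0 < a & forall y, enorm (y - x0) < a ->
      enorm (gdir K y - gdir K x0) <= 2^-1 * 2^-1 /\ g y <= 1 /\ y != 0.
    have e4 : 0 < 2^-1 * 2^-1 :> R by rewrite mulr_gt0.
    have [m [M [[m0 M0] _ _ _ mv]]] := gauge_bounds K.
    have X0 := lt_le_trans m0 (mv x0 x00).
    have em : 0 < 2^-1 * 2^-1 * enorm (ggrad K x0) / 2 by rewrite divr_gt0// mulr_gt0.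
    have [a a0 ha] := ggrad_unif K_regular em.
    have [L L0 hL] := gauge_lip K.
    exists (Num.min a (Num.min (2 * L)^-1 (enorm x0))).
      by rewrite !lt_min a0 invr_gt0 mulr_gt0//= enorm_gt0.
    move=> y; rewrite !lt_min => /andP[ya /andP[yL yx]].
    have y0 : y != 0.
      by apply: contraTneq yx => ->; rewrite sub0r enormN ltxx.
    split; last split=> //.
      rewrite enormB (le_trans (gdir_dist _ x00 y0))// ler_pdivrMr//.
      have : enorm (ggrad K y - ggrad K x0) < 2^-1 * 2^-1 * enorm (ggrad K x0) / 2.
        by apply: ha => //; rewrite gx0//; lra.
      by rewrite enormB ltr_pdivlMr// mulrC => /ltW.
    have := hL y x0; rewrite gx0 ler_norml => /andP[_ h].
    have : L * enorm (y - x0) < 2^-1.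
      by rewrite mulrC -ltr_pdivlMr// -invfM.
    lra.
  apply/nbhs_enormP; exists a => // y /ha[h1 [h2 h3]]; split=> //.
  have -> : gdir K y = u + (gdir K y - gdir K x0) by rewrite ux0 addrC subrK.
  rewrite dotDl dotxx u1 expr1n.
  have := ler_dot_enorm (gdir K y - gdir K x0) u; rewrite u1 mulr1 ler_norml => /andP[h _].
  have := h1; have := h; lra.
have [e /= e0 eA] : exists2 e, 0 < e & forall y, ball x0 e y -> A y.
  by have /nbhs_ballP[e e0 eA] := nA; exists e.
pose B : set bV := [set y : V | forall j, `|y ord0 j - x0 ord0 j| < e].
have BA : B `<=` A.
  move=> y By; apply: eA; split=> // i j; rewrite ord1.
  by have := By j; rewrite /ball/= distrC.
have volB := vol_ball_gt0 x0 e0.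
have vA : (0 < volume (A : set V))%E.
  by rewrite (lt_le_trans volB)// volE; exact: volumeS.
apply: contrapT => hn.
have mU i : measurable (under K (dircone K (w i)) (fun=> 1)).
  by apply: measurable_under => //; exact: measurable_dircone.
pose E (i : 'I_q) : set bV := if `[< exists2 u', w i u' & 2^-1 < dot u' u >] then
  under K (dircone K (w i)) (fun=> 1) else set0.
have AE : A `<=` \bigcup_i E i.
  move=> x [xn0 gx1 xu]; have [i wi] := cover _ (enorm_gdir K xn0).
  exists i => //; rewrite /E ifT; last by apply/asboolP; exists (gdir K x).
  by split=> //; exact: gauge_gt0.
have mE i : measurable (E i) by rewrite /E; case: ifP.
have : (vol d).-negligible (\bigcup_i E i).
  apply: negligible_bigcup_ord => i; rewrite /E; case: ifPn => [/asboolP[u' wu' uu']|_]; last first.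
    exact: negligible_set0.
  apply/negligibleP => //; apply: contrapT => /eqP v0; apply: hn; exists i; split; last first.
    move=> u'' wu''; have := small i _ _ wu'' wu'.
    have := ler_dot_enorm (u'' - u') u; rewrite u1 mulr1 ler_norml dotBl => /andP[h _] h'.
    lra.
  have [m [M [[m0 M0] _ _ vM mv]]] := gauge_bounds K.
  have bv x : `|enorm (ggrad K x)| <= M by rewrite ger0_norm ?enorm_ge0.
  have [h _] := @cint_bounds _ _ K K_fin (dircone K (w i)) (fun x => enorm (ggrad K x)) M m M
    (measurable_dircone K_regular (mw i)) (measurable_enorm_ggrad K_regular) bv
    (fun x x0 _ => conj (mv x x0) (vM x)).
  rewrite /sarea mulr_gt0 ?ltr0n// (lt_le_trans _ h)// mulr_gt0// /cvol /mvol.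
  rewrite fine_gt0// vol_under_fin// andbT lt_neqAle eq_sym v0/=.
  by rewrite volE volume_ge0.
move=> hN; have [N [mN N0 AN]] := negligibleS AE hN.
have : (volume (A : set V) <= volume (N : set V))%E by exact: volumeS.
by rewrite -(volE N) N0 leNgt vA.
Qed.

Lemma time_cells (delta M eta : R) : 0 < delta -> delta < M -> 0 < eta ->
  exists (N : nat) (s : nat -> R),
  [/\ s 0%N = delta, M <= s N, forall i, s i < s i.+1 & forall i, s i.+1 - s i <= eta].
Proof.
move=> d0 dM e0; exists (Num.truncn (M / eta)).+1, (fun i => delta + i%:R * eta); split.
- by rewrite mul0r addr0.
- have : M / eta < (Num.truncn (M / eta)).+1%:R by exact: truncnS_gt.
  by rewrite ltr_pdivrMr//; lra.
- by move=> i; rewrite ltrD2l ltr_pM2r// ltr_nat.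
- by move=> i; rewrite -natr1 mulrDl mul1r; lra.
Qed.

Lemma tcells_ex (delta M e : R) : 0 < delta -> delta < M -> 0 < e ->
  exists (q : nat) (a b : 'I_q.+1 -> R) (w : 'I_q.+1 -> set bV),
  [/\ forall i, [/\ 0 <= a i, a i <= b i, measurable (w i) & sandwiched K (w i)],
    trivIset setT (fun i => tcell (a i) (b i) (w i)),
    tcell (a ord0) (b ord0) (w ord0) = tcell 0 delta setT,
    forall t (u : V), delta <= t -> t < M -> enorm u = 1 ->
      exists2 i, i != ord0 & tcell (a i) (b i) (w i) (t, u) &
    forall i t t' (u u' z : V), i != ord0 -> tcell (a i) (b i) (w i) (t, u) ->
      tcell (a i) (b i) (w i) (t', u') -> enorm u = 1 -> enorm u' = 1 -> enorm z = 1 ->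
      [/\ delta <= t, delta <= t' & dot (t^-1 *: u) z <= dot (t'^-1 *: u') z + e]].
Proof.
move=> d0 dM e0.
(* Split the difference of two endpoints as [t^-1 *: (u - u') + (t^-1 * t'^-1 * (t' - t)) *: u']: as
   times are at least [delta], each of the two tolerances contributes at most [e / 2]. *)
pose eta1 := e * delta / 2; have eta10 : 0 < eta1 by rewrite divr_gt0// mulr_gt0.
pose eta2 := e * delta ^+ 2 / 2.
have eta20 : 0 < eta2 by rewrite divr_gt0// mulr_gt0// exprn_gt0.
have [q [w [hw tw cover small]]] := dir_cells eta10.
have [N [s [s0 sN s_lt s_eta]]] := time_cells d0 dM eta20.
have s_le i k : (i <= k)%N -> s i <= s k.
  move=> /subnK <-; elim: (k - i)%N => [|l IH]; first by rewrite add0n.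
  by rewrite addSn (le_trans IH)// ltW.
have s_d i : delta <= s i by rewrite -s0 s_le.
have s_uniq i k (t : R) : s i <= t -> t < s i.+1 -> s k <= t -> t < s k.+1 -> i = k.
  move=> h1 h2 h3 h4; have [ik|ki|//] := ltngtP i k.
    by have := le_lt_trans h3 h2; rewrite ltNge s_le.
  by have := le_lt_trans h1 h4; rewrite ltNge s_le.
pose T : finType := ('I_N * 'I_q)%type.
(* [None] marks the single cell of the times before [delta], with all directions. *)
pose idx (i : 'I_#|T|.+1) : option T :=
  if unlift ord0 i is Some k then Some (enum_val k) else None.
pose a i := if idx i is Some p then s p.1 else 0.
pose b i := if idx i is Some p then s p.1.+1 else delta.
pose W i := if idx i is Some p then w p.2 else setT.
have idx0 : idx ord0 = None by rewrite /idx unlift_none.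
have idxS k : idx (lift ord0 k) = Some (enum_val k) by rewrite /idx liftK.
exists #|T|, a, b, W; split.
- move=> i; rewrite /a /b /W; case: (idx i) => [p|].
    have [mwp swp] := hw p.2; split=> //; first by rewrite (le_trans _ (s_d _))// ltW.
    exact/ltW/s_lt.
  split=> //; [exact: ltW|exact: sandwiched_setT].
- move=> i i' _ _ [[t u] []]; rewrite /a /b /W.
  case: (unliftP ord0 i) => [k ->|->]; case: (unliftP ord0 i') => [k' ->|->]//;
    rewrite ?idx0 ?idxS /= => -[/= h1 h2 h3] [/= h4 h5 h6].
  + congr (lift _ _); apply: enum_val_inj.
    have E1 : val (enum_val k).1 = val (enum_val k').1 by exact: s_uniq h1 h2 h4 h5.
    have E2 : (enum_val k).2 = (enum_val k').2 by apply: tw => //; exists u.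
    move: E1 E2; case: (enum_val k) => x1 x2; case: (enum_val k') => y1 y2 /= E1 ->.
    by congr (_, _); apply: val_inj.
  + by have := le_lt_trans (le_trans (s_d _) h1) h5; rewrite ltxx.
  + by have := le_lt_trans (le_trans (s_d _) h4) h2; rewrite ltxx.
- by rewrite /a /b /W idx0.
- move=> t u dt tM u1.
  have [k kN [h1 h2]] : exists2 k, (k < N)%N & s k <= t /\ t < s k.+1.
    have tN : t < s N by exact: lt_le_trans sN.
    elim: N tN {T idx a b W idx0 idxS sN} => [|n IH] tN; first by lra.
    have [hn|hn] := ltP t (s n); last by exists n.
    by have [k kn hk] := IH hn; exists k => //; exact: ltnW.
  have [j wj] := cover u u1.
  exists (lift ord0 (enum_rank ((Ordinal kN, j) : T))); first by rewrite eq_sym neq_lift.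
  by rewrite /a /b /W idxS enum_rankK.
- move=> i t t' u u' z; case: (unliftP ord0 i) => [k ->|->]; rewrite ?eqxx// => _.
  rewrite /a /b /W idxS => -[/= h1 h2 h3] [/= h4 h5 h6] u1 u'1 z1.
  have dt : delta <= t by exact: le_trans (s_d _) h1.
  have dt' : delta <= t' by exact: le_trans (s_d _) h4.
  split=> //; rewrite -lerBlDl -dotBl.
  have t0 : 0 < t by exact: lt_le_trans dt.
  have t'0 : 0 < t' by exact: lt_le_trans dt'.
  have -> : t^-1 *: u - t'^-1 *: u' = t^-1 *: (u - u') + (t^-1 * t'^-1 * (t' - t)) *: u'.
    apply/rowP => j; rewrite !mxE; field; by rewrite !gt_eqF.
  rewrite dotDl !dotZl.
  have hu : dot (u - u') z <= eta1.
    by rewrite (le_trans (cauchy_schwarz _ _))// z1 mulr1; exact: small h3 h6.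
  have hu' := ler_dot_enorm u' z; rewrite u'1 z1 mulr1 in hu'.
  have e1 : t^-1 * dot (u - u') z <= e / 2.
    by rewrite mulrC ler_pdivrMr// (le_trans hu)// /eta1 mulrAC ler_pM2l ?divr_gt0.
  have htt : `|t' - t| <= eta2.
    by have := s_eta (enum_val k).1; rewrite ler_norml => ?; apply/andP; split; lra.
  have e2 : t^-1 * t'^-1 * (t' - t) * dot u' z <= e / 2.
    rewrite (le_trans (ler_norm _))// !normrM (gtr0_norm (x := t^-1)) ?invr_gt0//.
    rewrite (gtr0_norm (x := t'^-1)) ?invr_gt0//.
    rewrite (@le_trans _ _ (t^-1 * t'^-1 * eta2))//.
      have A0 : 0 <= t^-1 * t'^-1 by rewrite mulr_ge0 ?invr_ge0 ?ltW.
      rewrite -[leRHS]mulr1; apply: ler_pM => //; first exact: mulr_ge0.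
      exact: ler_wpM2l.
    rewrite -invfM mulrC ler_pdivrMr ?mulr_gt0// /eta2 mulrAC ler_pM2l ?divr_gt0//.
    by rewrite expr2 ler_pM// ltW.
  lra.
Qed.

End direction_cells.

(** * Multinomial counts and their Poisson limit *)

Section counting.

Lemma card_count (n : nat) (Q : nat -> bool) :
  ([set i | (i < n)%N /\ Q i] #= `I_(\sum_(i < n) Q i)%N)%card.
Proof.
elim: n => [|n IH].
  by rewrite big_ord0 (_ : [set i | _] = set0) ?II0//; apply/seteqP; split=> // i [].
rewrite big_ord_recr /=; case Qn : (Q n); last first.
  rewrite addn0 (_ : [set i | _] = [set i | (i < n)%N /\ Q i])//.
  apply/seteqP; split=> i [/=]; last by move=> iN Qi; split=> //; exact: ltnW.
  rewrite ltnS leq_eqVlt => /orP[/eqP ->|//]; by rewrite Qn.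
rewrite addn1 (_ : [set i | _] = n |` [set i | (i < n)%N /\ Q i]).
  by apply: card_setU1 => // -[/=]; rewrite ltnn.
apply/seteqP; split=> i.
  by move=> [/=]; rewrite ltnS leq_eqVlt => /orP[/eqP ->|iN] Qi; [left|right].
by move=> [->|[iN Qi]] /=; split=> //; exact: ltnW.
Qed.

Lemma card_countP (n k : nat) (Q : nat -> bool) :
  ([set i | (i < n)%N /\ Q i] #= `I_k)%card <-> (\sum_(i < n) Q i)%N = k.
Proof.
split=> [h|<-]; last exact: card_count.
apply/card_eq_II; apply: card_eq_trans h; apply: card_esym; exact: card_count.
Qed.

End counting.

Section real_probability.
Context {R : realType} {dO : measure_display} {Omega : measurableType dO}.
Variable P : probability Omega R.

Definition pr (A : set Omega) : R := fine (P A).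

Lemma prE A : measurable A -> P A = (pr A)%:E.
Proof. by move=> mA; rewrite fineK// fin_num_measure. Qed.

Lemma pr_ge0 A : 0 <= pr A. Proof. by rewrite fine_ge0. Qed.

Lemma prS A B : measurable A -> measurable B -> A `<=` B -> pr A <= pr B.
Proof.
move=> mA mB AB; rewrite fine_le// ?fin_num_measure//.
by apply: le_measure => //; rewrite inE.
Qed.

Lemma pr_le1 A : measurable A -> pr A <= 1.
Proof. by move=> mA; rewrite -lee_fin -prE//; exact: probability_le1. Qed.

Lemma pr0 : pr set0 = 0. Proof. by rewrite /pr measure0. Qed.

Lemma prT : pr setT = 1. Proof. by rewrite /pr probability_setT. Qed.

Lemma prU A B : measurable A -> measurable B -> A `&` B = set0 ->
  pr (A `|` B) = pr A + pr B.
Proof. by move=> mA mB AB; rewrite /pr measureU// fineD// fin_num_measure. Qed.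

Lemma prC A : measurable A -> pr (~` A) = 1 - pr A.
Proof.
move=> mA; rewrite -prT -(setvU A) prU ?addrK//; first exact: measurableC.
exact: setICl.
Qed.

Lemma pr_bigcup_ord (I : finType) (F : I -> set Omega) :
  (forall i, measurable (F i)) -> trivIset setT F ->
  pr (\bigcup_i F i) = \sum_i pr (F i).
Proof.
move=> mF tF; rewrite /pr measure_fin_bigcup//.
rewrite fsbig_finite//= (eq_bigr (fun i => (pr (F i))%:E)) => [|i _]; last exact: prE.
rewrite sumEFin /=.
rewrite (perm_big (index_enum I))//=; apply: uniq_perm; [exact: fset_uniq|exact: index_enum_uniq|].
  by move=> i; rewrite mem_index_enum in_fset_set; [exact: mem_set|exact: finite_finset].
exact: finite_finset.
Qed.

Lemma pr_split (I : finType) (A : set Omega) (F : I -> set Omega) :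
  measurable A -> (forall i, measurable (F i)) -> trivIset setT F ->
  pr A = pr (A `&` ~` \bigcup_i F i) + \sum_i pr (A `&` F i).
Proof.
move=> mA mF tF; have mU : measurable (\bigcup_i F i).
  by apply: fin_bigcup_measurable.
rewrite -pr_bigcup_ord; last 2 first.
- by move=> i; exact: measurableI.
- by move=> i j _ _ [t [[_ Fi] [_ Fj]]]; apply: tF => //; exists t.
rewrite -setI_bigcupr -prU.
- by congr pr; rewrite -setIUr setUC setUv setIT.
- by apply: measurableI => //; exact: measurableC.
- exact: measurableI.
- by apply/seteqP; split=> // t [[_ h] [_ /h]].
Qed.

End real_probability.

Section multinomial.
Context {R : realType} {q : nat}.
Variables (p0 : R) (p : 'I_q -> R).

Definition sub1c (c : 'I_q -> nat) (j : 'I_q) : 'I_q -> nat :=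
  fun i => (c i - (i == j))%N.

(** Recursion on the last of [n] independent samples: with probability [p0] it is in no cell, with
    probability [p j] in the cell [j]. *)
Fixpoint multinom (n : nat) (c : 'I_q -> nat) : R :=
  match n with
  | 0 => ([forall j, c j == 0%N])%:R
  | n'.+1 => p0 * multinom n' c +
      \sum_(j < q) (if (0 < c j)%N then p j * multinom n' (sub1c c j) else 0)
  end.

Lemma sum_sub1c c j : (0 < c j)%N -> (\sum_i c i)%N = (\sum_i sub1c c j i).+1.
Proof.
move=> cj; rewrite (bigD1 j)//= [in RHS](bigD1 j)//= /sub1c eqxx subn1.
rewrite -addSn prednK//; congr addn; apply: eq_bigr => i ij.
by rewrite (negbTE ij) subn0.
Qed.

Lemma prod_sub1c c j : (0 < c j)%N ->
  \prod_i p i ^+ c i = p j * \prod_i p i ^+ sub1c c j i.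
Proof.
move=> cj; rewrite (bigD1 j)//= [in RHS](bigD1 j)//= /sub1c eqxx subn1 mulrA.
rewrite -exprS prednK//; congr *%R; apply: eq_bigr => i ij.
by rewrite (negbTE ij) subn0.
Qed.

Lemma fact_sub1c c j : (0 < c j)%N ->
  \prod_i (c i)`!%:R = (c j)%:R * \prod_i (sub1c c j i)`!%:R :> R.
Proof.
move=> cj; rewrite (bigD1 j)//= [in RHS](bigD1 j)//= /sub1c eqxx subn1 mulrA.
rewrite -natrM -[in RHS](prednK cj) -factS prednK//; congr *%R.
by apply: eq_bigr => i ij; rewrite (negbTE ij) subn0.
Qed.

Lemma ffact_rec n s : (n.+1 ^_ s = n ^_ s + s * n ^_ s.-1)%N.
Proof.
case: s => [|s]; first by rewrite !ffactn0 mul0n addn0.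
rewrite ffactSS ffactnSr /= (mulnC (n ^_ s)) -mulnDl; have [sn|ns] := leqP s n.
  by congr muln; lia.
by rewrite ffact_small// !muln0.
Qed.

(** Multiplied by the factorials to avoid division; the falling factorial vanishes when more than
    [n] samples are asked for, so the formula has no exception. *)
Lemma multinomE n c : multinom n c * \prod_i (c i)`!%:R =
  (n ^_ (\sum_i c i))%:R * \prod_i p i ^+ c i * p0 ^+ (n - \sum_i c i).
Proof.
elim: n c => [|n IH] c /=.
  case: forallP => [h|h].
    have c0 i : c i = 0%N by apply/eqP.
    rewrite big1 => [|i _]; last by rewrite c0.
    rewrite big1 => [|i _]; last by rewrite c0.
    by rewrite big1 ?mulr1// => i _; rewrite c0 expr0.
  rewrite mul0r ffact_small ?mul0r// lt0n sum_nat_eq0.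
  by apply/negP => /forallP hc; apply: h.
set s := (\sum_i c i)%N; pose pc := \prod_i p i ^+ c i.
have E1 : p0 * multinom n c * \prod_i (c i)`!%:R =
    (n ^_ s)%:R * pc * p0 ^+ (n.+1 - s).
  rewrite -mulrA IH -/s -/pc mulrCA; have [sn|ns] := leqP s n.
    by rewrite subSn// exprS.
  by rewrite ffact_small// !mul0r.
have E2 j : (if (0 < c j)%N then p j * multinom n (sub1c c j) else 0) *
    \prod_i (c i)`!%:R = (c j)%:R * ((n ^_ s.-1)%:R * pc * p0 ^+ (n.+1 - s)).
  case: ifPn => [cj|]; last by rewrite -leqNgt leqn0 => /eqP ->; rewrite !mul0r.
  rewrite (fact_sub1c cj); have := IH (sub1c c j).
  set F := \prod_i _; set M := multinom n _ => IHM.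
  transitivity ((c j)%:R * (p j * (M * F))); first by ring.
  rewrite IHM /pc (prod_sub1c cj) /s (sum_sub1c cj) subSS /=; ring.
rewrite mulrDl E1 mulr_suml (eq_bigr _ (fun j _ => E2 j)) -mulr_suml.
rewrite ffact_rec natrD natrM -/pc -/s; have -> : \sum_i (c i)%:R = s%:R :> R by rewrite /s natr_sum.
set Q := p0 ^+ _; ring.
Qed.

End multinomial.

(** * Counts of an independent sample *)

Section iid_counts.
Context {R : realType} {dO : measure_display} {Omega : measurableType dO}.
Variable P : probability Omega R.
Context {dT : measure_display} {T : measurableType dT}.
Variable X : nat -> Omega -> T.
Hypothesis X_meas : forall i, measurable_fun setT (X i).
Hypothesis X_indep : mutually_independent P X.
Context {q : nat}.
Variable C : 'I_q -> set T.
Hypothesis mC : forall j, measurable (C j).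
Hypothesis tC : trivIset setT C.
Variable p : 'I_q -> R.
Hypothesis pE : forall i j, pr P (X i @^-1` C j) = p j.

Definition cnt (n : nat) (j : 'I_q) (o : Omega) : nat :=
  (\sum_(i < n) `[< C j (X i o) >])%N.

Definition count_event (n : nat) (c : 'I_q -> nat) : set Omega :=
  [set o | forall j, cnt n j o = c j].

Let C0 : set T := ~` \bigcup_j C j.
Let p0 := 1 - \sum_j p j.

Let mC0 : measurable C0.
Proof. by apply: measurableC; exact: fin_bigcup_measurable. Qed.

Let mX i (B : set T) : measurable B -> measurable (X i @^-1` B).
Proof. by move=> mB; rewrite -[X in measurable X]setTI; exact: X_meas. Qed.

Let tX i : trivIset setT (fun j => X i @^-1` C j).
Proof. by move=> j k _ _ [t [Cj Ck]]; apply: tC => //; exists (X i t). Qed.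

Let p0E i : pr P (X i @^-1` C0) = p0.
Proof.
have mU : measurable (\bigcup_j C j) by exact: fin_bigcup_measurable.
transitivity (1 - pr P (X i @^-1` \bigcup_j C j)).
  by rewrite -prC//; exact: mX.
rewrite preimage_bigcup pr_bigcup_ord//; last by move=> j; exact: mX.
by congr (_ - _); apply: eq_bigr => j _; exact: pE.
Qed.

Lemma cntS n j o : cnt n.+1 j o = (cnt n j o + `[< C j (X n o) >])%N.
Proof. by rewrite /cnt big_ord_recr. Qed.

Lemma cntS_in n j k o : C k (X n o) -> cnt n.+1 j o = (cnt n j o + (j == k))%N.
Proof.
move=> Ck; rewrite cntS; congr addn; have [->|jk] := eqVneq j k.
  by rewrite asboolT.
rewrite asboolF// => Cj; move/eqP: jk; apply; apply: tC => //.
by exists (X n o).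
Qed.

Lemma cntS_out n j o : C0 (X n o) -> cnt n.+1 j o = cnt n j o.
Proof.
by move=> h; rewrite cntS asboolF ?addn0// => Cj; apply: h; exists j.
Qed.

Lemma count_event_out n c :
  count_event n.+1 c `&` X n @^-1` C0 = count_event n c `&` X n @^-1` C0.
Proof.
apply/seteqP; split=> o [h Co]; split=> // j; have := h j.
  by rewrite cntS_out.
by rewrite cntS_out.
Qed.

Lemma count_event_in n c k :
  count_event n.+1 c `&` X n @^-1` C k =
  if (0 < c k)%N then count_event n (sub1c c k) `&` X n @^-1` C k else set0.
Proof.
case: ifPn => [ck|]; last first.
  rewrite -leqNgt leqn0 => /eqP ck; apply/seteqP; split=> // o [/(_ k) + Co].
  by rewrite (cntS_in _ Co) eqxx ck addn1.
apply/seteqP; split=> o [h Co]; split=> // j; have := h j; rewrite (cntS_in _ Co) /sub1c.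
  by move=> <-; rewrite addnK.
have [->|jk] := eqVneq j k; last by rewrite subn0 addn0.
by move=> ->; rewrite subnK.
Qed.

Lemma measurable_count_event n c : measurable (count_event n c).
Proof.
elim: n c => [|n IH] c.
  have [h|h] := pselect (forall j, c j = 0%N).
    rewrite (_ : count_event 0 c = setT)//; apply/seteqP; split=> // o _ j.
    by rewrite /cnt big_ord0 h.
  rewrite (_ : count_event 0 c = set0)//; apply/seteqP; split=> // o ho.
  by apply: h => j; have := ho j; rewrite /cnt big_ord0.
rewrite (_ : count_event n.+1 c = (count_event n.+1 c `&` X n @^-1` C0) `|`
    \bigcup_k (count_event n.+1 c `&` X n @^-1` C k)).
  apply: measurableU; first by rewrite count_event_out; apply: measurableI => //; exact: mX.
  apply: fin_bigcup_measurable => // k _; rewrite count_event_in.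
  by case: ifP => // _; apply: measurableI => //; exact: mX.
rewrite -setI_bigcupr -setIUr -preimage_bigcup -preimage_setU.
by rewrite /C0 setUC setUv preimage_setT setIT.
Qed.

(** Independence speaks of one set per index. The induction therefore carries such constraints on
    the samples from [n] on, and turns the last counted sample into one more constraint, in a cell
    or outside all of them. *)
Lemma pr_count_event_indep n c (J : {fset nat}) (B : nat -> set T) :
  (forall j, j \in J -> measurable (B j)) -> (forall j, j \in J -> (n <= j)%N) ->
  pr P (count_event n c `&` \bigcap_(j in [set` J]) (X j @^-1` B j)) =
  multinom p0 p n c * \prod_(j <- J) pr P (X j @^-1` B j).
Proof.
elim: n c J B => [|n IH] c J B mB Jn.
  have JE : pr P (\bigcap_(j in [set` J]) (X j @^-1` B j)) =
      \prod_(j <- J) pr P (X j @^-1` B j).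
    rewrite /pr X_indep// big_seq [in RHS]big_seq.
    rewrite (eq_bigr (fun j => (pr P (X j @^-1` B j))%:E)) => [|j jJ]; last first.
      by apply: prE; apply: mX; exact: mB.
    by rewrite prodEFin.
  rewrite /=; case: forallP => [h|h].
    rewrite (_ : count_event 0 c = setT) ?setTI ?mul1r//; apply/seteqP; split=> // o _ j.
    by rewrite /cnt big_ord0; apply/esym/eqP.
  rewrite (_ : count_event 0 c = set0) ?set0I ?pr0 ?mul0r//; apply/seteqP; split=> // o ho.
  by apply: h => j; have := ho j; rewrite /cnt big_ord0 => <-.
set F := \bigcap_(j in _) _.
have mF : measurable F.
  by apply: fin_bigcap_measurable => // j jJ; apply: mX; exact: mB.
have nJ : n \notin J by apply/negP => /Jn; rewrite ltnn.
pose B' D j := if j == n then D else B j.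
have step c' (D : set T) : measurable D ->
    pr P (count_event n c' `&` X n @^-1` D `&` F) =
    multinom p0 p n c' * (pr P (X n @^-1` D) * \prod_(j <- J) pr P (X j @^-1` B j)).
  move=> mD; have := IH c' (n |` J)%fset (B' D).
  have BD : B' D n = D by rewrite /B' eqxx.
  rewrite big_fsetU1//= BD => H.
  have -> : \prod_(j <- J) pr P (X j @^-1` B j) = \prod_(j <- J) pr P (X j @^-1` B' D j).
    rewrite big_seq [in RHS]big_seq; apply: eq_bigr => j jJ; rewrite /B' ifF//.
    by apply/negbTE; apply: contraNneq nJ => <-.
  rewrite -H.
  - congr pr; rewrite -setIA; congr (_ `&` _); apply/seteqP; split=> o.
      move=> [Do Fo] j /=; rewrite in_fset1U => /orP[/eqP ->|jJ]; rewrite /B'.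
        by rewrite eqxx.
      by case: eqP => [->//|_]; exact: Fo.
    move=> h; split.
      by have := h n; rewrite /= in_fset1U eqxx /B' eqxx; exact.
    move=> j jJ; have := h j; rewrite /= in_fset1U jJ orbT /B' => /(_ isT).
    by case: eqP => // jn; move: nJ; rewrite -jn jJ.
  - move=> j; rewrite in_fset1U /B'; case: eqP => //= _; exact: mB.
  - by move=> j; rewrite in_fset1U => /orP[/eqP ->//|/Jn]; exact: ltnW.
rewrite (@pr_split _ _ _ P _ _ (fun k => X n @^-1` C k)).
- have -> : ~` (\bigcup_k (X n @^-1` C k)) = X n @^-1` C0.
    by apply/seteqP; split=> o h [k _ Ck]; apply: h; exists k.
  rewrite setIAC count_event_out step//.
  rewrite /= mulrDl p0E mulrCA mulrA; congr +%R.
  rewrite mulr_suml; apply: eq_bigr => k _.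
  rewrite setIAC count_event_in; case: ifPn => [ck|_]; last by rewrite set0I pr0 mul0r.
  by rewrite step// pE mulrCA mulrA.
- by apply: measurableI => //; exact: measurable_count_event.
- by move=> k; exact: mX.
- exact: tX.
Qed.

Lemma pr_count_event n c : pr P (count_event n c) = multinom p0 p n c.
Proof.
have := @pr_count_event_indep n c fset0 (fun=> setT).
rewrite big_nil mulr1 (_ : \bigcap_(j in _) _ = setT) ?setIT; first by apply.
by apply/seteqP; split.
Qed.

End iid_counts.

(** * The Poisson limit of multinomial probabilities *)

Section poisson_limit.
Context {R : realType}.

Lemma expR_ge_1B (y : R) : y < 1 -> expR (- (y / (1 - y))) <= 1 - y.
Proof.
move=> y1; have y0 : 0 < 1 - y by rewrite subr_gt0.
rewrite expRN -[leRHS]invrK lef_pV2 ?posrE ?invr_gt0 ?expR_gt0//.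
apply: le_trans (expR_ge1Dx _).
have yn : 1 - y != 0 by rewrite gt_eqF.
by rewrite (_ : 1 + y / (1 - y) = (1 - y)^-1)//; field.
Qed.

Lemma cvg_eventually (u w : nat -> R) (l : R) N :
  (forall n, (N <= n)%N -> u n = w n) -> w n @[n --> \oo] --> l ->
  u n @[n --> \oo] --> l.
Proof.
move=> uw; apply: cvg_trans; apply: near_eq_cvg; exists N => // n /= Nn.
exact/esym/uw.
Qed.

(** Squeezed by [expR (- (y / (1 - y))) <= 1 - y <= expR (- y)]: as [n * y n] converges, [y n] tends
    to 0, and removing [s] factors changes nothing in the limit. *)
Lemma cvg_pow_1B (y : nat -> R) (l : R) (s : nat) :
  (forall n, 0 <= y n) -> n%:R * y n @[n --> \oo] --> l ->
  (1 - y n) ^+ (n - s) @[n --> \oo] --> expR (- l).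
Proof.
move=> y_ge0 ny.
have y0 : y n @[n --> \oo] --> (0 : R).
  have n1 : (n%:R^-1 : R) @[n --> \oo] --> (0 : R).
    apply/gtr0_cvgV0; last exact: cvgr_idn.
    by exists 1%N => // n /= n0; rewrite ltr0n.
  have := cvgM ny n1 => /(_ _); rewrite mulr0; apply: (@cvg_eventually _ _ _ 1) => n n0 /=.
  by rewrite mulrAC divff ?mul1r// pnatr_eq0 -lt0n.
have z : (n - s)%:R * y n @[n --> \oo] --> l.
  have : n%:R * y n - s%:R * y n @[n --> \oo] --> l - s%:R * 0.
    by apply: cvgB => //; apply: cvgM => //; exact: cvg_cst.
  rewrite mulr0 subr0; apply: (@cvg_eventually _ _ _ s) => n sn.
  by rewrite natrB// mulrBl.
have w : (n - s)%:R * y n / (1 - y n) @[n --> \oo] --> l.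
  rewrite -[X in _ --> X](mulr1 l) -[X in l * X]invr1 -[X in l * X^-1](subr0 1).
  apply: cvgM => //; apply: cvgV; first by rewrite subr0 oner_eq0.
  by apply: cvgB => //; exact: cvg_cst.
have E u : u n @[n --> \oo] --> l -> expR (- u n) @[n --> \oo] --> expR (- l).
  move=> ul; apply: (@cvg_comp _ _ _ (fun n => - u n) expR); last exact: continuous_expR.
  exact: cvgN.
apply: (squeeze_cvgr _ (E _ w) (E _ z)).
near=> n; have yn1 : y n < 1.
  near: n; apply: (cvgr_lt 0) => //; exact: ltr01.
have e1 : - ((n - s)%:R * y n / (1 - y n)) = (n - s)%:R * - (y n / (1 - y n)).
  by rewrite mulrN mulrA.
have e2 : - ((n - s)%:R * y n) = (n - s)%:R * - y n by rewrite mulrN.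
rewrite e1 e2 !expRM_natl; apply/andP; split.
  by rewrite lerXn2r ?nnegrE ?expR_ge0 ?subr_ge0 ?(ltW yn1)// expR_ge_1B.
rewrite lerXn2r ?nnegrE ?expR_ge0 ?subr_ge0 ?(ltW yn1)//.
exact: expR_ge1Dx.
Unshelve. all: by end_near. Qed.

Lemma cvg_prod (I : finType) (u : I -> nat -> R) (l : I -> R) :
  (forall i, u i n @[n --> \oo] --> l i) ->
  \prod_i u i n @[n --> \oo] --> \prod_i l i.
Proof.
move=> ul; elim: (index_enum I) => [|i s IH].
  by rewrite big_nil; under eq_fun do rewrite big_nil; exact: cvg_cst.
by rewrite big_cons; under eq_fun do rewrite big_cons; exact: cvgM.
Qed.

Lemma cvg_sum_fin (I : finType) (u : I -> nat -> R) (l : I -> R) :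
  (forall i, u i n @[n --> \oo] --> l i) ->
  \sum_i u i n @[n --> \oo] --> \sum_i l i.
Proof.
move=> ul; elim: (index_enum I) => [|i s IH].
  by rewrite big_nil; under eq_fun do rewrite big_nil; exact: cvg_cst.
by rewrite big_cons; under eq_fun do rewrite big_cons; exact: cvgD.
Qed.

Lemma cvg_ffact (s : nat) :
  ((n ^_ s)%:R / n%:R ^+ s : R) @[n --> \oo] --> (1 : R).
Proof.
elim: s => [|s IH].
  under eq_fun do rewrite ffactn0 expr0 divr1; exact: cvg_cst.
have n1 : (n%:R^-1 : R) @[n --> \oo] --> (0 : R).
  apply/gtr0_cvgV0; last exact: cvgr_idn.
  by exists 1%N => // n /= n0; rewrite ltr0n.
have : (n ^_ s)%:R / n%:R ^+ s * (1 - s%:R * n%:R^-1) @[n --> \oo] --> (1 : R) * (1 - s%:R * 0).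
  apply: cvgM => //; apply: cvgB; first exact: cvg_cst.
  by apply: cvgM => //; exact: cvg_cst.
rewrite mulr0 subr0 mulr1; apply: (@cvg_eventually _ _ _ s.+1) => n sn.
have n0 : n%:R != 0 :> R by rewrite pnatr_eq0; lia.
rewrite ffactnSr natrM natrB ?(ltnW sn)// exprS; field.
by rewrite n0 expf_neq0.
Qed.

Definition poisson_pr (lambda : R) (k : nat) : R :=
  lambda ^+ k / k`!%:R * expR (- lambda).

Lemma poisson_probE (lambda : R) k : 0 <= lambda ->
  poisson_prob lambda 0 [set k] = (poisson_pr lambda k)%:E.
Proof.
move=> l0; rewrite /poisson_prob /poisson_pr; case: ifPn => [lp|].
  by rewrite esum_set1 ?lee_fin ?poisson_pmf_ge0// /poisson_pmf lp.
rewrite -leNgt => l0'; have -> : lambda = 0 by apply/eqP; rewrite eq_le l0 l0'.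
rewrite diracE oppr0 expR0 mulr1; case: k => [|k].
  by rewrite mem_set// expr0 fact0 divr1.
by rewrite memNset// expr0n mul0r.
Qed.

(** The closed form is a product of three convergent factors: the falling factorial over the power
    of [n], the powers of [n * p n j], and a power of the probability of no cell. *)
Lemma cvg_multinom (q : nat) (p : nat -> 'I_q -> R) (lambda : 'I_q -> R) c :
  (forall n j, 0 <= p n j) ->
  (forall j, n%:R * p n j @[n --> \oo] --> lambda j) ->
  multinom (1 - \sum_j p n j) (p n) n c @[n --> \oo] -->
    \prod_j poisson_pr (lambda j) (c j).
Proof.
move=> p_ge0 np; set s := (\sum_j c j)%N.
have ys : n%:R * (\sum_j p n j) @[n --> \oo] --> \sum_j lambda j.
  under eq_fun do rewrite mulr_sumr; exact: cvg_sum_fin.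
have h1 := @cvg_pow_1B (fun n => \sum_j p n j) _ s (fun n => sumr_ge0 _ (fun j _ => p_ge0 n j)) ys.
have h2 : \prod_j ((n%:R * p n j) ^+ c j / (c j)`!%:R) @[n --> \oo] -->
    \prod_j (lambda j ^+ c j / (c j)`!%:R).
  apply: cvg_prod => j; apply: cvgM; last exact: cvg_cst.
  elim: (c j) => [|k IH].
    by rewrite expr0; under eq_fun do rewrite expr0; exact: cvg_cst.
  by rewrite exprS; under eq_fun do rewrite exprS; exact: cvgM.
have -> : \prod_j poisson_pr (lambda j) (c j) =
    1 * \prod_j (lambda j ^+ c j / (c j)`!%:R) * expR (- \sum_j lambda j).
  rewrite mul1r /poisson_pr big_split /=; congr *%R.
  by rewrite -sumrN expR_sum.
have h3 : (n ^_ s)%:R / n%:R ^+ s * \prod_j ((n%:R * p n j) ^+ c j / (c j)`!%:R)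
    @[n --> \oo] --> 1 * \prod_j (lambda j ^+ c j / (c j)`!%:R).
  by apply: cvgM => //; exact: cvg_ffact.
have : (n ^_ s)%:R / n%:R ^+ s * \prod_j ((n%:R * p n j) ^+ c j / (c j)`!%:R) *
    (1 - \sum_j p n j) ^+ (n - s) @[n --> \oo] -->
    1 * \prod_j (lambda j ^+ c j / (c j)`!%:R) * expR (- \sum_j lambda j).
  exact: cvgM.
apply: (@cvg_eventually _ _ _ 1) => n n0.
have n0' : n%:R != 0 :> R by rewrite pnatr_eq0; lia.
have F0 : \prod_j (c j)`!%:R != 0 :> R.
  by apply/prodf_neq0 => j _; rewrite pnatr_eq0 -lt0n fact_gt0.
apply: (mulIf F0); rewrite multinomE -/s /= big_split /= prodfV.
set F := \prod_j _`!%:R in F0 *.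
have -> : \prod_j (n%:R * p n j) ^+ c j = n%:R ^+ s * \prod_j p n j ^+ c j.
  rewrite /s -prodrXr -big_split /=; apply: eq_bigr => j _; exact: exprMn.
set A := \prod_j _; set B := _ ^+ (n - s); field.
by rewrite F0 expf_neq0.
Qed.

End poisson_limit.

(** * Random vectors of bodies *)

Section body_vectors.
Context {R : realType} {d m : nat}.
Local Notation V := 'rV[R]_d.
Local Notation body := (body0 R d).
Local Notation bodies := {ptws 'I_m -> body}.
Implicit Types y z : bodies.

Definition vclose (e : R) y z := forall r, hausdorff_dist (y r) (z r) < e.

Lemma vclose_sym e y z : vclose e y z -> vclose e z y.
Proof. by move=> h r; rewrite hausdorff_sym. Qed.

Lemma vclose_refl e y : 0 < e -> vclose e y y.
Proof. by move=> e0 r; rewrite hausdorff_xx. Qed.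

Lemma vclose_trans e e' x y z : vclose e x y -> vclose e' y z -> vclose (e + e') x z.
Proof.
move=> h1 h2 r; rewrite (le_lt_trans (hausdorff_triangle (y r) _ _))//.
by rewrite ltrD.
Qed.

Lemma vclose_le e e' y z : e <= e' -> vclose e y z -> vclose e' y z.
Proof. by move=> ee h r; exact: lt_le_trans (h r) ee. Qed.

Lemma body_ballE (K L : body) (e : R) : ball K e L = (hausdorff_dist K L < e).
Proof. by rewrite ballEmdist. Qed.

(** There are finitely many coordinates, so one radius for all of them describes the product
    topology. One half shows that the filter of these neighbourhoods converges in each coordinate,
    the other adds the coordinates one by one. *)
Lemma nbhs_bodiesP y (A : set bodies) :
  nbhs y A <-> exists2 e, 0 < e & forall z, vclose e y z -> A z.
Proof.
split=> [|[e e0 eA]].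
  pose F : set_system bodies := filter_from [set e : R | 0 < e] (fun e => [set z | vclose e y z]).
  have FF : Filter F.
    apply: filter_from_filter; first by exists 1 => /=; exact: ltr01.
    move=> e e' /= e0 e'0; exists (Num.min e e') => [|z h]; first by rewrite /= lt_min e0.
    by split=> r; have := h r; rewrite lt_min => /andP[].
  have : F --> y.
    apply/cvg_sup => i B; rewrite nbhsE => -[C [[D oD DC] Cy] CB].
    have /nbhs_ballP[e /= e0 eD] : nbhs (y i) D.
      by apply: open_nbhs_nbhs; split=> //; move: Cy; rewrite -DC.
    exists e => // z hz; apply: CB; rewrite -DC; apply: eD.
    by rewrite body_ballE; exact: hz.
  by move=> + yA => /(_ A yA)[e /= e0 eA]; exists e.
have h k : (k <= m)%N -> nbhs y [set z : bodies | forall r : 'I_m, (r < k)%N -> hausdorff_dist (y r) (z r) < e].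
  elim: k => [|k IH] km; first by apply: filterS filterT.
  have := IH (ltnW km); have hk : nbhs y [set z : bodies | hausdorff_dist (y (Ordinal km)) (z (Ordinal km)) < e].
    have hp : nbhs (proj (Ordinal km) y) (ball (y (Ordinal km)) e) by exact: nbhsx_ballx.
    have hq : nbhs y (proj (Ordinal km) @^-1` ball (y (Ordinal km)) e).
      exact: (@proj_continuous 'I_m (fun=> body) (Ordinal km) y _ hp).
    have hs : proj (Ordinal km) @^-1` ball (y (Ordinal km)) e `<=`
        [set z : bodies | hausdorff_dist (y (Ordinal km)) (z (Ordinal km)) < e].
      move=> z; rewrite /preimage /=.
      by rewrite (body_ballE (y (Ordinal km)) (z (Ordinal km)) e).
    exact: (@filterS _ (nbhs y) _ _ _ hs hq).
  apply: filterS2 hk => z /= zk zlt r; rewrite ltnS leq_eqVlt => /orP[/eqP rk|]; last exact: zlt.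
  by have -> : r = Ordinal km by exact: val_inj.
by apply: filterS (h m (leqnn m)) => z hz; apply: eA => r; exact: hz.
Qed.

Lemma open_bodiesP (A : set bodies) :
  open A <-> forall y, A y -> exists2 e, 0 < e & forall z, vclose e y z -> A z.
Proof.
by rewrite openE; split=> h y Ay; apply/nbhs_bodiesP; exact: h.
Qed.

(** These sets exhaust an open [A] as [e] decreases to 0, which turns membership of a limit in [A]
    into a condition on its approximations. *)
Definition deep_in (A : set bodies) (e : R) : set bodies :=
  [set y | exists2 e', e < e' & forall z, vclose e' y z -> A z].

Lemma open_uniform (Q : bodies -> R -> Prop) (e : R) : 0 <= e ->
  (forall y z r s, Q y r -> vclose s y z -> Q z (r - s)) ->
  (forall y r s, s <= r -> Q y r -> Q y s) ->
  open ([set y | exists2 e', e < e' & Q y e'] : set bodies).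
Proof.
move=> e0 hQ mQ; apply/open_bodiesP => y [e' ee' Qy].
exists ((e' - e) / 2); first by rewrite divr_gt0// subr_gt0.
by move=> z yz; exists (e' - (e' - e) / 2); [lra|exact: hQ yz].
Qed.

Lemma deep_in_nbhs (A : set bodies) e y z : deep_in A e y -> vclose e y z -> A z.
Proof. by move=> [e' ee' h] yz; apply: h; apply: vclose_le yz; exact: ltW. Qed.

Lemma open_deep_in A y : open A -> A y -> exists e, 0 < e /\ deep_in A e y.
Proof.
move=> /open_bodiesP oA /oA[e e0 h]; exists (e / 2); split; first by rewrite divr_gt0.
by exists e => //; rewrite ltr_pdivrMr//; lra.
Qed.

(** [Y o] is in an open [A] exactly when, for some [n], the approximations are eventually in
    [deep_in A] at scale [1 / (n + 1)]. Asking for measurable preimages of all sets costs nothing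
    for approximations with countably many values. *)
Lemma measurable_bodies_limit dO (Omega : measurableType dO)
    (Yk : nat -> Omega -> bodies) (Y : Omega -> bodies) :
  (forall k (A : set bodies), measurable (Yk k @^-1` A)) ->
  (forall o e, 0 < e -> exists N, forall k, (N <= k)%N -> vclose e (Y o) (Yk k o)) ->
  measurable_fun setT (Y : Omega -> borel bodies).
Proof.
move=> mY hY; apply: (@measurability _ _ Omega (borel bodies) setT Y (@open bodies)) => //.
move=> _ [A oA <-]; rewrite setTI.
pose i (n : nat) : R := n.+1%:R^-1.
have i0 n : 0 < i n by rewrite invr_gt0.
rewrite (_ : Y @^-1` A = \bigcup_n \bigcup_N \bigcap_(k in [set k | (N <= k)%N])
    (Yk k @^-1` deep_in A (i n))).
  apply: bigcupT_measurable => n; apply: bigcupT_measurable => N.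
  by apply: bigcap_measurable => //; exists N => /=.
apply/seteqP; split=> o.
  move=> /(open_deep_in oA)[e [e0 [e' ee' h]]].
  have [n in_e] : exists n, i n < e / 2.
    exists (Num.truncn (e / 2)^-1); rewrite /i invf_plt ?posrE ?divr_gt0//.
    exact: truncnS_gt.
  have e20 : 0 < e / 2 by rewrite divr_gt0.
  have [N hN] := hY o _ e20.
  exists n => //; exists N => // k /= Nk; exists (e / 2) => // z hz; apply: h.
  apply: (@vclose_le (e / 2 + e / 2)); first by lra.
  exact: vclose_trans (hN k Nk) hz.
move=> [n _ [N _ h]]; have [N' hN'] := hY o _ (i0 n).
have := h (maxn N N') (leq_maxl _ _) => /deep_in_nbhs; apply; apply: vclose_sym.
exact: hN' (leq_maxr _ _).
Qed.

Lemma measurable_countable_valued dO (Omega : measurableType dO) (C : countType)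
    (f : Omega -> C) (U : Type) (F : C -> U) (A : set U) :
  (forall c, measurable (f @^-1` [set c])) -> measurable ((F \o f) @^-1` A).
Proof.
move=> mf; rewrite (_ : _ @^-1` A = \bigcup_c
    (if `[< A (F c) >] then f @^-1` [set c] else set0)).
  apply: countable_bigcupT_measurable => // c; case: ifP => // _; exact: mf.
apply/seteqP; split=> o.
  by move=> Ao; exists (f o) => //; rewrite asboolT.
by move=> [c _]; case: asboolP => // Ac fc; rewrite /= fc.
Qed.

Definition disc (k : nat) (x : V) : 'rV[int]_d :=
  \row_j Num.floor (x ord0 j * k.+1%:R).

Definition undisc (k : nat) (c : 'rV[int]_d) : V :=
  \row_j ((c ord0 j)%:~R / k.+1%:R).

Lemma undiscK k x : enorm (x - undisc k (disc k x)) <= Num.sqrt d%:R / k.+1%:R.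
Proof.
rewrite (le_trans (enorm_le_norm _))// ler_wpM2l ?sqrtr_ge0//.
rewrite [leLHS]/Num.norm/= mx_normrE; apply/bigmax_leP; split=> [|[r j] _ /=].
  by rewrite invr_ge0.
rewrite ord1 !mxE; have /andP[h1 h2] := floor_itv (x ord0 j * k.+1%:R).
have k0 : 0 < k.+1%:R :> R by rewrite ltr0n.
have -> : x ord0 j - (Num.floor (x ord0 j * k.+1%:R))%:~R / k.+1%:R =
    (x ord0 j * k.+1%:R - (Num.floor (x ord0 j * k.+1%:R))%:~R) / k.+1%:R.
  by field; rewrite addrC natr1 gt_eqF.
rewrite normrM ger0_norm ?subr_ge0// gtr0_norm ?invr_gt0// ler_pdivrMr//.
rewrite mulVf ?gt_eqF//; move: h2; rewrite intrD; lra.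
Qed.

Lemma measurable_disc dO (Omega : measurableType dO) (X : Omega -> borel V) k c :
  measurable_fun setT X -> measurable [set o | disc k (X o) = c].
Proof.
move=> mX; rewrite (_ : [set o | _] = \bigcap_(j in [set: 'I_d])
    [set o | Num.floor ((X o : V) ord0 j * k.+1%:R) = c ord0 j]).
  apply: fin_bigcap_measurable => // j _.
  have mXj : measurable_fun setT ((fun o => (X o : V) ord0 j * k.+1%:R) :
      Omega -> measurableTypeR R).
    apply: measurable_funM; last exact: measurable_cst.
    exact: (measurableT_comp (measurable_coord (R:=R) j) mX).
  have := mXj measurableT `[(c ord0 j)%:~R, (c ord0 j + 1)%:~R[%classic (measurable_itv _).
  rewrite setTI; congr measurable; apply/seteqP; split=> o /=; rewrite in_itv/=.
    exact: floor_def.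
  by move=> <-; exact: floor_itv.
apply/seteqP; split=> o /=; first by move=> <- j _ /=; rewrite mxE.
by move=> h; apply/rowP => j; rewrite mxE; exact: h.
Qed.

(** Rounding finitely many points to a grid leaves countably many configurations, whatever the maps
    [g k] are; [None] stands for the outcomes outside [Om]. *)
Lemma measurable_discrete_limit dO (Omega : measurableType dO)
    (X : nat -> Omega -> borel V) (Nk : nat -> nat) (g : nat -> (nat -> V) -> bodies)
    (Y : Omega -> bodies) (Om : set Omega) :
  (forall i, measurable_fun setT (X i)) -> measurable Om ->
  (forall o e, Om o -> 0 < e -> exists N, forall k x', (N <= k)%N ->
    (forall i, (i < Nk k)%N -> enorm ((X i o : V) - x' i) <= Num.sqrt d%:R / k.+1%:R) ->
    vclose e (Y o) (g k x')) ->
  measurable_fun setT ((fun o => if `[< Om o >] then Y o else point) : Omega -> borel bodies).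
Proof.
move=> mX mOm hY.
pose f k (o : Omega) : option {ffun 'I_(Nk k) -> 'rV[int]_d} :=
  if `[< Om o >] then Some [ffun i : 'I_(Nk k) => disc k (X i o)] else None.
pose F k (c : option {ffun 'I_(Nk k) -> 'rV[int]_d}) : bodies :=
  if c is Some h then g k (fun i => if insub i is Some j then undisc k (h j) else 0)
  else point.
apply: (@measurable_bodies_limit _ _ (fun k => F k \o f k)).
  move=> k A; apply: measurable_countable_valued => c.
  have E : f k @^-1` [set c] = if c is Some h then
      Om `&` \bigcap_(i in [set: 'I_(Nk k)]) [set o | disc k (X i o) = h i] else ~` Om.
    apply/seteqP; split=> o; rewrite /f /=; case: c => [h|]; case: asboolP => //= Oo.
    - by move=> [<-]; split=> // i _ /=; rewrite ffunE.
    - by move=> [_ hh]; congr Some; apply/ffunP => i; rewrite ffunE; exact: hh.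
    - by move=> [].
  rewrite E; case: c {E} => [h|]; last exact: measurableC.
  apply: measurableI => //; apply: fin_bigcap_measurable => // i _.
  exact: measurable_disc.
move=> o e e0; case: (asboolP (Om o)) => Oo; last first.
  exists 0%N => k _; rewrite /F /f /= asboolF//; exact: vclose_refl.
have [N hN] := hY o e Oo e0; exists N => k Nk'; rewrite /F /f /= asboolT//.
apply: hN => // i ik; rewrite insubT//= ffunE /=; exact: undiscK.
Qed.

End body_vectors.

(** * Uniform samples *)

Section uniform_points.
Context {R : realType} {d : nat}.
Local Notation V := 'rV[R]_d.
Variable K : body0 R d.
Hypothesis d_gt0 : (0 < d)%N.
Hypothesis K_regular : regular K.
Local Notation g := (gauge K).
Local Notation v := (ggrad K).
Local Notation bV := (borel V).

Definition scell (n : nat) (a b : R) (w : set bV) : set bV :=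
  [set x | x != 0 /\ tcell a b w (tag K n x)].

Definition proper_point : set V := [set x | x != 0 /\ g x < 1].

(** Solve the bounds on the time for [g x]: at scale [1 / n] the cell is a shell inside [K]. Later
    times mean smaller gauge, so the bounds change places. *)
Lemma scell_shell n a b w : (0 < n)%N ->
  scell n a b w = shell K (dircone K w) (fun x => - b * enorm (v x))
    (fun x => - a * enorm (v x)) n%:R^-1.
Proof.
move=> n0; have n0' : 0 < n%:R :> R by rewrite ltr0n.
have H (x : V) c : x != 0 -> (c <= n%:R * (1 - g x) / enorm (v x)) =
    (g x <= 1 + n%:R^-1 * (- c * enorm (v x))).
  move=> x0; have v0 : 0 < enorm (v x).
    by have [m [M [[m0 _] _ _ _ /(_ x x0)]]] := gauge_bounds K; exact: lt_le_trans.
  rewrite ler_pdivlMr// -ler_pdivrMl// mulNr mulrN; apply/idP/idP; lra.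
apply/seteqP; split=> x /=.
  by move=> [x0 [/= h1 h2 h3]]; split; rewrite -?H// ltNge -H// -ltNge.
by move=> [[x0 wx] h1 h2]; split=> //; split=> //=; rewrite ?H// ltNge H// -ltNge.
Qed.

Lemma scell_sub n a b w : (0 < n)%N -> 0 <= a -> body_set K `&` scell n a b w = scell n a b w.
Proof.
move=> n0 a0; apply/seteqP; split=> [x []//|x sx]; split=> //.
move: sx; rewrite scell_shell// => -[_ _ h]; apply/gauge_le1/(le_trans h).
by rewrite gerDl mulr_ge0_le0// mulr_le0_ge0 ?enorm_ge0 ?oppr_le0.
Qed.

Section limits.
Hypothesis K_fin : (volume K < +oo)%E.

Lemma scaled_phi (a : R) : exists2 T : R, 0 <= T & forall (b : R) (x : V), `|b| <= `|a| -> `|- b * enorm (v x)| <= T.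
Proof.
have [M M0 pM] := phi_bound K; exists (`|a| * M); first by rewrite mulr_ge0// ltW.
by move=> b x ba; rewrite normrM normrN ler_pM.
Qed.

Lemma measurable_scaled_phi (a : R) :
  measurable_fun setT ((fun x => - a * enorm (v x)) : bV -> measurableTypeR R).
Proof. by apply: measurable_funM => //; exact: measurable_enorm_ggrad. Qed.

Lemma homog0_scaled_phi (a : R) : homog0 (fun x => - a * enorm (v x)).
Proof. by move=> c x c0 x0; rewrite (homog0_phi K_regular c0 x0). Qed.

Lemma measurable_scell_ex b : 0 <= b -> exists N, forall n a w, (N < n)%N ->
  0 <= a -> a <= b -> measurable w -> measurable (scell n a b w).
Proof.
move=> b0; have [T T0 bT] := scaled_phi b.
exists (Num.truncn T) => n a w Nn a0 ab mw; rewrite scell_shell; last exact: leq_ltn_trans Nn.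
have n0 : 0 < n%:R :> R by rewrite ltr0n; exact: leq_ltn_trans Nn.
apply: (@measurable_shell _ _ K _ _ T) => //.
- exact: measurable_scaled_phi.
- exact: measurable_scaled_phi.
- by move=> x; apply: bT; rewrite lexx.
- exact: measurable_dircone.
- rewrite ler_pdivrMl// mulr1; apply: ltW; apply: lt_le_trans (truncnS_gt T) _.
  by rewrite ler_nat.
Qed.

(** This is [shell_limit] at [s = 1 / n]: the difference of the two profiles is
    [(b - a) * enorm (v x)], whose integral gives the area measure. *)
Lemma scell_limit a b w : 0 <= a -> a <= b -> measurable w ->
  n%:R * mvol (scell n a b w) @[n --> \oo] --> (b - a) * sarea K w.
Proof.
move=> a0 ab mw; have b0 : 0 <= b by exact: le_trans ab.
have [T T0 bT] := scaled_phi b.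
have [C C0 HC] := shell_limit d_gt0 K_fin T0.
have [M M0 pM] := phi_bound K.
have SE : d%:R * (cint K (dircone K w) (fun x => - a * enorm (v x)) -
    cint K (dircone K w) (fun x => - b * enorm (v x))) = (b - a) * sarea K w.
  have mph : measurable_fun setT ((fun x => enorm (v x)) : bV -> measurableTypeR R).
    exact: measurable_enorm_ggrad.
  rewrite !(@cintZ _ _ K K_fin _ (fun x => enorm (v x)) M)//; try exact: measurable_dircone.
  by rewrite /sarea; ring.
have inv0 : (C * n%:R^-1 : R) @[n --> \oo] --> (0 : R).
  rewrite -[X in _ --> X](mulr0 C); apply: cvgM; first exact: cvg_cst.
  by apply/gtr0_cvgV0; [near=> n; rewrite ltr0n; near: n; exact: nbhs_infty_gt|exact: cvgr_idn].
apply/cvgrPdist_le => e e0; move/cvgrPdist_le : inv0 => /(_ e e0) inv0.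
near=> n; have n0 : (0 < n)%N by near: n; exact: nbhs_infty_gt.
have n0' : 0 < n%:R :> R by rewrite ltr0n.
have nT : T <= n%:R by near: n; exact: nbhs_infty_ger.
rewrite scell_shell//; have := HC (dircone K w) (fun x => - b * enorm (v x))
  (fun x => - a * enorm (v x)) n%:R^-1 (measurable_scaled_phi b)
  (measurable_scaled_phi a) (homog0_scaled_phi b) (homog0_scaled_phi a).
have abn : `|a| <= `|b| by rewrite !ger0_norm.
move=> /(_ (fun x => bT b x (lexx _)) (fun x => bT a x abn)).
have vle (x : V) : x != 0 -> - b * enorm (v x) <= - a * enorm (v x).
  by move=> _; rewrite ler_wpM2r ?enorm_ge0// lerN2.
move=> /(_ vle (cone_dircone K_regular w) (measurable_dircone K_regular mw)).
rewrite invr_gt0 n0' ler_pdivrMl// mulr1 nT invf_le1// ler1n n0 invrK SE.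
move=> /(_ isT isT isT); rewrite distrC => /le_trans; apply.
have : `|0 - C * n%:R^-1| <= e by near: n.
by rewrite sub0r normrN; apply: le_trans; exact: ler_norm.
Unshelve. all: by end_near.
Qed.

(** The improper points of [K] are the origin and those of gauge 1. Doubling fixes the origin and
    multiplies volumes by [2 ^+ d], so its volume is 0; the points of gauge 1 lie in shells whose
    volume is at most of the order of their width. *)
Lemma volume_improper : volume (body_set K `\` proper_point) = 0%E.
Proof.
have K0 : volume [set 0 : V] = 0%E.
  rewrite -volE; set S : set bV := [set 0].
  have mS : measurable S by apply: borel_closed; apply: compact_closed;
    [exact: norm_hausdorff|exact: compact_set1].
  have Sfin : (vol d S < +oo)%E.
    by rewrite (le_lt_trans _ K_fin)// volE volumeS// => _ ->; exact: body_in0.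
  have ES : vol d S = (mvol S)%:E.
    by rewrite fineK// ge0_fin_numE.
  have := @vol_scale _ d 2 S (ltr0n _ 2) mS.
  rewrite (_ : _ @^-1` S = S); last first.
    apply/seteqP; split=> x /=; last by move=> ->; rewrite scaler0.
    by move=> /eqP; rewrite scaler_eq0 invr_eq0 pnatr_eq0/= => /eqP.
  rewrite ES -EFinM => -[] /eqP; rewrite -[X in X == _]mul1r -subr_eq0 -mulrBl mulf_eq0.
  rewrite subr_eq0 eq_sym (gt_eqF (_ : 1 < 2 ^+ d)) /=; first by move=> /eqP ->.
  by rewrite exprn_egt1// ?ltr1n// -lt0n.
have m1 (c : R) : measurable_fun setT ((fun=> c) : bV -> measurableTypeR R).
  exact: measurable_cst.
have K1 : vol d [set x : V | g x = 1] = 0%E.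
  set S : set bV := [set x | _].
  have sS s : 0 <= s -> 0 < s -> S `<=` shell K setT (fun=> -1) (fun=> 0) s.
    by move=> s0 s1 x gx; split=> //; rewrite gx ?mulr0 ?addr0// mulrN1; lra.
  have Sfin : (vol d S < +oo)%E.
    by rewrite (le_lt_trans _ K_fin)// volE volumeS// => x gx; apply/gauge_le1; rewrite gx.
  suff : mvol S <= 0.
    move=> S0; have : mvol S = 0 by apply/eqP; rewrite eq_le S0 mvol_ge0.
    by rewrite /mvol => h; rewrite -[LHS]fineK ?h// ge0_fin_numE.
  have hs s : 0 < s -> s <= 1 -> mvol S <= s * (d%:R * cvol K setT).
    move=> s0 s1; apply: (@le_trans _ _ (mvol (shell K setT (fun=> -1) (fun=> 0) s))).
      apply: mvolS; first by apply: sS => //; exact: ltW.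
      rewrite (le_lt_trans _ K_fin)// volE volumeS// => x [_ _ h]; apply/gauge_le1.
      by rewrite (le_trans h)// mulr0 addr0.
    rewrite (@mvol_shell _ _ K d_gt0 K_fin _ _ 1 (m1 _) (m1 _) (fun _ _ _ _ => erefl) (fun _ _ _ _ => erefl))//.
    - rewrite !cint_cst// mulr0 addr0 expr1n mulrN1 -mulrBl mulrA ler_wpM2r ?cvol_ge0//.
      have := @subX_le _ d (1 - s) 1 1; rewrite !expr1n mulr1 subr_ge0 s1 gerBl (ltW s0).
      by move=> /(_ isT isT (lexx _)); rewrite subKr mulrC.
    - by move=> x; rewrite normrN normr1.
    - by move=> x; rewrite normr0.
    - exact: ltW.
    - by rewrite mulr1.
  apply/ler_addgt0Pr => e e0; rewrite add0r.
  set c := d%:R * cvol K setT in hs; have c0 : 0 <= c by rewrite mulr_ge0// cvol_ge0.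
  have c1 : 0 < c + 1 by rewrite ltr_wpDl.
  pose s := Num.min 1 (e / (c + 1)).
  have s0 : 0 < s by rewrite lt_min ltr01 divr_gt0.
  apply: le_trans (hs s s0 _) _; first by rewrite ge_min lexx.
  apply: (@le_trans _ _ (e / (c + 1) * c)); first by rewrite ler_wpM2r// ge_min lexx orbT.
  by rewrite mulrAC ler_pdivrMr// ler_pM2l//; lra.
apply/eqP; rewrite eq_le volume_ge0 andbT.
apply: (@le_trans _ _ (volume ([set x | g x = 1] `|` [set 0]))).
  apply: volumeS => x [/gauge_le1 gx np]; have [->|x0] := eqVneq x 0; [by right|left].
  by apply/eqP; rewrite eq_le gx /= leNgt; apply/negP => g1; apply: np.
rewrite -volE (le_trans (measureU2 _ _ _))//=.
- exact: (preimage_measurable (measurable_gauge K) (measurable_set1 (1 : R))).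
- by apply: borel_closed; apply: compact_closed; [exact: norm_hausdorff|exact: compact_set1].
- by rewrite -volE in K0; rewrite K0 K1 adde0.
Qed.

End limits.

End uniform_points.

Section uniform_samples.
Context {R : realType} {d : nat}.
Local Notation V := 'rV[R]_d.
Variable K : body0 R d.
Hypothesis d_gt0 : (0 < d)%N.
Hypothesis K_regular : regular K.
Local Notation g := (gauge K).
Local Notation v := (ggrad K).
Local Notation bV := (borel V).
Context {dO : measure_display} {Omega : measurableType dO}.
Variable P : probability Omega R.
Variable xi : nat -> Omega -> bV.
Hypothesis xi_meas : forall i, measurable_fun setT (xi i).
Hypothesis xi_indep : mutually_independent P xi.
Hypothesis xi_unif : forall i, uniformly_distributed P K (xi i).

(** Were the volume 0 or infinite, its [fine] would be 0 and so would the inverse, hence the uniform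
    law would give the whole space probability 0. *)
Lemma volume_fin_gt0 : (volume K < +oo)%E /\ 0 < fine (volume K).
Proof.
have := xi_unif 0 (measurableT : measurable (setT : set bV)).
rewrite preimage_setT probability_setT setIT => E.
have V0 := volume_ge0 (body_set K); split.
  rewrite lt_neqAle leey andbT; apply/eqP => Koo; move: E; rewrite Koo /= invr0 mule0.
  by move=> /eqP; rewrite onee_eq0.
rewrite lt_neqAle fine_ge0// andbT; apply/eqP => K0; move: E; rewrite -K0 invr0 mule0.
by move=> /eqP; rewrite onee_eq0.
Qed.

Let K_fin : (volume K < +oo)%E := volume_fin_gt0.1.

Lemma pr_uniform i (B : set bV) : measurable B ->
  pr P (xi i @^-1` B) = (fine (volume K))^-1 * mvol (body_set K `&` B).
Proof.
move=> mB; rewrite /pr xi_unif// fineM//; last first.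
  rewrite ge0_fin_numE ?volume_ge0//; apply: le_lt_trans K_fin.
  by apply: volumeS => x [].
by rewrite /= mulrC /mvol volE.
Qed.

Lemma measurable_proper_point : measurable (proper_point K : set bV).
Proof.
apply: measurableI; first exact: measurable_neq0.
have := preimage_measurable (measurable_gauge K) (@measurable_itv R `]-oo, 1[).
by congr measurable; apply/seteqP; split=> x /=; rewrite in_itv.
Qed.

Definition all_proper : set Omega := \bigcap_i (xi i @^-1` proper_point K).

Lemma measurable_all_proper : measurable all_proper.
Proof.
apply: bigcapT_measurable => i.
exact: (preimage_measurable (xi_meas i) measurable_proper_point).
Qed.

Lemma all_proper_negligible : P (~` all_proper) = 0%E.
Proof.
rewrite setC_bigcap; apply/eqP; rewrite -measure_le0.
apply: (le_trans (measure_sigma_subadditive _ _ _ _)).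
- by move=> i; apply: measurableC; exact: (preimage_measurable (xi_meas i) measurable_proper_point).
- rewrite -setC_bigcap; apply: measurableC; exact: measurable_all_proper.
- by [].
rewrite eseries0// => i _ _ /=.
have := xi_unif i (measurableC measurable_proper_point); rewrite preimage_setC => ->.
by rewrite volume_improper ?mul0e.
Qed.

Variables (q : nat) (a b : 'I_q -> R) (w : 'I_q -> set bV).
Hypotheses (a_ge0 : forall j, 0 <= a j) (ab : forall j, a j <= b j)
  (mw : forall j, measurable (w j))
  (tw : trivIset setT (fun j => tcell (a j) (b j) (w j))).

Definition scells n j := scell K n (a j) (b j) (w j).

Lemma trivIset_scells n : trivIset setT (scells n).
Proof.
move=> i j _ _ [x [[_ hi] [_ hj]]]; apply: tw => //; by exists (tag K n x).
Qed.

Lemma count_limit : exists N, (forall n j, (N <= n)%N -> measurable (scells n j)) /\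
  forall c, pr P (count_event xi (scells n) n c) @[n --> \oo] -->
    \prod_j poisson_pr ((fine (volume K))^-1 * ((b j - a j) * sarea K (w j))) (c j).
Proof.
have [N mS] : exists N, forall n j, (N <= n)%N -> measurable (scells n j).
  have h j := @measurable_scell_ex _ _ K K_regular (b j) (le_trans (a_ge0 j) (ab j)).
  have {}h j := cid (h j).
  exists (\max_j (sval (h j)).+1)%N => n j Nn; apply: (svalP (h j)) => //.
  by apply: leq_trans Nn; exact: (leq_bigmax j).
exists N.+1; split=> [n j Nn|c]; first by apply: mS; exact: ltnW.
pose p n j := (fine (volume K))^-1 * mvol (scells n j).
apply: (@cvg_eventually _ _ (fun n => multinom (1 - \sum_j p n j) (p n) n c) _ N.+1).
  move=> n Nn; apply: pr_count_event => //.
  - by move=> j; apply: mS; exact: ltnW.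
  - exact: trivIset_scells.
  - move=> i j; rewrite pr_uniform; last by apply: mS; exact: ltnW.
    by rewrite scell_sub//; exact: leq_trans Nn.
apply: cvg_multinom => [n j|j].
  by rewrite mulr_ge0 ?mvol_ge0// invr_ge0 ltW//; exact: volume_fin_gt0.2.
rewrite /p; under eq_fun do rewrite mulrCA.
by apply: cvgM; [exact: cvg_cst|exact: scell_limit].
Qed.

End uniform_samples.

(** * Poisson points *)

Section increasing_events.
Context {R : realType} {dO : measure_display} {Omega : measurableType dO}.
Variable P : probability Omega R.

Lemma pr_bigcup_large (U : nat -> set Omega) (e : R) : (forall n, measurable (U n)) ->
  (forall n k, (n <= k)%N -> U n `<=` U k) -> P (\bigcup_n U n) = 1%E -> 0 < e ->
  exists n, 1 - e <= pr P (U n).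
Proof.
move=> mU ndU PU e0; have mUU : measurable (\bigcup_n U n) by exact: bigcupT_measurable.
have nd : nondecreasing_seq U by move=> n k nk; apply/subsetPset; exact: ndU.
have cv : (P \o U) @ \oo --> P (\bigcup_n U n) by exact: nondecreasing_cvg_mu.
move: cv; rewrite PU => /fine_cvgP[].
move=> _ /cvgrPdist_le/(_ e e0)[N _ /(_ N (leqnn N))] /=.
rewrite -/(pr P (U N)) => h; exists N; move: h; rewrite ler_norml => /andP[_]; lra.
Qed.

Lemma pr0_negligible (A : set Omega) : measurable A -> pr P A = 0 -> P A = 0%E.
Proof. by move=> mA A0; rewrite prE// A0. Qed.

Lemma P_bigcup0 (A : nat -> set Omega) : (forall i, measurable (A i)) ->
  (forall i, P (A i) = 0%E) -> P (\bigcup_i A i) = 0%E.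
Proof.
move=> mA A0; apply/eqP; rewrite -measure_le0.
have h := @measure_sigma_subadditive _ _ _ P (\bigcup_i A i) A mA
  (bigcupT_measurable A mA) (fun _ => id).
apply: (le_trans h); rewrite eseries0// => i _ _; exact: A0.
Qed.

Lemma P_setC0 (A : set Omega) : measurable A -> P A = 1%E -> P (~` A) = 0%E.
Proof. by move=> mA PA; rewrite probability_setC// PA -EFinB subrr. Qed.

Lemma P_setC1 (A : set Omega) : measurable A -> P (~` A) = 0%E -> P A = 1%E.
Proof. by move=> mA PA; rewrite -[A]setCK probability_setC ?PA ?sube0//; exact: measurableC. Qed.

Lemma P_setI1 (A B : set Omega) : measurable A -> measurable B ->
  P A = 1%E -> P B = 1%E -> P (A `&` B) = 1%E.
Proof.
move=> mA mB PA PB; apply: P_setC1; first exact: measurableI.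
have h : (P (~` A `|` ~` B) <= P (~` A) + P (~` B))%E.
  by apply: measureU2; exact: measurableC.
apply/eqP; rewrite setCI eq_le measure_ge0 andbT (le_trans h)//.
by rewrite !P_setC0// adde0.
Qed.

Lemma pr_setU_le (A B : set Omega) : measurable A -> measurable B ->
  pr P (A `|` B) <= pr P A + pr P B.
Proof.
move=> mA mB; have -> : A `|` B = A `|` (B `\` A).
  apply/seteqP; split=> o; last by move=> [|[]]; [left|right].
  by have [Ao|nA] := pselect (A o); [left|move=> [//|Bo]; right].
have mD : measurable (B `\` A) by exact: measurableD.
rewrite prU//; last by apply/seteqP; split=> // o [? []].
by rewrite lerD2l prS// => o [].
Qed.

Lemma pr_bigcup_le (I : finType) (A : I -> set Omega) (e : I -> R) :
  (forall i, measurable (A i)) -> (forall i, pr P (A i) <= e i) ->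
  pr P (\bigcup_i A i) <= \sum_i e i.
Proof.
move=> mA Ae; have E : \bigcup_i A i = \bigcup_(i in [set` index_enum I]) A i.
  by apply/seteqP; split=> o [i _ Ao]; exists i => //=; rewrite mem_index_enum.
rewrite E; elim: (index_enum I) => [|i s IH].
  by rewrite big_nil (_ : \bigcup_(i in _) _ = set0) ?pr0//; apply/seteqP; split=> // o [].
rewrite big_cons (_ : \bigcup_(j in _) _ = A i `|` \bigcup_(j in [set` s]) A j); last first.
  apply/seteqP; split=> o.
    move=> [j /=]; rewrite inE => /orP[/eqP ->|js] Ao; [by left|by right; exists j].
  by move=> [Ao|[j js Ao]]; [exists i => //=|exists j => //=]; rewrite inE ?eqxx// js orbT.
have ms : measurable (\bigcup_(j in [set` s]) A j).
  by apply: fin_bigcup_measurable => //; exact: finite_seq.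
by apply: (le_trans (pr_setU_le _ _)) => //; rewrite lerD.
Qed.

Lemma measurable_eq_event (f h : Omega -> R) :
  measurable_fun setT (f : Omega -> measurableTypeR R) ->
  measurable_fun setT (h : Omega -> measurableTypeR R) -> measurable [set o | f o = h o].
Proof.
move=> mf mh; have mB := measurable_funB mf mh.
have := preimage_measurable mB (measurable_set1 (0 : R)); congr measurable.
by apply/seteqP; split=> o /=; [move/eqP; rewrite subr_eq0 => /eqP|move=> ->; rewrite subrr].
Qed.

End increasing_events.

Section poisson_estimates.
Context {R : realType}.

Lemma poisson_pr_le1 (l : R) k : 0 <= l -> poisson_pr l k <= 1.
Proof.
move=> l0; rewrite -lee_fin -poisson_probE//.
exact: (probability_le1 (poisson_prob l 0)).
Qed.

(** From [poisson_pr l k * l = k.+1%:R * poisson_pr l k.+1]; any fixed count becomes unlikely as the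
    mean grows. *)
Lemma poisson_pr_tail (l : R) k : 0 < l -> poisson_pr l k <= k.+1%:R / l.
Proof.
move=> l0; rewrite ler_pdivlMr//.
have -> : poisson_pr l k * l = k.+1%:R * poisson_pr l k.+1.
  rewrite /poisson_pr factS natrM exprS; field.
  by rewrite !pnatr_eq0 -lt0n fact_gt0 addrC natr1 pnatr_eq0.
by rewrite -[leRHS]mulr1 ler_wpM2l// poisson_pr_le1// ltW.
Qed.

(** Since [expR (- l) >= 1 - l], two or more points have a probability of second order. *)
Lemma poisson_pr_small (l : R) : 0 <= l ->
  1 - (poisson_pr l 0 + poisson_pr l 1) <= l ^+ 2.
Proof.
move=> l0; rewrite /poisson_pr expr0 expr1 fact0 !invr1 !mul1r mulr1.
have h := expR_ge1Dx (- l).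
have := ler_wpM2r (_ : 0 <= 1 + l) h; rewrite addr_ge0// => /(_ isT); lra.
Qed.

End poisson_estimates.

Section poisson_counts.
Context {R : realType} {dO : measure_display} {Omega : measurableType dO}.
Variable P : probability Omega R.
Context {dT : measure_display} {T : measurableType dT}.
Variables (L : set T -> \bar R) (x : nat -> Omega -> T).
Hypothesis x_poisson : poisson_process P L x.

Definition total_event (q : nat) (C : 'I_q -> set T) (c : 'I_q -> nat) : set Omega :=
  [set o | forall j, ([set i | C j (x i o)] #= `I_(c j))%card].

(** Events on partial counts are measurable by the case of finitely many indices; eventual constancy
    transfers this to counts over all indices. *)
Lemma card_stable (Q : nat -> Prop) k : ([set i | Q i] #= `I_k)%card <->
  exists N, forall n, (N <= n)%N -> (\sum_(i < n) `[< Q i >] = k)%N.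
Proof.
split=> [Qk|[N h]].
  have fQ : finite_set [set i | Q i].
    by apply/finite_setP; exists k.
  have [N QN] : exists N, forall i, Q i -> (i < N)%N.
    have [M QM] : exists M, forall i, Q i -> (i <= M)%N.
      have [s Es] := (finite_seqP _).1 fQ; exists (\max_(i <- s) i)%N => i Qi.
      have : i \in s by have : [set i | Q i] i := Qi; rewrite Es.
      by move=> si; exact: leq_bigmax_seq.
    by exists M.+1 => i /QM; rewrite ltnS.
  exists N => n Nn; apply: (card_countP n k (fun i => `[< Q i >])).1.
  suff <- : [set i | Q i] = [set i | (i < n)%N /\ `[< Q i >]] by [].
  apply/seteqP; split=> i /=; last by move=> [_ /asboolP].
  by move=> Qi; split; [exact: leq_trans (QN i Qi) Nn|exact/asboolP].
have := (card_countP N k (fun i => `[< Q i >])).2 (h N (leqnn N)).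
suff -> : [set i | Q i] = [set i | (i < N)%N /\ `[< Q i >]] by [].
apply/seteqP; split=> i /=; last by move=> [_ /asboolP].
move=> Qi; split; last exact/asboolP.
rewrite ltnNge; apply/negP => Ni; have := h i.+1 (leqW Ni); have := h i Ni.
by rewrite big_ord_recr/= asboolT// => ->; rewrite addn1 => /eqP; rewrite eqn_leq ltnn.
Qed.

Lemma measurable_total_event q (C : 'I_q -> set T) c :
  (forall j, measurable (C j)) -> trivIset setT C -> measurable (total_event C c).
Proof.
move=> mC tC; have E : total_event C c =
    \bigcap_j \bigcup_N \bigcap_(n in [set n | (N <= n)%N]) [set o | cnt x C n j o = c j].
  apply/seteqP; split=> o h j.
    by move=> _; have [N hN] := (card_stable _ _).1 (h j); exists N => // n; exact: hN.
  by have [N _ hN] := h j Logic.I; apply/card_stable; exists N => n Nn; exact: hN.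
rewrite E; apply: fin_bigcap_measurable => // j _; apply: bigcupT_measurable => N.
apply: bigcap_measurable => [|n _]; first by exists N => /=.
have := @measurable_count_event _ _ _ _ x x_poisson.1 1 (fun=> C j) (fun=> mC j).
move=> /(_ _ n (fun=> c j)); rewrite (_ : count_event _ _ _ _ = [set o | cnt x C n j o = c j]).
  by apply; move=> i i' _ _ _; rewrite [i]ord1 [i']ord1.
by apply/seteqP; split=> o => [/(_ ord0)|h i].
Qed.

Lemma pr_total_event q (C : 'I_q -> set T) c (l : 'I_q -> R) :
  (forall j, measurable (C j)) -> trivIset setT C -> (forall j, 0 <= l j) ->
  (forall j, L (C j) = (l j)%:E) ->
  pr P (total_event C c) = \prod_j poisson_pr (l j) (c j).
Proof.
move=> mC tC l0 LC; have -> : total_event C c =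
    \bigcap_j [set o | ([set i | C j (x i o)] #= `I_(c j))%card].
  by apply/seteqP; split=> o h j; [move=> _; exact: h|exact: (h j Logic.I)].
rewrite /pr x_poisson.2// => [|j]; last by rewrite LC ltry.
rewrite (eq_bigr (fun j => (poisson_pr (l j) (c j))%:E)) => [|j _].
  by rewrite prodEFin.
  by rewrite LC /= poisson_probE.
Qed.

Definition has_count (C : set T) (k : nat) : set Omega :=
  [set o | ([set i | C (x i o)] #= `I_k)%card].

Lemma has_countE C k : has_count C k = total_event (fun _ : 'I_1 => C) (fun=> k).
Proof. by apply/seteqP; split=> o => [h j|/(_ ord0)]. Qed.

Let triv1 (C : set T) : trivIset setT (fun _ : 'I_1 => C).
Proof. by move=> i i' _ _ _; rewrite [i]ord1 [i']ord1. Qed.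

Lemma measurable_has_count C k : measurable C -> measurable (has_count C k).
Proof. by move=> mC; rewrite has_countE; exact: measurable_total_event. Qed.

Lemma pr_has_count C k (l : R) : measurable C -> 0 <= l -> L C = l%:E ->
  pr P (has_count C k) = poisson_pr l k.
Proof.
move=> mC l0 LC; rewrite has_countE (@pr_total_event _ _ _ (fun=> l))//.
by rewrite big_ord1.
Qed.

Lemma has_count_inj C k k' o : has_count C k o -> has_count C k' o -> k = k'.
Proof.
move=> h h'; apply/card_eq_II; apply: card_eq_trans (card_esym h) h'.
Qed.

Lemma has_count_finite C (l : R) : measurable C -> 0 <= l -> L C = l%:E ->
  P (\bigcup_k has_count C k) = 1%E.
Proof.
move=> mC l0 LC; have mE k : measurable (has_count C k) by exact: measurable_has_count.
rewrite measure_semi_bigcup//; last 2 first.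
- by move=> k k' _ _ [t [h h']]; exact: has_count_inj h h'.
- exact: bigcupT_measurable.
have E : (\bigcup_k [set k] : set nat) = setT by apply/seteqP; split=> // k _; exists k.
rewrite -(probability_setT (poisson_prob l 0)) -E measure_semi_bigcup//; last first.
  by move=> k k' _ _ [t [/= tk tk']]; rewrite -tk -tk'.
apply: eq_eseriesr => k _; have := prE P (mE k).
by rewrite (pr_has_count _ mC l0 LC) -poisson_probE.
Qed.

End poisson_counts.

Lemma card_two (T : eqType) (A : set T) (i j : T) : i != j -> A i -> A j ->
  (`I_2 #<= A)%card.
Proof.
move=> ij Ai Aj; apply: (@card_le_inj _ _ _ _ (fun k => if k is 0%N then i else j)).
  move=> [|[|k]] [|[|k']]; rewrite !inE//= => _ _ ji; move: ij.
    by rewrite ji eqxx.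
  by rewrite ji eqxx.
by case.
Qed.

Lemma card_ge_le (T : Type) (A : set T) n k : (`I_n #<= A)%card -> (A #= `I_k)%card ->
  (n <= k)%N.
Proof. by move=> nA Ak; rewrite -card_le_II; rewrite (card_le_eqr Ak) in nA. Qed.

Section poisson_points.
Context {R : realType} {d : nat}.
Local Notation V := 'rV[R]_d.
Variable K : body0 R d.
Hypothesis d_gt0 : (0 < d)%N.
Hypothesis K_regular : regular K.
Hypothesis K_fin : (volume K < +oo)%E.
Hypothesis K_gt0 : 0 < fine (volume K).
Local Notation bV := (borel V).
Context {dO : measure_display} {Omega : measurableType dO}.
Variable P : probability Omega R.
Variable tu : nat -> Omega -> measurableTypeR R * bV.
Hypothesis tu_dom : forall i o, 0 < (tu i o).1 /\ enorm ((tu i o).2 : V) = 1.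
Hypothesis tu_poisson : poisson_process P (intensity K) tu.
Variable m : nat.

Definition rate (a b : R) (w : set bV) : R := (fine (volume K))^-1 * ((b - a) * sarea K w).

Lemma rate_ge0 a b w : a <= b -> measurable w -> 0 <= rate a b w.
Proof.
move=> ab mw; rewrite mulr_ge0 ?invr_ge0 ?(ltW K_gt0)// mulr_ge0 ?subr_ge0//.
exact: sarea_ge0.
Qed.

Let mT : measurable (setT : set bV). Proof. exact: measurableT. Qed.

Let LT a b : 0 <= a -> a <= b -> intensity K (tcell a b (setT : set bV)) = (rate a b setT)%:E.
Proof. by move=> a0 ab; apply: intensity_tcell => //; exact: sandwiched_setT. Qed.

Let mtu i : measurable_fun setT (tu i) := tu_poisson.1 i.

Let mt i : measurable_fun setT (fun o => (tu i o).1 : measurableTypeR R).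
Proof. exact: (measurableT_comp measurable_fst (mtu i)). Qed.

Definition tie (i j : nat) (T : R) : set Omega :=
  [set o | [/\ i != j, (tu i o).1 = (tu j o).1 & (tu i o).1 < T]].

Lemma measurable_tie i j T : measurable (tie i j T).
Proof.
have [->|ij] := eqVneq i j.
  by rewrite (_ : tie _ _ _ = set0)//; apply/seteqP; split=> // o []; rewrite eqxx.
have -> : tie i j T = [set o | (tu i o).1 = (tu j o).1] `&` [set o | (tu i o).1 < T].
  by apply/seteqP; split=> o [].
apply: measurableI; first exact: measurable_eq_event.
have := preimage_measurable (mt i) (@measurable_itv R `]-oo, T[).
by congr measurable; apply/seteqP; split=> o /=; rewrite in_itv.
Qed.

(** Cut the times into [n + 1] equal cells: two points with the same time share a cell, and each
    cell has two points or more with probability at most [(l / n.+1%:R) ^+ 2]. Distinct times will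
    make the endpoints of the segments distinct, as their norms are the inverse times. *)
Lemma tie0 i j T : 0 < T -> P (tie i j T) = 0%E.
Proof.
move=> T0; have mt0 := measurable_tie i j T; apply: pr0_negligible => //.
apply/eqP; rewrite eq_le pr_ge0 andbT; pose l := rate 0 T setT.
have l0 : 0 <= l by rewrite rate_ge0// ltW.
suff hn n : pr P (tie i j T) <= l ^+ 2 / n.+1%:R.
  apply/ler_addgt0Pr => e e0; rewrite add0r.
  apply: le_trans (hn (Num.truncn (l ^+ 2 / e))) _; rewrite ler_pdivrMr ?ltr0n//.
  by rewrite mulrC -ler_pdivrMr//; apply: ltW; exact: truncnS_gt.
have n0 : 0 < n.+1%:R :> R by rewrite ltr0n.
pose h := T / n.+1%:R; have h0 : 0 < h by rewrite divr_gt0.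
pose C (k : 'I_n.+1) := tcell (k%:R * h) (k.+1%:R * h) (setT : set bV).
have mC k : measurable (C k) by exact: measurable_tcell.
have kh (k : nat) : 0 <= k%:R * h by rewrite mulr_ge0// ltW.
have kS (k : nat) : k%:R * h <= k.+1%:R * h by rewrite ler_pM2r// ler_nat.
have LC k : intensity K (C k) = (l / n.+1%:R)%:E.
  by rewrite LT// /l /rate /h -natr1; congr EFin; field; rewrite !gt_eqF// natr1.
pose A k := ~` (has_count tu (C k) 0 `|` has_count tu (C k) 1).
have mH k c : measurable (has_count tu (C k) c).
  exact: (measurable_has_count tu_poisson).
have mA k : measurable (A k) by apply: measurableC; apply: measurableU.
have ln0 : 0 <= l / n.+1%:R by rewrite divr_ge0.
have prA k : pr P (A k) <= (l / n.+1%:R) ^+ 2.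
  rewrite prC; last exact: measurableU.
  rewrite prU//; last first.
    by apply/seteqP; split=> // o [h1 h2]; have := has_count_inj h1 h2.
  by rewrite !(pr_has_count tu_poisson _ (mC k) ln0 (LC k)) poisson_pr_small.
have sub : tie i j T `<=` \bigcup_k A k.
  move=> o [ij tt tT].
  have [k hk] : exists k : 'I_n.+1, C k (tu i o) /\ C k (tu j o).
    have [t0 _] := tu_dom i o.
    have nh : n.+1%:R * h = T by rewrite /h mulrC divfK// gt_eqF.
    have kn : (Num.truncn ((tu i o).1 / h) < n.+1)%N.
      rewrite -(ltr_nat R); apply: (@le_lt_trans _ _ ((tu i o).1 / h)).
        by rewrite truncn_le divr_ge0// ltW.
      by rewrite ltr_pdivrMr// nh.
    exists (Ordinal kn); suff Ci : C (Ordinal kn) (tu i o) by split=> //; move: Ci; rewrite /C /tcell/= tt.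
    split=> //=; first by rewrite -ler_pdivlMr// truncn_le divr_ge0// ltW.
    by rewrite -ltr_pdivrMr//; exact: truncnS_gt.
  have h2 : (`I_2 #<= [set l | C k (tu l o)])%card by exact: card_two ij hk.1 hk.2.
  by exists k => //= -[|] /(card_ge_le h2).
have mU : measurable (\bigcup_k A k) by exact: fin_bigcup_measurable.
apply: (le_trans (prS P mt0 mU sub)); apply: (le_trans (pr_bigcup_le mA prA)); rewrite sumr_const card_ord -mulr_natr.
by rewrite le_eqVlt; apply/orP; left; apply/eqP; field; rewrite addrC natr1 gt_eqF.
Qed.

Section deep_configurations.
Variables (q : nat) (w : 'I_q -> set bV).
Hypothesis mw : forall i, measurable (w i) /\ sandwiched K (w i).

(** Only cells of positive area are sure to receive points, and by [positive_direction_cell] these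
    suffice to look in every direction. *)
Definition deep_event (T : R) : set Omega := [set o | forall i, 0 < sarea K (w i) ->
  (`I_m.+1 #<= [set l | tcell 0 T (w i) (tu l o)])%card].

Lemma deep_eventE T : deep_event T = ~` \bigcup_(p : 'I_q * 'I_m.+1)
  (if 0 < sarea K (w p.1) then has_count tu (tcell 0 T (w p.1)) p.2 else set0).
Proof.
apply/seteqP; split=> o.
  move=> h [[i c] _] /=; case: ifP => // wi /(card_ge_le (h i wi)).
  by rewrite leqNgt ltn_ord.
move=> h i wi; have [//|[n nm hn]] := card_gtVle m [set l | tcell 0 T (w i) (tu l o)].
exfalso; apply: h; rewrite -ltnS in nm; exists (i, Ordinal nm) => //=.
by rewrite wi.
Qed.

Lemma deep_eventS T T' : T <= T' -> deep_event T `<=` deep_event T'.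
Proof.
move=> TT o h i wi; apply: card_le_trans (h i wi) _; apply: subset_card_le => l.
by move=> [h1 h2 h3]; split=> //; exact: lt_le_trans TT.
Qed.

Let mA T (p : 'I_q * 'I_m.+1) : measurable
  (if 0 < sarea K (w p.1) then has_count tu (tcell 0 T (w p.1)) p.2 else set0).
Proof.
case: ifP => // _; apply: (measurable_has_count tu_poisson).
exact: measurable_tcell (mw _).1.
Qed.

Lemma measurable_deep_event T : measurable (deep_event T).
Proof.
rewrite deep_eventE; apply: measurableC.
by apply: fin_bigcup_measurable => // p _; exact: mA.
Qed.

(** The rate of a cell grows linearly with [T], so each of the finitely many low counts has a
    probability of order at most [1 / T]. *)
Lemma deep_event_large : P (\bigcup_(T : nat) deep_event T%:R) = 1%E.
Proof.
have mD := measurable_deep_event.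
have mDD : measurable (\bigcup_(T : nat) deep_event T%:R).
  by apply: bigcupT_measurable => T; exact: mD.
pose C := \sum_(p : 'I_q * 'I_m.+1) if 0 < sarea K (w p.1) then
  p.2.+1%:R / rate 0 1 (w p.1) else 0.
have hT (T : nat) : (0 < T)%N -> 1 - C / T%:R <= pr P (deep_event T%:R).
  move=> T0; have T0' : 0 < T%:R :> R by rewrite ltr0n.
  rewrite deep_eventE prC; last by apply: fin_bigcup_measurable => // p _; exact: mA.
  rewrite lerD2l lerN2 /C mulr_suml; apply: pr_bigcup_le => p; first exact: mA.
  case: ifP => [wp|_]; last by rewrite pr0 mul0r.
  have [mwp swp] := mw p.1.
  rewrite (pr_has_count tu_poisson _ _ _ (intensity_tcell d_gt0 K_fin K_regular _ _ mwp swp))//;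
    try exact: ltW.
  - have E : rate 0 T%:R (w p.1) = rate 0 1 (w p.1) * T%:R by rewrite /rate; ring.
    rewrite -/(rate 0 T%:R (w p.1)) E; apply: (le_trans (poisson_pr_tail _ _)).
      by rewrite mulr_gt0// /rate subr0 mul1r mulr_gt0// invr_gt0.
    by rewrite invfM mulrA.
  - exact: measurable_tcell.
  - by apply: rate_ge0 => //; exact: ltW.
have h1 : 1 <= pr P (\bigcup_(T : nat) deep_event T%:R).
  apply/ler_addgt0Pr => e e0; pose T := (Num.truncn (`|C| / e)).+1.
  have T0 : 0 < T%:R :> R by rewrite ltr0n.
  have : pr P (deep_event T%:R) <= pr P (\bigcup_(T : nat) deep_event T%:R).
    by apply: prS => // o; exists T.
  have := hT T isT; have : C / T%:R <= e.
    rewrite ler_pdivrMr// mulrC -ler_pdivrMr//.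
    apply: (@le_trans _ _ (`|C| / e)); first by rewrite ler_wpM2r ?ler_norm// invr_ge0 ltW.
    by apply: ltW; exact: truncnS_gt.
  lra.
rewrite prE//; congr EFin; apply/eqP; rewrite eq_le h1 andbT; exact: pr_le1.
Qed.

(** Finitely many points before each time bound the segments and allow truncation; distinct times
    allow indexing by the points themselves; enough early points in all directions give depth. *)
Definition good_points : set Omega :=
  (\bigcap_(T : nat) \bigcup_k has_count tu (tcell 0 T%:R setT) k) `&`
  (~` \bigcup_i \bigcup_j \bigcup_(T : nat) tie i j T.+1%:R) `&`
  \bigcup_(T : nat) deep_event T%:R.

Lemma measurable_good_points : measurable good_points.
Proof.
apply: measurableI; last by apply: bigcupT_measurable => T; exact: measurable_deep_event.
apply: measurableI.
  apply: bigcapT_measurable => T; apply: bigcupT_measurable => k.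
  by apply: (measurable_has_count tu_poisson); exact: measurable_tcell.
apply: measurableC; apply: bigcupT_measurable => i; apply: bigcupT_measurable => j.
by apply: bigcupT_measurable => T; exact: measurable_tie.
Qed.

Lemma P_good_points : P good_points = 1%E.
Proof.
have mT0 T : measurable (tcell 0 T (setT : set bV)) by exact: measurable_tcell.
have mF T : measurable (\bigcup_k has_count tu (tcell 0 T setT) k).
  by apply: bigcupT_measurable => k; exact: (measurable_has_count tu_poisson).
have m1 : measurable (\bigcap_(T : nat) \bigcup_k has_count tu (tcell 0 T%:R setT) k).
  by apply: bigcapT_measurable.
have m2 i j : measurable (\bigcup_(T : nat) tie i j T.+1%:R).
  by apply: bigcupT_measurable => T; exact: measurable_tie.
have m3 i : measurable (\bigcup_j \bigcup_(T : nat) tie i j T.+1%:R).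
  exact: bigcupT_measurable.
have m4 : measurable (\bigcup_i \bigcup_j \bigcup_(T : nat) tie i j T.+1%:R).
  exact: bigcupT_measurable.
apply: P_setI1.
- by apply: measurableI => //; exact: measurableC.
- by apply: bigcupT_measurable => T; exact: measurable_deep_event.
- apply: P_setI1 => //; first exact: measurableC.
    apply: P_setC1 => //; rewrite setC_bigcap; apply: P_bigcup0 => T.
      exact: measurableC.
    apply: P_setC0 => //; have T0 : 0 <= T%:R :> R by [].
    exact: (has_count_finite tu_poisson (mT0 _) (rate_ge0 T0 mT) (LT (lexx 0) T0)).
  apply: P_setC1; first exact: measurableC.
  rewrite setCK; apply: P_bigcup0 => // i; apply: P_bigcup0 => // j.
  by apply: P_bigcup0 => T; [exact: measurable_tie|exact: tie0].
- exact: deep_event_large.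
Qed.

Lemma good_points_finite o (T : R) : good_points o -> finite_set [set i | (tu i o).1 < T].
Proof.
move=> [[h _] _]; have [k _ hk] := h (Num.truncn T).+1 Logic.I.
apply: (@sub_finite_set _ _ [set i | tcell 0 (Num.truncn T).+1%:R setT (tu i o)]).
  move=> i /= iT; split=> //; first exact: ltW (tu_dom i o).1.
  by apply: lt_trans iT _; exact: truncnS_gt.
by apply/finite_setP; exists k.
Qed.

Lemma good_points_inj o i j : good_points o -> (tu i o).1 = (tu j o).1 -> i = j.
Proof.
move=> [[_ h] _] tt; apply/eqP; rewrite -[_ == _]negbK; apply/negP => ij; apply: h.
exists i => //; exists j => //; exists (Num.truncn (tu i o).1) => //; split=> //.
exact: truncnS_gt.
Qed.

End deep_configurations.

End poisson_points.

(** * Families of segments and of polars with equal counts *)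

Section segment_families.
Context {R : realType} {d : nat}.
Local Notation V := 'rV[R]_d.
Implicit Types (p : nat -> R * V).

Definition pole (p : R * V) : V := p.1^-1 *: p.2.

Definition segments p : nat -> set V := fun i => segment 0 (pole (p i)).

Definition segment_vector (m : nat) p : {ptws 'I_m -> body0 R d} :=
  fun r => to_body (core setT (segments p) r.+1).
Arguments segment_vector : clear implicits.

Lemma enorm_pole (p : R * V) : 0 < p.1 -> enorm p.2 = 1 -> enorm (pole p) = p.1^-1.
Proof. by move=> t0 u1; rewrite enormZ u1 mulr1 gtr0_norm ?invr_gt0. Qed.

Lemma segments_bound p (delta : R) : 0 < delta ->
  (forall i, delta <= (p i).1 /\ enorm (p i).2 = 1) ->
  forall i y, setT i -> segments p i y -> enorm y <= delta^-1.
Proof.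
move=> d0 h i y _ /segment_bound/le_trans; apply; have [dp u1] := h i.
have t0 : 0 < (p i).1 by exact: lt_le_trans dp.
by rewrite enorm_pole// lef_pV2.
Qed.

Lemma level_segments p u (c : R) i : 0 <= c ->
  level setT (segments p) u c i <-> c < dot (pole (p i)) u.
Proof.
move=> c0; split=> [[_ h]|h]; first exact/(segment_level (pole (p i)) u c0).
by split=> //; exact/segment_level.
Qed.

Lemma level_segments_lt p u (c : R) i : 0 < c -> 0 < (p i).1 -> enorm (p i).2 = 1 ->
  enorm u = 1 -> level setT (segments p) u c i -> (p i).1 < c^-1.
Proof.
move=> c0 t0 pu u1 /(level_segments _ _ _ (ltW c0)) h.
have : c < (p i).1^-1.
  by rewrite (lt_le_trans h)// (le_trans (cauchy_schwarz _ _))// u1 mulr1 enorm_pole.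
by move=> h'; rewrite -[X in X < _]invrK ltf_pV2 ?posrE// invr_gt0.
Qed.

(** A point with time below [T] and direction at product more than 1/4 with [u] passes all levels
    below [1 / (4 * T)]. *)
Lemma segments_deep p (T : R) (q : nat) (w : 'I_q -> set V) (Q : 'I_q -> Prop) m :
  0 < T -> (forall i, 0 < (p i).1) ->
  (forall u, enorm u = 1 -> exists i, Q i /\ forall u', w i u' -> 4^-1 < dot u' u) ->
  (forall i, Q i -> (`I_m.+1 #<= [set l | tcell 0 T (w i) (p l)])%card) ->
  deep ((4 * T)^-1) setT (segments p) m.
Proof.
move=> T0 t0 wQ cQ u c u1 c0 cT; have [i [Qi wi]] := wQ u u1.
apply: card_le_trans (cQ i Qi) _; apply: subset_card_le => l [_ tT wl].
apply/level_segments => //; apply: (lt_trans cT); rewrite dotZl invfM.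
rewrite [ltRHS]mulrC; apply: (@lt_trans _ _ (4^-1 * (p l).1^-1)).
  by rewrite ltr_pM2l// ltf_pV2 ?posrE.
by rewrite ltr_pM2r ?invr_gt0//; exact: wi.
Qed.

Lemma body_segment_vector m p (rho delta : R) r : 0 < rho -> 0 < delta ->
  (forall i, delta <= (p i).1 /\ enorm (p i).2 = 1) ->
  deep rho setT (segments p) m ->
  body_set (segment_vector m p r : body0 R d) = core setT (segments p) (r : 'I_m).+1.
Proof.
move=> r0 d0 hp dp; apply: (@core_is_body _ _ _ _ _ _ rho delta^-1) => //.
- by rewrite invr_ge0 ltW.
- by apply: deepS dp; rewrite ltn_ord.
- exact: segments_bound.
Qed.

Lemma segment_vector_vclose m p (T' : Type) (I' : set T') (L' : T' -> set V) (e e0 rho M : R)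
    (y' : {ptws 'I_m -> body0 R d}) :
  0 < rho -> 0 <= M -> 0 <= e0 -> e0 <= rho -> e0 / rho * M < e ->
  deep (rho + rho) setT (segments p) m ->
  (forall i y, setT i -> segments p i y -> enorm y <= M) ->
  (forall i y, I' i -> L' i y -> enorm y <= M) ->
  dominated e0 setT (segments p) I' L' -> dominated e0 I' L' setT (segments p) ->
  (forall r : 'I_m, y' r = to_body (core I' L' r.+1)) ->
  vclose e (segment_vector m p) y'.
Proof.
move=> rho0 M0 e00 er eM dp b b' D D' yE r; rewrite yE; apply: le_lt_trans eM.
apply: hausdorff_core => //; apply: deepS dp; exact: ltn_ord.
Qed.

(** A segment with time at least [1 / e1] is too short to pass a level [c + e1]. So the first [k]
    members decide once they include all earlier times, and rounding moves their levels by at most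
    [e1]. *)
Lemma segment_vector_limit m p (rho delta : R) : 0 < rho -> 0 < delta ->
  (forall i, delta <= (p i).1 /\ enorm (p i).2 = 1) ->
  (forall T, finite_set [set i | (p i).1 < T]) ->
  deep rho setT (segments p) m -> forall e, 0 < e -> exists N, forall k x', (N <= k)%N ->
    (forall i, (i < k)%N -> enorm (pole (p i) - x' i) <= Num.sqrt d%:R / k.+1%:R) ->
    vclose e (segment_vector m p)
      (fun r => to_body (core `I_k (fun i => segment 0 (x' i)) r.+1)).
Proof.
move=> rho0 d0 hp fp dp e e0.
have t0 i : 0 < (p i).1 by apply: lt_le_trans (hp i).1.
(* Rounding lengthens a segment by at most [Num.sqrt d%:R], whatever [k] is, so [M] bounds both
   families. *)
pose M := delta^-1 + Num.sqrt d%:R; pose rho' := rho / 2.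
have sd0 : 0 <= Num.sqrt d%:R :> R by exact: sqrtr_ge0.
have M0 : 0 < M by rewrite ltr_pwDl// invr_gt0.
have rho'0 : 0 < rho' by rewrite divr_gt0.
pose e1 := Num.min rho' (e / 2 * rho' / M).
have e10 : 0 < e1 by rewrite lt_min rho'0 !(divr_gt0, mulr_gt0).
have [N0 hN0] : exists N0, forall i, (p i).1 < e1^-1 -> (i < N0)%N.
  have [s Es] := (finite_seqP _).1 (fp e1^-1); exists (\max_(i <- s) i).+1 => i Qi.
  have : i \in s by have : [set i | (p i).1 < e1^-1] i := Qi; rewrite Es.
  by move=> si; rewrite ltnS; exact: leq_bigmax_seq.
exists (maxn N0 (Num.truncn (Num.sqrt d%:R / e1))) => k x' Nk hx.
have dk : Num.sqrt d%:R / k.+1%:R <= e1.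
  rewrite ler_pdivrMr ?ltr0n// mulrC -ler_pdivrMr//.
  apply: ltW; apply: (lt_le_trans (truncnS_gt _)); rewrite ler_nat ltnS.
  by apply: leq_trans Nk; exact: leq_maxr.
have hdot i u : (i < k)%N -> enorm u = 1 -> `|dot (pole (p i)) u - dot (x' i) u| <= e1.
  move=> ik u1; rewrite -dotBl; have h := hx i ik.
  rewrite ler_norml; apply/andP; split; last first.
    by rewrite (le_trans (cauchy_schwarz _ _))// u1 mulr1 (le_trans h).
  rewrite lerNl -dotNl opprB (le_trans (cauchy_schwarz _ _))// u1 mulr1 enormB.
  exact: le_trans h dk.
apply: (@segment_vector_vclose m p nat `I_k (fun i => segment 0 (x' i)) e e1 rho' M) => //.
- exact: ltW.
- exact: ltW.
- by rewrite ge_min lexx.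
- apply: (@le_lt_trans _ _ (e / 2)).
    by rewrite mulrAC ler_pdivrMr// -ler_pdivlMr// ge_min lexx orbT.
  by rewrite ltr_pdivrMr// ltr_pMr// ltr1n.
- by rewrite /rho' -splitr.
- move=> i y _ /(segments_bound d0 hp Logic.I)/le_trans; apply; by rewrite lerDl.
- move=> i y ik /segment_bound/le_trans; apply.
  have -> : x' i = pole (p i) - (pole (p i) - x' i) by rewrite subKr.
  rewrite (le_trans (ler_enormD _ _))// enormN lerD//.
    by have [dp' u1] := hp i; rewrite enorm_pole// lef_pV2// posrE.
  by rewrite (le_trans (hx i ik))// ler_pdivrMr ?ltr0n// ler_peMr// ler1n.
- move=> u c u1 c0; apply: subset_card_le => i h.
  have ce : 0 < c + e1 by rewrite ltr_wpDl.
  have iN : (i < k)%N.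
    apply: (@leq_trans N0); last by apply: leq_trans Nk; exact: leq_maxl.
    apply: hN0; apply: (lt_le_trans (level_segments_lt ce (t0 i) (hp i).2 u1 h)).
    by rewrite lef_pV2// lerDr.
  move/(level_segments _ _ _ (ltW ce)) : h => h; split=> //; apply/segment_level => //.
  by have := hdot i u iN u1; rewrite ler_norml => /andP[_]; lra.
- move=> u c u1 c0; apply: subset_card_le => i [ik /segment_level h].
  apply/level_segments => //; have {}h := h (addr_ge0 c0 (ltW e10)).
  by have := hdot i u ik u1; rewrite ler_norml => /andP[? _]; lra.
Qed.

End segment_families.
Arguments segment_vector {R d} m p _.

(** * Families of rescaled polars for a fixed sample size *)

Section polar_families.
Context {R : realType} {d : nat}.
Local Notation V := 'rV[R]_d.
Variable K : body0 R d.
Local Notation g := (gauge K).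

Lemma polar_shiftE n x y : (0 < n)%N ->
  polar_shift K n x y <-> forall k, body_set K k -> dot (k - x) (n%:R *: y) <= 1.
Proof.
move=> n0; have n0' : (n%:R : R)^-1 != 0 by rewrite invr_eq0 pnatr_eq0 -lt0n.
rewrite /polar_shift dilateE// translateE invrK; split=> h k.
  by move=> Kk; apply: h; rewrite /= opprK subrK.
by rewrite /= opprK => Kk; have := h _ Kk; rewrite addrK.
Qed.

Lemma polar_shift_ball : exists2 b, 0 < b & forall n x y, (0 < n)%N -> g x <= 1 ->
  enorm y <= b / n%:R -> polar_shift K n x y.
Proof.
have [B B0 KB] := body_bound K; exists (B + B)^-1; first by rewrite invr_gt0 addr_gt0.
move=> n x y n0 /gauge_le1 Kx yb; have n0' : 0 < n%:R :> R by rewrite ltr0n.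
apply/polar_shiftE => // k Kk; rewrite (le_trans (cauchy_schwarz _ _))// enormZ normr_nat.
have BB : 0 < B + B by rewrite addr_gt0.
apply: (@le_trans _ _ ((B + B) * (n%:R * ((B + B)^-1 / n%:R)))); last first.
  by rewrite [n%:R * _]mulrC divfK ?gt_eqF// mulfV ?gt_eqF.
rewrite ler_pM ?enorm_ge0 ?mulr_ge0 ?enorm_ge0//; last by rewrite ler_pM2l.
by rewrite (le_trans (ler_enormD _ _))// enormN lerD// KB.
Qed.

(** A point [x] of gauge at most [1 - tau] is the centre of a ball of radius [tau * b] in [K], which
    bounds the polar of [K - x]. *)
Lemma polar_shift_inner : exists2 b, 0 < b & forall n x y (tau : R), (0 < n)%N ->
  0 < tau -> g x <= 1 - tau -> polar_shift K n x y -> enorm y <= (tau * b * n%:R)^-1.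
Proof.
have [b b0 bK] := body_ball K; exists b => // n x y tau n0 t0 gx /(polar_shiftE _ _ n0) h.
have n0' : 0 < n%:R :> R by rewrite ltr0n.
have [->|y0] := eqVneq y 0.
  by rewrite enorm0 invr_ge0 !mulr_ge0// ltW.
have Y0 := enorm_gt0 y0; pose v := (enorm y)^-1 *: y.
have v1 : enorm v = 1 by rewrite enormZ gtr0_norm ?invr_gt0// mulVf// gt_eqF.
have gv : g (b *: v) <= 1 by apply/gauge_le1/bK; rewrite enormZ v1 mulr1 gtr0_norm.
have := h (x + tau *: (b *: v)); rewrite -gauge_le1.
have gle : g (x + tau *: (b *: v)) <= 1.
  rewrite (le_trans (gaugeD _ _ _))// gaugeZ ?(ltW t0)//.
  by have := ler_wpM2l (ltW t0) gv; move: gx; lra.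
move=> /(_ gle); rewrite addrAC subrr add0r !dotZl dotZr dotxx => h1.
rewrite -[leLHS]invrK lef_pV2 ?posrE ?invr_gt0// ?mulr_gt0//.
rewrite -[leRHS]mul1r ler_pdivlMr//; apply: le_trans h1.
by rewrite le_eqVlt; apply/orP; left; apply/eqP; field; rewrite gt_eqF.
Qed.

(** Moving the centre from [x] to [x'] changes the constraint [dot (k - x) (n%:R *: y) <= 1] by at
    most [n%:R * enorm (x - x') * B], which the scaling absorbs. *)
Lemma polar_shift_move n x x' y B : (0 < n)%N -> polar_shift K n x y -> enorm y <= B ->
  polar_shift K n x' ((1 + n%:R * enorm (x - x') * B)^-1 *: y).
Proof.
move=> n0 /(polar_shiftE _ _ n0) h yB; apply/polar_shiftE => // k Kk.
have n0' : 0 < n%:R :> R by rewrite ltr0n.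
have B0 : 0 <= B by exact: le_trans (enorm_ge0 _) yB.
have D0 : 0 < 1 + n%:R * enorm (x - x') * B.
  by rewrite ltr_pwDl// !mulr_ge0 ?enorm_ge0.
rewrite scalerA mulrC -scalerA dotZr mulrC ler_pdivrMr// mul1r.
have -> : k - x' = (k - x) + (x - x') by rewrite addrA subrK.
rewrite dotDl lerD ?h// (le_trans (cauchy_schwarz _ _))//.
by rewrite enormZ normr_nat mulrCA mulrA ler_wpM2l// mulr_ge0// ?enorm_ge0.
Qed.

Lemma polar_shift_dominated n (x x' : nat -> V) (B e eta : R) : (0 < n)%N -> 0 <= eta ->
  (forall i, (i < n)%N -> enorm (x i - x' i) <= eta) ->
  (forall i y, (i < n)%N -> polar_shift K n (x i) y -> enorm y <= B) ->
  n%:R * eta * B * B <= e ->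
  dominated e `I_n (fun i => polar_shift K n (x i)) `I_n (fun i => polar_shift K n (x' i)).
Proof.
move=> n0 eta0 hx hB he u c u1 c0; apply: subset_card_le => i [ni [y py cy]].
have yB := hB i y ni py; have B0 : 0 <= B by exact: le_trans (enorm_ge0 _) yB.
split=> //; have py' := polar_shift_move (x' i) n0 py yB.
exists ((1 + n%:R * enorm (x i - x' i) * B)^-1 *: y) => //.
set D := n%:R * enorm (x i - x' i) * B; have D0 : 0 <= D by rewrite !mulr_ge0 ?enorm_ge0.
have DD : D * B <= e.
  by apply: le_trans he; rewrite !ler_wpM2r// ler_wpM2l//; exact: hx.
have e0 : 0 <= e by apply: le_trans DD; rewrite mulr_ge0.
have cB : c <= B.
  apply: le_trans (_ : dot y u <= B); first by apply: ltW; apply: le_lt_trans cy; rewrite lerDl.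
  by rewrite (le_trans (cauchy_schwarz _ _))// u1 mulr1.
rewrite dotZl mulrC ltr_pdivlMr ?ltr_pwDl//; apply: le_lt_trans cy.
by rewrite mulrDr mulr1 lerD2l (le_trans _ DD)// mulrC ler_wpM2l.
Qed.

(** The radius [b / n%:R] vanishes in the limit: this depth serves for fixed [n], where it makes the
    cores bodies and yields measurability. *)
Lemma polar_shift_deep : exists2 b, 0 < b & forall n (x : nat -> V) m, (m < n)%N ->
  (forall i, (i < n)%N -> g (x i) <= 1) ->
  deep (b / n%:R) `I_n (fun i => polar_shift K n (x i)) m.
Proof.
have [b b0 hb] := polar_shift_ball; exists b => // n x m mn gx u c u1 c0 cb.
have n0 : (0 < n)%N by exact: leq_ltn_trans mn.
have mn' : (`I_m.+1 #<= `I_n)%card by rewrite card_le_II.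
apply: (card_le_trans mn').
apply: subset_card_le => i /= ni; split=> //; exists ((b / n%:R) *: u).
  apply: hb => //; first exact: gx.
  by rewrite enormZ u1 mulr1 ger0_norm// divr_ge0// ltW.
by rewrite dotZl dotxx u1 expr1n mulr1.
Qed.

Definition polar_vector (m n : nat) (x : nat -> V) : {ptws 'I_m -> body0 R d} :=
  fun r => to_body (core `I_n (fun i => polar_shift K n (x i)) r.+1).
Arguments polar_vector : clear implicits.

Lemma body_polar_vector m n (x : nat -> V) (r : 'I_m) : (m < n)%N ->
  (forall i, (i < n)%N -> g (x i) < 1) ->
  body_set (polar_vector m n x r : body0 R d) =
  core `I_n (fun i => polar_shift K n (x i)) r.+1.
Proof.
move=> mn gx; have [b b0 hb] := polar_shift_deep; have [b' b'0 hb'] := polar_shift_inner.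
have n0 : (0 < n)%N by exact: leq_ltn_trans mn.
have n0' : 0 < n%:R :> R by rewrite ltr0n.
have [tau t0 gt] : exists2 tau : R, 0 < tau & forall i, (i < n)%N -> g (x i) <= 1 - tau.
  exists (\big[Num.min/1]_(i < n) (1 - g (x i))).
    by apply/bigmin_gtP; split=> // i _; rewrite subr_gt0 gx.
  by move=> i ni; rewrite lerBrDr -lerBrDl; exact: (@bigmin_le_cond _ _ _ _ (Ordinal ni)).
apply: (@core_is_body _ _ _ _ _ _ (b / n%:R) (tau * b' * n%:R)^-1).
- by rewrite divr_gt0.
- by rewrite invr_ge0 !mulr_ge0// ltW.
- by apply: deepS (hb n x m mn _) => // i ni; exact: ltW (gx i ni).
- by move=> i y ni; apply: hb' => //; exact: gt.
Qed.

Lemma polar_vector_limit m n (x : nat -> V) : (m < n)%N ->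
  (forall i, (i < n)%N -> g (x i) < 1) -> forall e, 0 < e -> exists N, forall k x', (N <= k)%N ->
    (forall i, (i < n)%N -> enorm (x i - x' i) <= Num.sqrt d%:R / k.+1%:R) ->
    vclose e (polar_vector m n x) (polar_vector m n x').
Proof.
move=> mn gx e e0; have [b b0 hb] := polar_shift_deep; have [b' b'0 hb'] := polar_shift_inner.
have n0 : (0 < n)%N by exact: leq_ltn_trans mn.
have n0' : 0 < n%:R :> R by rewrite ltr0n.
(* [tau] is the margin of the whole sample. Half of it is kept by the rounded points, so that their
   polars are bounded as well. *)
have [tau t0 gt] : exists2 tau : R, 0 < tau & forall i, (i < n)%N -> g (x i) <= 1 - tau.
  exists (\big[Num.min/1]_(i < n) (1 - g (x i))).
    by apply/bigmin_gtP; split=> // i _; rewrite subr_gt0 gx.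
  by move=> i ni; rewrite lerBrDr -lerBrDl; exact: (@bigmin_le_cond _ _ _ _ (Ordinal ni)).
have [M M0 gM] := gauge_lip K.
pose rho := b / n%:R / 2; pose B := (tau / 2 * b' * n%:R)^-1.
have rho0 : 0 < rho by rewrite !divr_gt0.
have B0 : 0 < B by rewrite invr_gt0 !mulr_gt0.
pose e1 := Num.min rho (e / 2 * rho / B).
have e10 : 0 < e1 by rewrite lt_min rho0 !(divr_gt0, mulr_gt0).
pose eta := Num.min (tau / 2 / M) (e1 / (n%:R * B * B)).
have eta0 : 0 < eta by rewrite lt_min !(divr_gt0, mulr_gt0).
exists (Num.truncn (Num.sqrt d%:R / eta)) => k x' Nk hx.
have {}hx i : (i < n)%N -> enorm (x i - x' i) <= eta.
  move=> ni; apply: (le_trans (hx i ni)); rewrite ler_pdivrMr ?ltr0n// mulrC -ler_pdivrMr//.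
  by apply: ltW; apply: (lt_le_trans (truncnS_gt _)); rewrite ler_nat ltnS.
have gx' i : (i < n)%N -> g (x' i) <= 1 - tau / 2.
  move=> ni; have := gM (x i) (x' i); have : M * enorm (x i - x' i) <= tau / 2.
    by rewrite mulrC -ler_pdivlMr// (le_trans (hx i ni))// ge_min lexx.
  by have := gt i ni; rewrite ler_norml => ? ? /andP[? _]; lra.
have bd i y : (i < n)%N -> polar_shift K n (x i) y -> enorm y <= B.
  move=> ni; apply: hb' => //; first by rewrite divr_gt0.
  by have := gt i ni; lra.
have bd' i y : (i < n)%N -> polar_shift K n (x' i) y -> enorm y <= B.
  by move=> ni; apply: hb' => //; [rewrite divr_gt0|exact: gx'].
have small : n%:R * eta * B * B <= e1.
  have -> : n%:R * eta * B * B = eta * (n%:R * B * B) by ring.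
  by rewrite -ler_pdivlMr ?mulr_gt0// ge_min lexx orbT.
move=> r; apply: (@le_lt_trans _ _ (e1 / rho * B)).
  apply: hausdorff_core => //; try exact: ltW.
  - by rewrite ge_min lexx.
  - rewrite /rho -splitr; apply: deepS (hb n x m mn _); first exact: ltn_ord.
    by move=> i ni; exact: ltW (gx i ni).
  - by apply: (polar_shift_dominated n0 (ltW eta0) hx bd small).
  - apply: (polar_shift_dominated n0 (ltW eta0) _ bd' small) => i ni.
    by rewrite enormB; exact: hx.
apply: (@le_lt_trans _ _ (e / 2)).
  by rewrite mulrAC ler_pdivrMr// -ler_pdivlMr// ge_min lexx orbT.
by rewrite ltr_pdivrMr// ltr_pMr// ltr1n.
Qed.

End polar_families.
Arguments polar_vector {R d} K m n x _.

Lemma half_le (R : realFieldType) (e : R) : 0 < e -> e / 2 <= e.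
Proof. lra. Qed.

(** * Comparison of families with equal counts in all cells *)

Section coupling.
Context {R : realType} {d : nat}.
Local Notation V := 'rV[R]_d.
Variable K : body0 R d.
Hypothesis K_regular : regular K.
Local Notation g := (gauge K).
Local Notation bV := (borel V).
Variables (delta M e : R) (q : nat) (a b : 'I_q.+1 -> R) (w : 'I_q.+1 -> set bV).
Hypotheses (delta_gt0 : 0 < delta) (e_gt0 : 0 < e) (eM : e^-1 <= M).
Local Notation B := (fun i => tcell (a i) (b i) (w i)).
Hypotheses (tB : trivIset setT B) (B0 : B ord0 = tcell 0 delta setT)
  (cover : forall t (u : V), delta <= t -> t < M -> enorm u = 1 ->
    exists2 i, i != ord0 & B i (t, u))
  (osc : forall i t t' (u u' z : V), i != ord0 -> B i (t, u) -> B i (t', u') ->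
    enorm u = 1 -> enorm u' = 1 -> enorm z = 1 ->
    [/\ delta <= t, delta <= t' & dot (t^-1 *: u) z <= dot (t'^-1 *: u') z + e / 2]).
Implicit Types p : nat -> R * V.

Definition unit_dir p (I : set nat) := forall i, I i -> 0 < (p i).1 /\ enorm (p i).2 = 1.

Definition same_counts (I I' : set nat) p p' := forall j,
  ([set i | I i /\ B j (p i)] #= [set i | I' i /\ B j (p' i)])%card.

Lemma same_counts_sym I I' p p' : same_counts I I' p p' -> same_counts I' I p' p.
Proof. by move=> h j; rewrite card_eq_sym. Qed.

Lemma empty_first p I : unit_dir p I -> ([set i | I i /\ B ord0 (p i)] #= `I_0)%card ->
  forall i, I i -> delta <= (p i).1.
Proof.
rewrite II0 card_eq0 => hp /eqP h i Ii; rewrite leNgt; apply/negP => ti.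
have : [set i | I i /\ B ord0 (p i)] i.
  by split=> //; rewrite B0; split=> //=; exact: ltW (hp i Ii).1.
by rewrite h.
Qed.

Let osc' j (x y : R * V) u : j != ord0 -> B j x -> B j y -> enorm x.2 = 1 ->
  enorm y.2 = 1 -> enorm u = 1 -> dot (pole x) u <= dot (pole y) u + e / 2.
Proof.
case: x y => [t v] [t' v'] j0 Bx By v1 v1' u1.
by have [] := osc j0 Bx By v1 v1' u1.
Qed.

(** A segment passing [c + e] has time below [1 / e], hence below [M], so it lies in a cell other
    than the first; the points of [p'] in this cell have nearly the same endpoint. *)
Lemma segments_dominated p p' : unit_dir p setT -> unit_dir p' setT ->
  same_counts setT setT p p' -> (forall i, delta <= (p i).1) ->
  dominated e setT (segments p) setT (segments p').
Proof.
move=> hp hp' pp pd; apply: (dominated_cells tB pp) => u c i u1 c0 hi.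
have ce : 0 < c + e by rewrite ltr_wpDl.
have [t0 pu1] := hp i Logic.I.
have tM : (p i).1 < M.
  apply: lt_le_trans eM; apply: (lt_le_trans (level_segments_lt ce t0 pu1 u1 hi)).
  by rewrite lef_pV2// lerDr.
have [j j0 Bj] := cover (pd i) tM pu1; rewrite -surjective_pairing in Bj.
exists j => // i' _ Bj'; move/(level_segments _ _ _ (ltW ce)) : hi => hi.
apply/level_segments => //; have := osc' j0 Bj Bj' pu1 (hp' i' Logic.I).2 u1.
move: hi (half_le e_gt0); lra.
Qed.

Lemma segments_polar_dominated n p (x : nat -> V) : (0 < n)%N ->
  (forall i, (i < n)%N -> proper_point K (x i)) ->
  unit_dir p setT -> same_counts setT `I_n p (fun i => tag K n (x i)) ->
  (forall i, delta <= (p i).1) ->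
  dominated e setT (segments p) `I_n (fun i => polar_shift K n (x i)).
Proof.
move=> n0 hx hp pp pd; apply: (dominated_cells tB pp) => u c i u1 c0 hi.
have ce : 0 < c + e by rewrite ltr_wpDl.
have [t0 pu1] := hp i Logic.I.
have tM : (p i).1 < M.
  apply: lt_le_trans eM; apply: (lt_le_trans (level_segments_lt ce t0 pu1 u1 hi)).
  by rewrite lef_pV2// lerDr.
have [j j0 Bj] := cover (pd i) tM pu1; rewrite -surjective_pairing in Bj.
exists j => // i' ni Bj'; move/(level_segments _ _ _ (ltW ce)) : hi => hi.
have e2 : 0 < e / 2 by rewrite divr_gt0.
(* [polar_shift_level] needs a positive level while [c] may be 0, so half of the shift is kept above
   [c]. *)
have [x0 gx] := hx i' ni; apply: (@level_anti _ _ _ _ _ _ c (c + e / 2)); first by rewrite lerDl ltW.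
split=> //; apply/(polar_shift_level _ n0 (ltW gx)); first by rewrite ltr_wpDl.
apply: segment_polar_shift => //; first by rewrite ltr_wpDl.
have := osc' j0 Bj Bj' pu1 (enorm_gdir K x0) u1; move: hi; rewrite /pole; lra.
Qed.

Variable C : R.
Hypotheses (C_gt0 : 0 < C) (CM : C / e <= M)
  (HC : forall n x u (c : R), (0 < n)%N -> g x < 1 -> x != 0 -> enorm u = 1 -> 0 < c ->
    1 < g (x + (n%:R * c)^-1 *: u) -> c * (tag K n x).1 < C).

Lemma tag_gt0 n (x : V) : (0 < n)%N -> proper_point K x -> 0 < (tag K n x).1.
Proof.
move=> n0 [x0 gx]; have [m0 [M0 [[m00 _] _ _ _ hm]]] := gauge_bounds K.
rewrite /tag/= divr_gt0//; last exact: lt_le_trans (hm x x0).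
by rewrite mulr_gt0 ?ltr0n// subr_gt0.
Qed.

(** A polar passing a level [c] has time below [C / c]; a time of at least [delta] therefore
    excludes the level [C / delta]. *)
Lemma polar_shift_tag_bound n (x y : V) : (0 < n)%N -> proper_point K x ->
  delta <= (tag K n x).1 -> polar_shift K n x y -> enorm y <= C / delta.
Proof.
move=> n0 [x0 gx] dt py; rewrite leNgt; apply/negP => Cy.
have C0 : 0 < C / delta by rewrite divr_gt0.
have Y0 : 0 < enorm y by exact: lt_trans Cy.
pose u := (enorm y)^-1 *: y.
have u1 : enorm u = 1 by rewrite enormZ gtr0_norm ?invr_gt0// mulVf// gt_eqF.
have h : 1 < g (x + (n%:R * (C / delta))^-1 *: u).
  apply/(polar_shift_level _ n0 (ltW gx) C0); exists y => //.
  by rewrite /u dotZr dotxx expr2 mulrA mulVf ?gt_eqF// mul1r.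
have := HC n0 gx x0 u1 C0 h; rewrite ltNge => /negP; apply.
by rewrite mulrAC ler_pdivlMr// ler_wpM2l// ltW.
Qed.

(** Half of [e] pays for replacing the polar by its segment, half for the oscillation within the
    cell. [n0] is uniform over the configurations. *)
Lemma polar_segments_dominated : exists n0, forall n p (x : nat -> V), (n0 <= n)%N ->
  (0 < n)%N -> (forall i, (i < n)%N -> proper_point K (x i)) ->
  unit_dir p setT -> same_counts `I_n setT (fun i => tag K n (x i)) p ->
  (forall i, (i < n)%N -> delta <= (tag K n (x i)).1) ->
  dominated e `I_n (fun i => polar_shift K n (x i)) setT (segments p).
Proof.
have e2 : 0 < e / 2 by rewrite divr_gt0.
have [n0 Hn0] := polar_shift_segment K_regular M e2 delta_gt0; exists n0.
move=> n p x n0n n_gt0 hx hp pp pd; apply: (dominated_cells tB pp) => u c i u1 c0 [ni hi].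
have ce : 0 < c + e by rewrite ltr_wpDl.
have [x0 gx] := hx i ni.
move/(polar_shift_level _ n_gt0 (ltW gx) ce) : hi => hi.
have tM : (tag K n (x i)).1 < M.
  apply: lt_le_trans CM; rewrite ltr_pdivlMr// mulrC.
  apply: le_lt_trans (HC n_gt0 gx x0 u1 ce hi); rewrite ler_wpM2r ?lerDr//.
  exact: ltW (tag_gt0 _ _).
have [j j0 Bj] := cover (pd i ni) tM (enorm_gdir K x0).
exists j => // i' _ Bj'; apply/level_segments => //.
have h : c + e - e / 2 < dot ((tag K n (x i)).1^-1 *: (tag K n (x i)).2) u.
  apply: (Hn0 n (x i) u (c + e)) => //; [exact: pd|exact: ltW|].
  by apply: (@le_trans _ _ e); [exact: half_le|rewrite lerDr].
have := osc' j0 Bj Bj' (enorm_gdir K x0) (hp i' Logic.I).2 u1; move: h; rewrite /pole/=; lra.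
Qed.

End coupling.

(** * Convergence in law from couplings *)

Section bounded_expectation.
Context {R : realType} {dO : measure_display} {Omega : measurableType dO}.
Variable P : probability Omega R.
Implicit Types X : Omega -> R.

Definition bounded_rv X := measurable_fun setT (X : Omega -> measurableTypeR R) /\
  exists M : R, forall o, `|X o| <= M.

Definition mean X : R := fine ('E_P[X])%E.

Lemma bounded_rv_integrable X : bounded_rv X -> P.-integrable setT (EFin \o X).
Proof.
move=> [mX [M hM]]; apply: measurable_bounded_integrable => //.
  by rewrite (le_lt_trans (probability_le1 _ measurableT))// ltry.
by exists M; split=> [|M' MM x _]; [exact: num_real|exact: le_trans (hM x) (ltW MM)].
Qed.

Lemma meanE X : bounded_rv X -> 'E_P[X]%E = (mean X)%:E.
Proof.
move=> bX; rewrite /mean fineK// unlock.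
exact: (integrable_fin_num measurableT (bounded_rv_integrable bX)).
Qed.

Lemma bounded_rv_cst (k : R) : bounded_rv (fun=> k).
Proof. by split; [exact: measurable_cst|exists `|k|]. Qed.

Lemma bounded_rvD X Y : bounded_rv X -> bounded_rv Y -> bounded_rv (fun o => X o + Y o).
Proof.
move=> [mX [M hM]] [mY [M' hM']]; split; first exact: measurable_funD.
by exists (M + M') => o; rewrite (le_trans (ler_normD _ _))// lerD.
Qed.

Lemma bounded_rvZ (k : R) X : bounded_rv X -> bounded_rv (fun o => k * X o).
Proof.
move=> [mX [M hM]]; split; first by apply: measurable_funM => //; exact: measurable_cst.
by exists (`|k| * M) => o; rewrite normrM ler_wpM2l.
Qed.

Lemma bounded_rv_indic (A : set Omega) : measurable A -> bounded_rv (\1_A).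
Proof.
move=> mA; split; first exact: measurable_indic.
by exists 1 => o; rewrite indicE; case: (_ \in _); rewrite ?normr1 ?normr0.
Qed.

Lemma meanD X Y : bounded_rv X -> bounded_rv Y ->
  mean (fun o => X o + Y o) = mean X + mean Y.
Proof.
move=> bX bY; apply: EFin_inj; rewrite EFinD -!meanE//; last exact: bounded_rvD.
rewrite unlock -integralD_EFin//; exact: bounded_rv_integrable.
Qed.

Lemma meanZ (k : R) X : bounded_rv X -> mean (fun o => k * X o) = k * mean X.
Proof.
move=> bX; apply: EFin_inj; rewrite EFinM -!meanE//; last exact: bounded_rvZ.
rewrite unlock -integralZl//; exact: bounded_rv_integrable.
Qed.

Lemma mean_cst (k : R) : mean (fun=> k) = k.
Proof. by rewrite /mean (_ : (fun=> k) = cst k)// expectation_cst. Qed.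

Lemma mean_indic (A : set Omega) : measurable A -> mean (\1_A) = pr P A.
Proof. by move=> mA; rewrite /mean expectation_indic. Qed.

Lemma mean_le X Y : bounded_rv X -> bounded_rv Y -> (forall o, X o <= Y o) ->
  mean X <= mean Y.
Proof.
move=> bX bY XY; rewrite -lee_fin -!meanE// unlock; apply: le_integral => //.
- exact: bounded_rv_integrable.
- exact: bounded_rv_integrable.
- by move=> o _; rewrite lee_fin.
Qed.

Lemma mean_sum_indic (I : Type) (s : seq I) (a : I -> R) (A : I -> set Omega) :
  (forall i, measurable (A i)) ->
  bounded_rv (fun o => \sum_(i <- s) a i * \1_(A i) o) /\
  mean (fun o => \sum_(i <- s) a i * \1_(A i) o) = \sum_(i <- s) a i * pr P (A i).
Proof.
move=> mA; elim: s => [|i s [bs ms]].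
  by under eq_fun do rewrite big_nil; rewrite big_nil mean_cst; split=> //; exact: bounded_rv_cst.
have bi : bounded_rv (fun o => a i * \1_(A i) o).
  exact: (bounded_rvZ (a i) (bounded_rv_indic (mA i))).
under eq_fun do rewrite big_cons; rewrite big_cons; split; first exact: bounded_rvD.
by rewrite meanD// meanZ ?mean_indic ?ms//; exact: bounded_rv_indic.
Qed.

Lemma mean_upper (F : finType) (A : F -> set Omega) (a : F -> R) M X :
  bounded_rv X -> (forall c, measurable (A c)) -> trivIset setT A ->
  (forall c o, A c o -> X o <= a c) -> (forall o, X o <= M) ->
  mean X <= M + \sum_c (a c - M) * pr P (A c).
Proof.
move=> bX mA tA Xa XM; have [bS mS] := mean_sum_indic (index_enum F) (fun c => a c - M) mA.
rewrite -mS -[X in _ <= X + _]mean_cst -meanD//; last exact: bounded_rv_cst.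
apply: mean_le => //; first by apply: bounded_rvD => //; exact: bounded_rv_cst.
move=> o; have [[c Ac]|nA] := pselect (exists c, A c o).
  rewrite (bigD1 c)//= big1 ?addr0 => [|c' cc'].
    by rewrite indicE mem_set// mulr1 addrC subrK; exact: Xa.
  rewrite indicE memNset ?mulr0// => Ac'; move/eqP: cc'; apply; apply: tA => //.
  by exists o.
rewrite big1 ?addr0// => c _; rewrite indicE memNset ?mulr0// => Ac.
by apply: nA; exists c.
Qed.

(** On the events [X] is within [k] of the tabulated value, elsewhere it is bounded by [M]; the
    lower bound is the upper one for the opposite variable. *)
Lemma mean_approx (F : finType) (A : F -> set Omega) (v : F -> R) (M k : R) X :
  bounded_rv X -> (forall c, measurable (A c)) -> trivIset setT A -> 0 <= k ->
  (forall c o, A c o -> `|X o - v c| <= k) -> (forall o, `|X o| <= M) ->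
  `|mean X - \sum_c v c * pr P (A c)| <= k + M * (1 - \sum_c pr P (A c)).
Proof.
move=> bX mA tA k0 Xv XM; set t := \sum_c pr P (A c).
have t1 : t <= 1 by rewrite /t -pr_bigcup_ord//; apply: pr_le1; exact: fin_bigcup_measurable.
have kt : k * t <= k by rewrite -[leRHS]mulr1 ler_wpM2l.
have expand (a : F -> R) : M + \sum_c (a c + k - M) * pr P (A c) =
    \sum_c a c * pr P (A c) + k * t + M * (1 - t).
  rewrite (eq_bigr (fun c => a c * pr P (A c) + (k - M) * pr P (A c))) => [|c _]; last by ring.
  by rewrite big_split -mulr_sumr -/t /=; ring.
have up : mean X <= M + \sum_c (v c + k - M) * pr P (A c).
  apply: mean_upper => // [c o Ac|o].
    by have := Xv c o Ac; rewrite ler_norml => /andP[_]; lra.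
  exact: le_trans (ler_norm _) (XM o).
have lo : mean (fun o => -1 * X o) <= M + \sum_c (- v c + k - M) * pr P (A c).
  apply: mean_upper => // [|c o Ac|o]; first exact: bounded_rvZ.
    by have := Xv c o Ac; rewrite ler_norml => /andP[+ _]; lra.
  by have := XM o; rewrite ler_norml => /andP[+ _]; lra.
rewrite meanZ// expand in lo; rewrite expand in up.
have sN : \sum_c - v c * pr P (A c) = - \sum_c v c * pr P (A c).
  by rewrite -sumrN; apply: eq_bigr => c _; rewrite mulNr.
rewrite sN in lo; rewrite ler_norml; move: up lo kt; set S := \sum_c _.
by move=> *; apply/andP; split; lra.
Qed.

End bounded_expectation.

Lemma continuous_measurable {R : realType} (T : ptopologicalType) (f : T -> R) :
  continuous f -> measurable_fun setT (f : borel T -> measurableTypeR R).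
Proof.
move=> cf; apply: (measurability _ (measurable_realfun.RGenOpens.measurableE R)).
move=> _ [_ [a [b ->] <-]]; rewrite setTI; apply: sub_sigma_algebra.
apply: open_comp; last exact: interval_open.
by move=> x _; exact: cf.
Qed.

Section coupling_law.
Context {R : realType} {d m : nat}.
Context {dO dO' : measure_display}.
Context {Omega : measurableType dO} {Omega' : measurableType dO'}.
Variables (P : probability Omega R) (P' : probability Omega' R).
Local Notation bodies := {ptws 'I_m -> body0 R d}.
Variables (Y_ : nat -> Omega -> borel bodies) (Y : Omega' -> borel bodies) (N0 : nat).
Hypothesis mY_ : forall n, (N0 <= n)%N -> measurable_fun setT (Y_ n).
Hypothesis mY : measurable_fun setT Y.

Definition coupling (e k : R) := exists (F : finType) (A : nat -> F -> set Omega)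
    (A' : F -> set Omega') (G : set Omega') (N : nat),
  [/\ forall n c, (N <= n)%N -> measurable (A n c),
    forall n, (N <= n)%N -> trivIset setT (A n),
    forall c, measurable (A' c), trivIset setT A' & measurable G] /\
  [/\ forall c, pr P (A n c) @[n --> \oo] --> pr P' (A' c),
    1 - k <= pr P' G, 1 - k <= \sum_c pr P' (A' c),
    forall c o o', A' c o -> G o -> A' c o' -> vclose e (Y o : bodies) (Y o') &
    forall c n o o', (N <= n)%N -> A' c o -> G o -> A n c o' ->
      vclose e (Y o : bodies) (Y_ n o')].

Hypothesis coupled : forall e k, 0 < e -> 0 < k -> coupling e k.

Variables (f : bodies -> R) (M : R).
Hypotheses (f_cont : continuous f) (fM : forall y, `|f y| <= M).

Let M_ge0 : 0 <= M. Proof. exact: le_trans (normr_ge0 _) (fM point). Qed.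

(* As e decreases to 0, these open sets exhaust the space of the bodies: on one
   of large probability, [f] is nearly constant on the balls of radius e, and no
   tightness argument is needed. *)
Definition flat (k e : R) : set bodies := [set y | exists2 e', e < e' &
  forall z z', vclose e' y z -> vclose e' y z' -> `|f z - f z'| <= k].

Lemma open_flat k e : 0 <= e -> open (flat k e).
Proof.
move=> e0; apply: (open_uniform (Q := fun y r => forall z z', vclose r y z ->
  vclose r y z' -> `|f z - f z'| <= k)) => //.
  move=> y z r s h yz z1 z2 h1 h2; apply: h.
    by have := vclose_trans yz h1; rewrite addrC subrK.
  by have := vclose_trans yz h2; rewrite addrC subrK.
by move=> y r s sr h z z' h1 h2; apply: h; [exact: vclose_le h1|exact: vclose_le h2].
Qed.

Lemma flat_large k (e : R) : 0 < k -> 0 < e -> exists2 e0, 0 < e0 &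
  1 - e <= pr P' (Y @^-1` flat k e0).
Proof.
move=> k0 e0; pose i (n : nat) : R := n.+1%:R^-1.
have i0 n : 0 < i n by rewrite invr_gt0.
have mF n : measurable (Y @^-1` flat k (i n)).
  by apply: (preimage_measurable mY); apply: sub_sigma_algebra; exact: open_flat (ltW (i0 n)).
have ndF n n' : (n <= n')%N -> Y @^-1` flat k (i n) `<=` Y @^-1` flat k (i n').
  move=> nn o [e' ie h]; exists e' => //; apply: le_lt_trans ie.
  by rewrite /i lef_pV2 ?posrE ?ltr0n// ler_nat.
have PF : P' (\bigcup_n (Y @^-1` flat k (i n))) = 1%E.
  rewrite (_ : \bigcup_n _ = setT) ?probability_setT//; apply/seteqP; split=> // o _.
  have := @f_cont (Y o : bodies); move/cvgrPdist_lt => /(_ (k / 2)).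
  rewrite divr_gt0// => /(_ isT) /nbhs_bodiesP[e' e'0 he'].
  have [n ine] : exists n, i n < e'.
    exists (Num.truncn e'^-1); rewrite /i invf_plt ?posrE//; exact: truncnS_gt.
  exists n => //; exists e' => // z z' /he' h1 /he' h2.
  have -> : f z - f z' = (f (Y o) - f z') - (f (Y o) - f z) by ring.
  rewrite (le_trans (ler_normB _ _))// [leRHS]splitr lerD//; exact: ltW.
by have [n hn] := pr_bigcup_large mF ndF PF e0; exists (i n).
Qed.

Let bounded_comp dO1 (Om : measurableType dO1) (X : Om -> borel bodies) :
  measurable_fun setT X -> bounded_rv (f \o X).
Proof.
move=> mX; split; last by exists M => o; exact: fM.
exact: (measurableT_comp (continuous_measurable f_cont) mX).
Qed.

(** The discarded probability is at most [3 * k] on the limit side, from [G], the tables and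
    flatness, and at most [4 * k] on the other side for large [n]. One error [k] for the values on
    each side and one for the weights complete [3 + 7 * M]. *)
Lemma mean_coupling (k : R) : 0 < k -> exists N, forall n, (N <= n)%N ->
  `|mean P (f \o Y_ n) - mean P' (f \o Y)| <= k * (3 + 7 * M).
Proof.
move=> k0; have [e e0 he] := flat_large k0 k0.
have [F [A [A' [G [N [[mA tA mA' tA' mG] [cA kG kA c1 c2]]]]]]] := coupled e0 k0.
pose W := Y @^-1` flat k e.
have mW : measurable W.
  by apply: (preimage_measurable mY); apply: sub_sigma_algebra; exact: open_flat (ltW e0).
(* An index is kept only if its event contains an outcome in both [G] and [W]; [v c] is the value of
   [f] at one such outcome. *)
pose S c := `[< exists o, [/\ A' c o, G o & W o] >].
pose v c := if pselect (exists o, [/\ A' c o, G o & W o]) is left h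
  then f (Y (sval (cid h))) else 0.
pose A1 n c := if S c then A n c else set0.
pose A1' c := if S c then A' c else set0.
have mA1 n c : (N <= n)%N -> measurable (A1 n c).
  by rewrite /A1 => Nn; case: ifP => // _; exact: mA.
have mA1' c : measurable (A1' c) by rewrite /A1'; case: ifP.
have tA1 n : (N <= n)%N -> trivIset setT (A1 n).
  move=> Nn c c' _ _ [t []]; rewrite /A1; case: ifP => // _ h; case: ifP => // _ h'.
  by apply: (tA n Nn) => //; exists t.
have tA1' : trivIset setT A1'.
  move=> c c' _ _ [t []]; rewrite /A1'; case: ifP => // _ h; case: ifP => // _ h'.
  by apply: tA' => //; exists t.
have vP c : S c -> exists o, [/\ A' c o, G o, W o & v c = f (Y o)].
  move=> /asboolP h; rewrite /v; case: pselect => // h'.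
  by case: (cid h') => o /= [? ? ?]; exists o.
have close n c o' : (N <= n)%N -> A1 n c o' -> `|f (Y_ n o') - v c| <= k.
  rewrite /A1 => Nn; case: ifP => // /vP[x1 [Ao Go [e' ee' hf] ->]] Ao'.
  apply: hf; first exact: vclose_le (ltW ee') (c2 c n x1 o' Nn Ao Go Ao').
  by apply: vclose_refl; exact: lt_trans ee'.
have close' c o' : A1' c o' -> `|f (Y o') - v c| <= k.
  rewrite /A1'; case: ifP => // /vP[x1 [Ao Go [e' ee' hf] ->]] Ao'.
  apply: hf; first exact: vclose_le (ltW ee') (c1 c x1 o' Ao Go Ao').
  by apply: vclose_refl; exact: lt_trans ee'.
pose t' := \sum_c pr P' (A1' c); pose t n := \sum_c pr P (A1 n c).
pose s' := \sum_c v c * pr P' (A1' c); pose s n := \sum_c v c * pr P (A1 n c).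
have cA1 c : pr P (A1 n c) @[n --> \oo] --> pr P' (A1' c).
  rewrite /A1 /A1'; case: ifP => _; first exact: cA.
  by rewrite !pr0; exact: cvg_cst.
have ct : t n @[n --> \oo] --> t' by exact: cvg_sum_fin.
have cs : s n @[n --> \oo] --> s'.
  by apply: cvg_sum_fin => c; apply: cvgM => //; exact: cvg_cst.
have t'k : 1 - 3 * k <= t'.
  have mU : measurable (\bigcup_c A' c) by exact: fin_bigcup_measurable.
  have sub : ~` (\bigcup_c A1' c) `<=` ~` (\bigcup_c A' c) `|` (~` G `|` ~` W).
    move=> o h; have [[c _ Ac]|nA] := pselect ((\bigcup_c A' c) o); last by left.
    right; have [Go|nG] := pselect (G o); last by left.
    have [Wo|nW] := pselect (W o); last by right.
    exfalso; apply: h; exists c => //; rewrite /A1' ifT//; apply/asboolP.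
    by exists o.
  have mU1 : measurable (\bigcup_c A1' c) by exact: fin_bigcup_measurable.
  have mGW : measurable (~` G `|` ~` W) by apply: measurableU; exact: measurableC.
  have := prS P' (measurableC mU1) (measurableU _ _ (measurableC mU) mGW) sub.
  have := pr_setU_le P' (measurableC mU) mGW.
  have := pr_setU_le P' (measurableC mG) (measurableC mW).
  rewrite !prC// pr_bigcup_ord// pr_bigcup_ord// -/t'.
  move: he kG kA; rewrite -/W; lra.
have happrox n : (maxn N N0 <= n)%N ->
    `|mean P (f \o Y_ n) - s n| <= k + M * (1 - t n).
  rewrite geq_max => /andP[Nn N0n]; have bY := bounded_comp (mY_ N0n).
  have cl c o : A1 n c o -> `|(f \o Y_ n) o - v c| <= k by exact: close.
  exact: (mean_approx P bY (fun c => mA1 n c Nn) (tA1 n Nn) (ltW k0) cl (fun o => fM (Y_ n o))).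
have happrox' : `|mean P' (f \o Y) - s'| <= k + M * (1 - t').
  have bY := bounded_comp mY.
  by apply: (mean_approx P' bY mA1' tA1' (ltW k0) close') => o; exact: fM.
move/cvgrPdist_le : ct => /(_ k k0)[N1 _ hN1].
move/cvgrPdist_le : cs => /(_ k k0)[N2 _ hN2].
exists (maxn (maxn N N0) (maxn N1 N2)) => n; rewrite geq_max => /andP[Nn].
rewrite geq_max => /andP[N1n N2n].
have {hN1} h1 : `|t' - t n| <= k by exact: hN1.
have {hN2} h2 : `|s' - s n| <= k by exact: hN2.
have h3 := happrox n Nn.
have tn : 1 - t n <= 4 * k by move: h1; rewrite ler_norml => /andP[_]; lra.
have tn' : 1 - t' <= 3 * k by lra.
have m1 := ler_wpM2l M_ge0 tn; have m2 := ler_wpM2l M_ge0 tn'.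
move: h2 h3 happrox'; rewrite !ler_norml => /andP[? ?] /andP[? ?] /andP[? ?].
by apply/andP; split; lra.
Qed.

Lemma cvg_mean_coupling :
  ('E_P[f \o (Y_ n : Omega -> bodies)])%E @[n --> \oo] --> ('E_P'[f \o (Y : Omega' -> bodies)])%E.
Proof.
rewrite meanE; last exact: bounded_comp.
apply: (@cvg_trans _ ((mean P (f \o Y_ n))%:E @[n --> \oo])).
  apply: near_eq_cvg; exists N0 => // n /= N0n; rewrite meanE//.
  by apply: bounded_comp; exact: mY_.
apply: cvg_EFin; first by near=> n.
apply/cvgrPdist_le => e e0.
have c0 : 0 < 3 + 7 * M by rewrite ltr_pwDl// mulr_ge0.
have [N hN] := mean_coupling (divr_gt0 e0 c0).
exists N => // n /= Nn; rewrite distrC; have := hN n Nn.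
by rewrite divfK// gt_eqF.
Unshelve. all: by end_near.
Qed.

End coupling_law.

(** * Convergence of the peelings *)

Section almost_sure.
Context {R : realType} {dO : measure_display} {Omega : measurableType dO}.
Variable P : probability Omega R.

Lemma ae_full (A : set Omega) (Q : Omega -> Prop) : measurable A -> P A = 1%E ->
  (forall o, A o -> Q o) -> {ae P, forall o, Q o}.
Proof.
move=> mA PA AQ; exists (~` A); split; first exact: measurableC.
  exact: P_setC0.
by move=> o nQ Ao; apply: nQ; exact: AQ.
Qed.

Lemma pr_setI_full (A B : set Omega) : measurable A -> measurable B -> P B = 1%E ->
  pr P (A `&` B) = pr P A.
Proof.
move=> mA mB PB; have mI : measurable (A `&` B) by exact: measurableI.
have sub : A `<=` (A `&` B) `|` ~` B.
  by move=> o Ao; have [Bo|nB] := pselect (B o); [left|right].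
have mU : measurable ((A `&` B) `|` ~` B) by apply: measurableU => //; exact: measurableC.
have h : pr P A <= pr P (A `&` B).
  apply: (le_trans (prS P mA mU sub)).
  apply: (le_trans (pr_setU_le P mI (measurableC mB))).
  by rewrite [X in _ + X]/pr P_setC0//= addr0.
by apply/eqP; rewrite eq_le h andbT prS// => o [].
Qed.

End almost_sure.

Section random_segments.
Context {R : realType} {d : nat}.
Local Notation V := 'rV[R]_d.
Variable K : body0 R d.
Local Notation bV := (borel V).
Context {dO : measure_display} {Omega : measurableType dO}.
Variable tu : nat -> Omega -> measurableTypeR R * bV.
Hypothesis tu_dom : forall i o, 0 < (tu i o).1 /\ enorm ((tu i o).2 : V) = 1.
Hypothesis mtu : forall i, measurable_fun setT (tu i).
Variable m : nat.
Variables (q : nat) (w : 'I_q -> set bV).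
Hypothesis mw : forall i, measurable (w i) /\ sandwiched K (w i).
Hypothesis w_pos : forall u : V, enorm u = 1 -> exists i, 0 < sarea K (w i) /\
  forall u', w i u' -> 4^-1 < dot u' u.
Local Notation good := (good_points K tu m w).
Local Notation bodies := {ptws 'I_m -> body0 R d}.

Definition points (o : Omega) : nat -> R * V := fun i => tu i o.

(** Only finitely many times are below 1, and each of them is positive. *)
Lemma good_lower o : good o -> exists2 delta, 0 < delta & forall i, delta <= (points o i).1.
Proof.
move=> go; have [s Es] := (finite_seqP _).1 (good_points_finite tu_dom 1 go).
have [delta d0 hd] : exists2 delta : R, 0 < delta & forall i, i \in s -> delta <= (tu i o).1.
  elim: s {Es} => [|i s [delta d0 hd]]; first by exists 1.
  exists (Num.min delta (tu i o).1); first by rewrite lt_min d0 (tu_dom i o).1.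
  by move=> j; rewrite inE ge_min => /orP[/eqP ->|/hd ->//]; rewrite lexx orbT.
exists (Num.min 1 delta) => [|i]; first by rewrite lt_min ltr01.
have [i1|i1] := ltP (points o i).1 1; last by rewrite ge_min i1.
have si : i \in s by have : [set i | (tu i o).1 < 1] i := i1; rewrite Es.
by rewrite ge_min hd// orbT.
Qed.

Lemma deep_event_deep o (T : R) : 0 < T -> deep_event K tu m w T o ->
  deep ((4 * T)^-1) setT (segments (points o)) m.
Proof.
move=> T0 dT; apply: (@segments_deep _ _ _ T q w (fun i => 0 < sarea K (w i))) => //.
by move=> i; exact: (tu_dom i o).1.
Qed.

Lemma good_deep o : good o -> exists2 rho, 0 < rho & deep rho setT (segments (points o)) m.
Proof.
move=> [_ [T _ dT]]; exists (4 * T.+1%:R)^-1; first by rewrite invr_gt0 mulr_gt0.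
by apply: deep_event_deep => //; apply: deep_eventS dT; rewrite ler_nat.
Qed.

Lemma points_dom o (delta : R) : (forall i, delta <= (points o i).1) ->
  forall i, delta <= (points o i).1 /\ enorm (points o i).2 = 1.
Proof. by move=> h i; split=> //; exact: (tu_dom i o).2. Qed.

Definition zero_vector (o : Omega) : borel bodies :=
  if `[< good o >] then segment_vector m (points o) else point.

Lemma zero_vectorE o : good o -> zero_vector o = segment_vector m (points o).
Proof. by move=> go; rewrite /zero_vector asboolT. Qed.

Lemma measurable_pole_points i : measurable_fun setT (fun o => pole (points o i) : bV).
Proof.
have m1 : measurable_fun setT (fun o => (tu i o).1 : measurableTypeR R).
  exact: (measurableT_comp measurable_fst (mtu i)).
have m2 : measurable_fun setT (fun o => (tu i o).2 : bV).
  exact: (measurableT_comp measurable_snd (mtu i)).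
apply: measurable_rV => j; under eq_fun do rewrite mxE.
apply: measurable_funM; last exact: (measurableT_comp (measurable_coord (R := R) j) m2).
(* Times are positive, so the inverse is a composition of the measurable functions [ln] and
   [expR]. *)
have -> : (fun o => (points o i).1^-1) = (fun o => expR (- ln (tu i o).1)).
  by apply/funext => o; rewrite expRN lnK// posrE; exact: (tu_dom i o).1.
have m3 := measurableT_comp (@measurable_ln R) m1.
exact: (measurableT_comp (@measurable_expR R) (measurable_funN m3)).
Qed.

Lemma measurable_zero_vector : measurable good -> measurable_fun setT zero_vector.
Proof.
move=> mg; apply: (@measurable_discrete_limit _ _ _ _ _ (fun i o => pole (points o i)) id
  (fun k x' => (fun r => to_body (core `I_k (fun i => segment 0 (x' i)) r.+1)) : bodies)
  (fun o => segment_vector m (points o))) => //; first exact: measurable_pole_points.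
move=> o e go e0; have [delta d0 hd] := good_lower go; have [rho r0 hr] := good_deep go.
apply: (segment_vector_limit r0 d0 (points_dom hd) _ hr e0) => T.
exact: (good_points_finite tu_dom T go).
Qed.

Lemma pole_inj o : good o -> injective (pole \o points o).
Proof.
move=> go i j /= E; apply: (good_points_inj go).
have := congr1 enorm E; have [ti ui] := tu_dom i o; have [tj uj] := tu_dom j o.
by rewrite !enorm_pole//; exact: invr_inj.
Qed.

Lemma zero_vector_core o (r : 'I_m) : good o ->
  body_set (zero_vector o r) = core setT (segments (points o)) r.+1.
Proof.
move=> go; rewrite zero_vectorE//.
have [delta d0 hd] := good_lower go; have [rho r0 hr] := good_deep go.
exact: (body_segment_vector r r0 d0 (points_dom hd) hr).
Qed.

Lemma peeling_points o r : good o ->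
  peeling [set (tu i o).1^-1 *: ((tu i o).2 : V) | i in [set: nat]] (fun x => segment 0 x) r =
  core setT (segments (points o)) r.
Proof.
move=> go; have inj : {in [set: nat] &, injective (pole \o points o)}.
  by move=> i j _ _; exact: pole_inj.
rewrite -(core_image (fun x : V => segment 0 x) r inj).
apply: peelingE; first by move=> x _; exact: segment0.
apply: (@card_le_inj _ _ _ _ (pole \o points o)) => [i j _ _|i _]; first exact: pole_inj.
by exists i.
Qed.

End random_segments.

Section random_polars.
Context {R : realType} {d : nat}.
Local Notation V := 'rV[R]_d.
Variable K : body0 R d.
Local Notation bV := (borel V).
Context {dO : measure_display} {Omega : measurableType dO}.
Variable xi : nat -> Omega -> bV.
Hypothesis xi_meas : forall i, measurable_fun setT (xi i).
Variable m : nat.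
Local Notation bodies := {ptws 'I_m -> body0 R d}.
Local Notation proper := (all_proper K xi).

Definition sample_vector (n : nat) (o : Omega) : borel bodies :=
  if `[< proper o >] then polar_vector K m n (fun i => xi i o) else point.

Lemma sample_vectorE n o : proper o -> sample_vector n o = polar_vector K m n (fun i => xi i o).
Proof. by move=> po; rewrite /sample_vector asboolT. Qed.

Lemma measurable_sample_vector n : (m < n)%N -> measurable_fun setT (sample_vector n).
Proof.
move=> mn; apply: (@measurable_discrete_limit _ _ _ _ _ xi (fun=> n)
  (fun k x' => polar_vector K m n x' : bodies) (fun o => polar_vector K m n (fun i => xi i o))).
- exact: xi_meas.
- exact: measurable_all_proper.
move=> o e po e0; apply: (polar_vector_limit mn _ e0) => i _.
exact: (po i Logic.I).2.
Qed.

Lemma sample_vector_core n o (r : 'I_m) : (m < n)%N -> proper o ->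
  body_set (sample_vector n o r) = core `I_n (fun i => polar_shift K n (xi i o)) r.+1.
Proof.
move=> mn po; rewrite sample_vectorE//; apply: body_polar_vector => // i _.
exact: (po i Logic.I).2.
Qed.

Lemma peeling_samples n o (r : 'I_m) : (m < n)%N -> proper o ->
  peeling `I_n (fun i => dilate n%:R^-1 (polar (translate (- (xi i o : V)) K))) r.+1 =
  core `I_n (fun i => polar_shift K n (xi i o)) r.+1.
Proof.
move=> mn po; have n0 : (0 < n)%N by exact: leq_ltn_trans mn.
apply: peelingE; last by rewrite card_le_II; apply: leq_trans mn; rewrite ltnS ltn_ord.
move=> i _; have [b b0 hb] := polar_shift_ball K; apply: hb => //.
  exact: ltW (po i Logic.I).2.
by rewrite enorm0 divr_ge0// ltW.
Qed.

End random_polars.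

(** * Events of equal counts for the sample and the Poisson points *)

Section main_coupling.
Context {R : realType} {d : nat}.
Local Notation V := 'rV[R]_d.
Variable K : body0 R d.
Hypothesis d_gt0 : (0 < d)%N.
Hypothesis K_regular : regular K.
Local Notation bV := (borel V).
Context {dO dO' : measure_display} {Omega : measurableType dO} {Omega' : measurableType dO'}.
Variables (P : probability Omega R) (P' : probability Omega' R).
Variable xi : nat -> Omega -> bV.
Hypothesis xi_meas : forall i, measurable_fun setT (xi i).
Hypothesis xi_indep : mutually_independent P xi.
Hypothesis xi_unif : forall i, uniformly_distributed P K (xi i).
Variable tu : nat -> Omega' -> measurableTypeR R * bV.
Hypothesis tu_dom : forall i o, 0 < (tu i o).1 /\ enorm ((tu i o).2 : V) = 1.
Hypothesis tu_poisson : poisson_process P' (intensity K) tu.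
Variable m : nat.
Variables (q : nat) (w : 'I_q -> set bV).
Hypothesis mw : forall i, measurable (w i) /\ sandwiched K (w i).
Hypothesis w_pos : forall u : V, enorm u = 1 -> exists i, 0 < sarea K (w i) /\
  forall u', w i u' -> 4^-1 < dot u' u.
Local Notation good := (good_points K tu m w).
Local Notation proper := (all_proper K xi).
Local Notation bodies := {ptws 'I_m -> body0 R d}.

Let K_fin : (volume K < +oo)%E := (volume_fin_gt0 xi_unif).1.
Let K_gt0 : 0 < fine (volume K) := (volume_fin_gt0 xi_unif).2.

Let mgood : measurable good := measurable_good_points tu_poisson m mw.
Let Pgood : P' good = 1%E :=
  P_good_points d_gt0 K_regular K_fin K_gt0 tu_dom tu_poisson m mw.
Let mproper : measurable proper := measurable_all_proper K xi_meas.
Let Pproper : P proper = 1%E.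
Proof. by apply: P_setC1 => //; exact: all_proper_negligible. Qed.

Definition late (delta : R) : set Omega' := [set o | forall i, delta <= (tu i o).1].

Lemma measurable_late delta : measurable (late delta).
Proof.
rewrite (_ : late delta = \bigcap_i [set o | delta <= (tu i o).1]); last first.
  by apply/seteqP; split=> o h i; [move=> _; exact: h|exact: (h i Logic.I)].
apply: bigcapT_measurable => i.
have mt : measurable_fun setT (fun o => (tu i o).1 : measurableTypeR R).
  exact: (measurableT_comp measurable_fst (tu_poisson.1 i)).
have := preimage_measurable mt (@measurable_itv R `[delta, +oo[).
by congr measurable; apply/seteqP; split=> o /=; rewrite in_itv/= andbT.
Qed.

Lemma P_full (A : set Omega') : measurable A -> good `<=` A -> P' A = 1%E.
Proof.
move=> mA gA; apply/eqP; rewrite eq_le probability_le1//= -Pgood.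
by apply: le_measure; rewrite ?inE.
Qed.

Lemma late_ex (k : R) : 0 < k -> exists2 delta, 0 < delta & 1 - k <= pr P' (late delta).
Proof.
move=> k0; pose U (n : nat) := late n.+1%:R^-1.
have ndU n n' : (n <= n')%N -> U n `<=` U n'.
  move=> nn o h i; apply: le_trans (h i).
  by rewrite lef_pV2 ?posrE ?ltr0n// ler_nat.
have PU : P' (\bigcup_n U n) = 1%E.
  apply: P_full; first by apply: bigcupT_measurable => n; exact: measurable_late.
  move=> o /(good_lower tu_dom)[delta d0 hd].
  exists (Num.truncn delta^-1) => // i; apply: le_trans (hd i).
  by rewrite invf_ple ?posrE//; exact: ltW (truncnS_gt _).
have [n hn] := pr_bigcup_large (fun n => measurable_late _) ndU PU k0.
by exists n.+1%:R^-1.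
Qed.

Lemma deep_ex (k : R) : 0 < k -> exists2 T, 0 < T & 1 - k <= pr P' (deep_event K tu m w T).
Proof.
move=> k0; pose U (n : nat) := deep_event K tu m w n%:R.
have mU n : measurable (U n) by exact: (measurable_deep_event tu_poisson).
have ndU n n' : (n <= n')%N -> U n `<=` U n'.
  by move=> nn; apply: deep_eventS; rewrite ler_nat.
have PU : P' (\bigcup_n U n) = 1%E by exact: deep_event_large.
have [n hn] := pr_bigcup_large mU ndU PU k0.
(* [n] may be 0; the successor makes [T] positive and only enlarges the event. *)
exists n.+1%:R => //; apply: le_trans hn _; apply: prS => //.
- exact: (measurable_deep_event tu_poisson).
- exact: ndU.
Qed.

Section cells.
Variables (q1 : nat) (a b : 'I_q1.+1 -> R) (v : 'I_q1.+1 -> set bV).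
Hypothesis hv : forall i, [/\ 0 <= a i, a i <= b i, measurable (v i) & sandwiched K (v i)].
Local Notation B := (fun i => tcell (a i) (b i) (v i)).
Hypothesis tB : trivIset setT B.

Let mB j : measurable (B j). Proof. by have [_ _ mv _] := hv j; exact: measurable_tcell. Qed.

(** A uniform bound on the counts, so that the tables of counts form a finite type. *)
Definition counted (n : nat) : set Omega' :=
  [set o | forall j, exists2 k, (k <= n)%N & has_count tu (B j) k o].

Lemma counted_ex (k : R) : 0 < k -> exists n, 1 - k <= pr P' (counted n).
Proof.
move=> k0; have mU n : measurable (counted n).
  rewrite (_ : counted n = \bigcap_j \bigcup_(k in [set k | (k <= n)%N]) has_count tu (B j) k).
    apply: fin_bigcap_measurable => // j _; apply: bigcup_measurable => l _.
    exact: (measurable_has_count tu_poisson).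
  apply/seteqP; split=> o h j; first by move=> _; have [l ln hl] := h j; exists l.
  by have [l ln hl] := h j Logic.I; exists l.
have ndU n n' : (n <= n')%N -> counted n `<=` counted n'.
  by move=> nn o h j; have [l ln hl] := h j; exists l => //; exact: leq_trans nn.
apply: (pr_bigcup_large mU ndU _ k0).
apply: P_full; first exact: bigcupT_measurable.
move=> o go; have h j : exists l, has_count tu (B j) l o.
  have fB : finite_set [set i | B j (tu i o)].
    apply: sub_finite_set (good_points_finite tu_dom (b j) go).
    by move=> i [].
  exact/finite_setP.
pose f j := sval (cid (h j)); exists (\max_j f j)%N => // j.
by exists (f j); [exact: (leq_bigmax j)|exact: (svalP (cid (h j)))].
Qed.

Lemma total_same_counts (c : 'I_q1.+1 -> nat) o o' : total_event tu B c o ->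
  total_event tu B c o' -> same_counts a b v setT setT (points tu o) (points tu o').
Proof.
move=> h h' j; have E (p : nat -> R * V) : [set i | setT i /\ B j (p i)] = [set i | B j (p i)].
  by apply/seteqP; split=> i // [].
by rewrite !E; apply: card_eq_trans (h j) _; rewrite card_eq_sym; exact: h'.
Qed.

Lemma sample_counts n (c : 'I_q1.+1 -> nat) o : proper o ->
  count_event xi (scells K a b v n) n c o ->
  forall j, ([set i | `I_n i /\ B j (tag K n (xi i o))] #= `I_(c j))%card.
Proof.
move=> po h j; have := (card_countP n (c j) (fun i => `[< scells K a b v n j (xi i o) >])).2 (h j).
suff -> : [set i | (i < n)%N /\ `[< scells K a b v n j (xi i o) >]] =
  [set i | `I_n i /\ B j (tag K n (xi i o))] by [].
apply/seteqP; split=> i [ni]; first by move=> /asboolP[].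
by move=> Bj; split=> //; apply/asboolP; split=> //; exact: (po i Logic.I).1.
Qed.

Lemma sample_same_counts n (c : 'I_q1.+1 -> nat) o o' : total_event tu B c o ->
  proper o' -> count_event xi (scells K a b v n) n c o' ->
  same_counts a b v setT `I_n (points tu o) (fun i => tag K n (xi i o')).
Proof.
move=> h po h' j; have -> : [set i | setT i /\ B j (points tu o i)] = [set i | B j (tu i o)].
  by apply/seteqP; split=> i // [].
by apply: card_eq_trans (h j) _; rewrite card_eq_sym; exact: sample_counts.
Qed.

Variable A : nat.
Implicit Types c : {ffun 'I_q1.+1 -> 'I_A.+1}.

(* The cell [ord0] is the time interval from 0 to delta; requiring it to be empty
   bounds the segments by [delta^-1]. *)
Definition zero_count c : set Omega' :=
  if c ord0 == ord0 then total_event tu B (fun j => c j) `&` good else set0.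

Definition sample_count n c : set Omega :=
  if c ord0 == ord0 then count_event xi (scells K a b v n) n (fun j => c j) `&` proper
  else set0.

Lemma measurable_zero_count c : measurable (zero_count c).
Proof.
rewrite /zero_count; case: ifP => // _; apply: measurableI => //.
exact: (measurable_total_event tu_poisson).
Qed.

Lemma trivIset_zero_count : trivIset setT zero_count.
Proof.
move=> c c' _ _ [t []]; rewrite /zero_count; case: ifP => // _ [h _]; case: ifP => // _ [h' _].
by apply/ffunP => j; apply: val_inj; exact: (has_count_inj (h j) (h' j)).
Qed.

Lemma trivIset_sample_count n : trivIset setT (sample_count n).
Proof.
move=> c c' _ _ [t []]; rewrite /sample_count; case: ifP => // _ [h _]; case: ifP => // _ [h' _].
by apply/ffunP => j; apply: val_inj; rewrite /= -(h j) -(h' j).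
Qed.

Lemma sample_count_limit : exists N, (forall n c, (N <= n)%N -> measurable (sample_count n c)) /\
  forall c, pr P (sample_count n c) @[n --> \oo] --> pr P' (zero_count c).
Proof.
have a0 j : 0 <= a j by have [] := hv j.
have ab j : a j <= b j by have [] := hv j.
have mv j : measurable (v j) by have [] := hv j.
have [N [mS lS]] := count_limit d_gt0 K_regular xi_meas xi_indep xi_unif a0 ab mv tB.
have mc n (c : 'I_q1.+1 -> nat) : (N <= n)%N -> measurable (count_event xi (scells K a b v n) n c).
  move=> Nn; apply: measurable_count_event => //; first by move=> j; exact: mS.
  exact: trivIset_scells.
exists N; split=> [n c Nn|c]; rewrite /sample_count /zero_count; case: ifP => _ //.
  by apply: measurableI => //; exact: mc.
  rewrite pr_setI_full//; last exact: (measurable_total_event tu_poisson).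
  rewrite (@pr_total_event _ _ _ _ _ _ _ _ tu_poisson _ _ _ (fun j => rate K (a j) (b j) (v j)))//; last 2 first.
  - by move=> j; exact: rate_ge0.
  - by move=> j; have [_ _ _ sv] := hv j; rewrite intensity_tcell.
  apply: (@cvg_eventually _ _ _ _ N _ (lS (fun j => c j))) => n Nn.
  by rewrite pr_setI_full//; exact: mc.
by rewrite !pr0; exact: cvg_cst.
Qed.

Variables (delta : R).
Hypotheses (delta_gt0 : 0 < delta) (B0 : B ord0 = tcell 0 delta setT).

(** A good outcome without early points and with bounded counts belongs to the event of its own
    table; the other outcomes are charged to [late] and [counted]. *)
Lemma sum_zero_count (k k' : R) : 1 - k <= pr P' (late delta) ->
  1 - k' <= pr P' (counted A) -> 1 - (k + k') <= \sum_c pr P' (zero_count c).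
Proof.
move=> hk hk'; rewrite -pr_bigcup_ord//; last 2 first.
- exact: measurable_zero_count.
- exact: trivIset_zero_count.
have mU : measurable (\bigcup_c zero_count c).
  by apply: fin_bigcup_measurable => // c _; exact: measurable_zero_count.
have mL := measurable_late delta.
have mC : measurable (counted A).
  rewrite (_ : counted A = \bigcap_j \bigcup_(k in [set k | (k <= A)%N]) has_count tu (B j) k).
    apply: fin_bigcap_measurable => // j _; apply: bigcup_measurable => l _.
    exact: (measurable_has_count tu_poisson).
  apply/seteqP; split=> o h j; first by move=> _; have [l ln hl] := h j; exists l.
  by have [l ln hl] := h j Logic.I; exists l.
have sub : ~` (\bigcup_c zero_count c) `<=` ~` late delta `|` (~` counted A `|` ~` good).
  move=> o h; have [lo|] := pselect (late delta o); last by left.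
  right; have [co|] := pselect (counted A o); last by left.
  right=> go; apply: h; have hc j := cid2 (co j).
  pose c : {ffun 'I_q1.+1 -> 'I_A.+1} := [ffun j => inord (s2val (hc j))].
  have cE j : c j = s2val (hc j) :> nat by rewrite ffunE inordK// ltnS; exact: (s2valP (hc j)).
  exists c => //; rewrite /zero_count ifT; first by split=> // j; rewrite cE; exact: (s2valP' (hc j)).
  apply/eqP/val_inj; rewrite /= cE; apply: (@has_count_inj _ _ _ _ tu (B ord0) _ _ o).
    exact: (s2valP' (hc ord0)).
  rewrite /has_count/= II0 card_eq0; apply/eqP; rewrite -subset0 => i.
  have := B0; rewrite /= => -> [_ /= tl _].
  by have := lo i; rewrite leNgt tl.
have mCG : measurable (~` counted A `|` ~` good) by apply: measurableU; exact: measurableC.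
have h1 := prS P' (measurableC mU) (measurableU _ _ (measurableC mL) mCG) sub.
have h2 := pr_setU_le P' (measurableC mL) mCG.
have h3 := pr_setU_le P' (measurableC mC) (measurableC mgood).
have h4 : pr P' (~` good) = 0 by rewrite /pr P_setC0.
rewrite !prC// in h1 h2 h3 *; move: h1 h2 h3 h4; rewrite prC//; lra.
Qed.

End cells.

End main_coupling.

Section peeling_convergence.
Context {R : realType} {d : nat}.
Local Notation V := 'rV[R]_d.
Variable K : body0 R d.
Hypothesis d_gt0 : (0 < d)%N.
Hypothesis K_regular : regular K.
Local Notation bV := (borel V).
Context {dO dO' : measure_display} {Omega : measurableType dO} {Omega' : measurableType dO'}.
Variables (P : probability Omega R) (P' : probability Omega' R).
Variable xi : nat -> Omega -> bV.
Hypothesis xi_meas : forall i, measurable_fun setT (xi i).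
Hypothesis xi_indep : mutually_independent P xi.
Hypothesis xi_unif : forall i, uniformly_distributed P K (xi i).
Variable tu : nat -> Omega' -> measurableTypeR R * bV.
Hypothesis tu_dom : forall i o, 0 < (tu i o).1 /\ enorm ((tu i o).2 : V) = 1.
Hypothesis tu_poisson : poisson_process P' (intensity K) tu.
Variable m : nat.
Variables (q : nat) (w : 'I_q -> set bV).
Hypothesis mw : forall i, measurable (w i) /\ sandwiched K (w i).
Hypothesis w_pos : forall u : V, enorm u = 1 -> exists i, 0 < sarea K (w i) /\
  forall u', w i u' -> 4^-1 < dot u' u.
Local Notation good := (good_points K tu m w).
Local Notation proper := (all_proper K xi).
Local Notation bodies := {ptws 'I_m -> body0 R d}.

Let K_fin : (volume K < +oo)%E := (volume_fin_gt0 xi_unif).1.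

(** Order of the choices: [T] for depth and [delta] for the bound come from [k]; they fix [rho] and
    [M0], then the tolerance [e1], then the horizon [M] and the cells, and last the bound [A] on the
    counts. *)
Lemma vectors_coupling (e k : R) : 0 < e -> 0 < k ->
  coupling P P' (sample_vector K xi (m := m)) (zero_vector K tu w (m := m)) e k.
Proof.
move=> e0 k0; have k2 : 0 < k / 2 by rewrite divr_gt0.
have [T T0 hT] := deep_ex d_gt0 K_regular xi_unif tu_poisson m mw k0.
have [delta delta0 hdelta] :=
  late_ex d_gt0 K_regular xi_unif tu_dom tu_poisson m mw k2.
have [C C0 HC] := polar_shift_level_bound K.
(* Half the depth given by [deep_event], as [hausdorff_core] asks for twice [rho]. *)
pose rho := (4 * T)^-1 / 2; have rho0 : 0 < rho by rewrite divr_gt0// invr_gt0 mulr_gt0.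
pose M0 := Num.max delta^-1 (C / delta).
have M00 : 0 < M0 by rewrite lt_max invr_gt0 delta0.
(* The Hausdorff distance will be at most [e1 / rho * M0], hence below [e]. *)
pose e1 := Num.min rho (e / 2 * rho / M0).
have e10 : 0 < e1 by rewrite lt_min rho0 divr_gt0// mulr_gt0// divr_gt0.
(* The last two terms exceed the times of all segments and polars that can pass a level [e1]; the
   first keeps [delta < M]. *)
pose M := Num.max (2 * delta) (Num.max e1^-1 (C / e1)).
have dM : delta < M by rewrite lt_max; apply/orP; left; lra.
have eM : e1^-1 <= M by rewrite !le_max lexx orbT.
have CM : C / e1 <= M by rewrite !le_max lexx !orbT.
have e12 : 0 < e1 / 2 by rewrite divr_gt0.
have [q1 [a [b [v [hv tB B0 cover osc]]]]] :=
  tcells_ex d_gt0 K_fin K_regular delta0 dM e12.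
have [A hA] := counted_ex d_gt0 K_regular xi_unif tu_dom tu_poisson m mw hv k2.
have [N1 [mS lS]] := sample_count_limit d_gt0 K_regular xi_meas xi_indep xi_unif
  tu_dom tu_poisson m mw hv tB A.
have [N2 HN2] := polar_segments_dominated K_regular delta0 e10 tB cover osc CM HC.
have ee : e1 / rho * M0 < e.
  apply: (@le_lt_trans _ _ (e / 2)).
    by rewrite mulrAC ler_pdivrMr// -ler_pdivlMr// ge_min lexx orbT.
  by rewrite ltr_pdivrMr// ltr_pMr// ltr1n.
have er : e1 <= rho by rewrite ge_min lexx.
have rr : rho + rho = (4 * T)^-1 by rewrite /rho -splitr.
have zero_facts c o : zero_count K tu m w a b v (A := A) c o ->
    [/\ good o, total_event tu (fun i => tcell (a i) (b i) (v i)) (fun j => c j) o &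
        forall i, delta <= (points tu o i).1].
  rewrite /zero_count; case: ifP => // /eqP c0 [h go]; split=> //.
  have ud : unit_dir (points tu o) setT by move=> i _; exact: tu_dom.
  have h0 : ([set i | setT i /\ tcell (a ord0) (b ord0) (v ord0) (points tu o i)] #= `I_0)%card.
    rewrite (_ : [set i | _] = [set i | tcell (a ord0) (b ord0) (v ord0) (tu i o)]).
      by have := h ord0; rewrite c0.
    by apply/seteqP; split=> i // [].
  by move=> i; exact: (empty_first B0 ud h0 Logic.I).
exists {ffun 'I_q1.+1 -> 'I_A.+1}, (fun n c => sample_count K xi a b v (A := A) n c),
  (zero_count K tu m w a b v (A := A)), (deep_event K tu m w T), (maxn N1 (maxn N2 m.+1)).
split; split.
- by move=> n c; rewrite geq_max => /andP[N1n _]; exact: mS.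
- by move=> n _; exact: trivIset_sample_count.
- exact: (measurable_zero_count tu_poisson m mw hv tB).
- exact: trivIset_zero_count.
- exact: (measurable_deep_event tu_poisson).
- exact: lS.
- exact: hT.
- rewrite [k in 1 - k]splitr.
  exact: (sum_zero_count d_gt0 K_regular xi_unif tu_dom tu_poisson m mw hv tB B0 hdelta hA).
- move=> c o o' /zero_facts[go ho lo] dT /zero_facts[go' ho' lo'].
  rewrite !zero_vectorE//.
  have ud : unit_dir (points tu o) setT by move=> i _; exact: tu_dom.
  have ud' : unit_dir (points tu o') setT by move=> i _; exact: tu_dom.
  have sc := total_same_counts ho ho'.
  have bd o1 : (forall i, delta <= (points tu o1 i).1) ->
      forall i y, setT i -> segments (points tu o1) i y -> enorm y <= M0.
    move=> l i y Ii h; rewrite le_max; apply/orP; left.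
    exact: (segments_bound delta0 (points_dom tu_dom l) Ii h).
  apply: (segment_vector_vclose rho0 (ltW M00) (ltW e10) er ee _ (bd o lo) (bd o' lo')) => //.
  + by rewrite rr; exact: deep_event_deep dT.
  + exact: (segments_dominated e10 eM tB cover osc ud ud' sc lo).
  + exact: (segments_dominated e10 eM tB cover osc ud' ud (same_counts_sym sc) lo').
- move=> c n o o'; rewrite !geq_max => /and3P[N1n N2n mn] /zero_facts[go ho lo] dT.
  rewrite /sample_count; case: ifP => // /eqP c0 [ho' po].
  rewrite zero_vectorE// sample_vectorE//.
  have n0 : (0 < n)%N by exact: leq_ltn_trans mn.
  have ud : unit_dir (points tu o) setT by move=> i _; exact: tu_dom.
  have px i : (i < n)%N -> proper_point K (xi i o') by move=> _; exact: (po i Logic.I).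
  have ud' : unit_dir (fun i => tag K n (xi i o')) `I_n.
    move=> i ni; split; first by apply: tag_gt0 => //; exact: px.
    by apply: enorm_gdir; exact: (px i ni).1.
  have sc := sample_same_counts ho po ho'.
  have h0 : ([set i | `I_n i /\ tcell (a ord0) (b ord0) (v ord0) (tag K n (xi i o'))]
      #= `I_0)%card by have := sample_counts po ho' ord0; rewrite c0.
  have lo' i : (i < n)%N -> delta <= (tag K n (xi i o')).1.
    by move=> ni; exact: (empty_first B0 ud' h0 ni).
  apply: (segment_vector_vclose rho0 (ltW M00) (ltW e10) er ee (I' := `I_n)
    (L' := fun i => polar_shift K n (xi i o'))) => //.
  + by rewrite rr; exact: deep_event_deep dT.
  + move=> i y Ii h; rewrite le_max; apply/orP; left.
    exact: (segments_bound delta0 (points_dom tu_dom lo) Ii h).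
  + move=> i y ni h; rewrite le_max; apply/orP; right.
    exact: (polar_shift_tag_bound delta0 C0 HC n0 (px i ni) (lo' i ni) h).
  + exact: (segments_polar_dominated e10 eM tB cover osc n0 px ud sc lo).
  + exact: (HN2 n _ _ N2n n0 px ud (same_counts_sym sc) lo').
Qed.

End peeling_convergence.

(** * Wrappings *)

Section wrapping_polar.
Context {R : realType} {d : nat}.
Local Notation V := 'rV[R]_d.
Local Notation body := (body0 R d).

Lemma polar_bigcup (T : Type) (I : set T) (B : T -> set V) :
  polar (\bigcup_(i in I) B i) = \bigcap_(i in I) polar (B i).
Proof.
apply/seteqP; split=> y h; first by move=> i Ii x Bx; apply: h; exists i.
by move=> x [i Ii Bx]; exact: (h i Ii).
Qed.

(** Polarity exchanges unions and intersections, and the wrapping and the hulls after removal of [J]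
    are their own bipolars. These need the origin: a hull contains it because more than [r] members
    leave one outside [J]. *)
Lemma wrappingE (T : eqType) (I : set T) (B : T -> set V) r :
  (forall i, I i -> B i 0) -> (`I_r.+1 #<= I)%card ->
  wrapping I (fun i => polar (B i)) r = polar (peeling I B r).
Proof.
move=> B0 Ir; rewrite /wrapping /peeling.
set JJ := [set J | _]; pose C (J : set T) := closed_conv (\bigcup_(i in I `\` J) B i).
have -> : (fun J => \bigcap_(i in I `\` J) polar (B i)) = (fun J => polar (C J)).
  by apply/funext => J; rewrite /C polar_closed_conv polar_bigcup.
have C0 J : JJ J -> C J 0.
  move=> [JI Jr]; apply: sub_closed_conv.
  have [[i [Ii nJ]]|nI] := pselect (exists i, I i /\ ~ J i); first by exists i => //; exact: B0.
  have IJ : I `<=` J.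
    by move=> i Ii; have [//|nJ] := pselect (J i); case: nI; exists i.
  have := card_le_trans Ir (subset_card_le IJ); rewrite (card_le_eqr Jr) card_le_II.
  by rewrite ltnn.
have [J1 J1J] : exists J, JJ J.
  have r0 : (`I_0 #<= I)%card by apply: card_le_trans Ir; rewrite card_le_II.
  have [|||J [_ JI Jr]] := @card_extend T set0 I 0 r _ _ _ Ir => //.
    by rewrite II0.
  by exists J.
set W := closed_conv _.
have W0 : W 0 by apply: sub_closed_conv; exists J1 => // x _; rewrite dotC dot0l.
rewrite -[LHS](bipolar (@closed_conv_closed _ _ _) (@closed_conv_convex _ _ _) W0).
rewrite polar_closed_conv polar_bigcup; congr polar.
apply: eq_bigcapr => J JJJ; apply: bipolar.
- exact: closed_conv_closed.
- exact: closed_conv_convex.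
- exact: C0.
Qed.

Lemma polar_int0 (K : body) : interior (polar K) 0.
Proof.
have [B B0 KB] := body_bound K; apply/nbhs_enormP; exists B^-1; first by rewrite invr_gt0.
move=> y; rewrite subr0 => yB x Kx; rewrite (le_trans (cauchy_schwarz _ _))//.
by rewrite -(mulfV (lt0r_neq0 B0)) ler_pM ?enorm_ge0// ?KB// ltW.
Qed.

Definition polar_body (K : body) : body :=
  Body0 (polar_compact K) (@polar_convex _ _ K) (polar_int0 K).

Lemma hausdorff_approx (K L : body) (e : R) x : hausdorff_dist K L < e ->
  body_set K x -> exists2 y, body_set L y & enorm (x - y) < e.
Proof.
move=> KL Kx; have : dist_to x L < e.
  by apply: le_lt_trans KL; rewrite (le_trans (excess_ge L Kx))// le_max lexx.
move=> /inf_lt; case=> [|_ [y Ly <-] xy]; last by exists y.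
by exists (enorm (x - 0)), 0 => //; exact: body_in0.
Qed.

(** Dividing a point of the polar of [K] by [1 + e * M] puts it in the polar of [L], as the points
    of [L] are within [e] of [K]. *)
Lemma polar_body_excess (K L : body) (e M : R) : 0 <= e -> hausdorff_dist K L < e ->
  (forall y, polar K y -> enorm y <= M) -> 0 <= M ->
  excess (polar_body K) (polar_body L) <= e * M * M.
Proof.
move=> e0 KL KM M0; have k1 : 1 <= 1 + e * M by rewrite lerDl mulr_ge0.
have k0 : 0 < 1 + e * M by exact: lt_le_trans k1.
have -> : e * M * M = (1 + e * M - 1) * M by ring.
apply: excess_scale => // y Ky x Lx.
have LK : hausdorff_dist L K < e by rewrite hausdorff_sym.
have [z Kz xz] := hausdorff_approx LK Lx.
rewrite dotZr mulrC ler_pdivrMr// mul1r.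
have -> : x = z + (x - z) by rewrite addrC subrK.
rewrite dotDl lerD//; first exact: Ky.
by rewrite (le_trans (cauchy_schwarz _ _))// ler_pM ?enorm_ge0// ?(ltW xz)// KM.
Qed.

Lemma polar_body_continuous (K : body) (e : R) : 0 < e -> exists2 r, 0 < r &
  forall L : body, hausdorff_dist K L < r -> hausdorff_dist (polar_body K) (polar_body L) < e.
Proof.
move=> e0; have [b b0 bK] := body_ball K; pose M := 2 / b.
have M0 : 0 < M by rewrite divr_gt0.
have MM : 0 < M * M by rewrite mulr_gt0.
pose r := Num.min (b / 2) (e / 2 / (M * M)).
have r0 : 0 < r by rewrite lt_min (divr_gt0 b0)//= divr_gt0// divr_gt0.
exists r => // L KL.
(* Testing with the point of [K] of norm [b] along [y] gives [b * enorm y <= 1 + c * enorm y]. The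
   case [c = 0] bounds the polar of [K] and the case [c = r] that of every [L] within [r], with one
   constant. *)
have bound (y : V) (c : R) : 0 <= c -> c <= b / 2 ->
    (forall x, body_set K x -> dot x y <= 1 + c * enorm y) -> enorm y <= M.
  move=> c0 cb h; have [->|y0] := eqVneq y 0; first by rewrite enorm0 ltW.
  have Y0 := enorm_gt0 y0; have := h ((b / enorm y) *: y).
  rewrite dotZl dotxx expr2 mulrA divfK ?gt_eqF// => /(_ _) h1.
  have {}h1 : b * enorm y <= 1 + c * enorm y.
    apply: h1; apply: bK; rewrite enormZ ger0_norm ?divfK ?gt_eqF//.
    by rewrite divr_ge0// ltW.
  have h2 : c * enorm y <= b / 2 * enorm y by rewrite ler_wpM2r// ltW.
  by rewrite /M ler_pdivlMr// mulrC; lra.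
have KM y : polar K y -> enorm y <= M.
  move=> Ky; apply: (bound y 0) => //; first by rewrite divr_ge0// ltW.
  by move=> x Kx; rewrite mul0r addr0; exact: Ky.
have LM y : polar L y -> enorm y <= M.
  move=> Ly; apply: (bound y r); [exact: ltW|by rewrite ge_min lexx|].
  move=> x Kx; have [z Lz xz] := hausdorff_approx KL Kx.
  have -> : x = z + (x - z) by rewrite addrC subrK.
  rewrite dotDl lerD//; first exact: Ly.
  by rewrite (le_trans (cauchy_schwarz _ _))// ler_wpM2r ?enorm_ge0// ltW.
have rM : r * M * M < e.
  apply: (@le_lt_trans _ _ (e / 2)).
    by rewrite -mulrA -ler_pdivlMr// ge_min lexx orbT.
  by rewrite ltr_pdivrMr// ltr_pMr// ltr1n.
have LK : hausdorff_dist L K < r by rewrite hausdorff_sym.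
rewrite /hausdorff_dist gt_max; apply/andP; split; apply: le_lt_trans rM.
  exact: (polar_body_excess (ltW r0) KL KM (ltW M0)).
exact: (polar_body_excess (ltW r0) LK LM (ltW M0)).
Qed.

Definition polar_vector_body m (y : {ptws 'I_m -> body}) : {ptws 'I_m -> body} :=
  fun r => polar_body (y r).

Lemma polar_vector_body_vclose m (y : {ptws 'I_m -> body}) (e : R) : 0 < e ->
  exists2 c, 0 < c & forall z, vclose c y z ->
    vclose e (polar_vector_body y) (polar_vector_body z).
Proof.
move=> e0; have h r := cid2 (polar_body_continuous (y r) e0).
exists (\big[Num.min/1]_(r < m) (s2val (h r))).
  by apply/bigmin_gtP; split=> // r _; exact: (s2valP (h r)).
move=> z yz r; apply: (s2valP' (h r)); apply: (lt_le_trans (yz r)).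
exact: (@bigmin_le_cond _ _ _ _ r).
Qed.

Lemma polar_vector_body_continuous m : continuous (@polar_vector_body m).
Proof.
move=> y A /nbhs_bodiesP[e e0 eA]; apply/nbhs_bodiesP.
have [c c0 hc] := polar_vector_body_vclose y e0; exists c => // z yz.
by apply: eA; exact: hc.
Qed.

Lemma measurable_polar_vector_body m :
  measurable_fun setT (@polar_vector_body m : borel {ptws 'I_m -> body} -> borel {ptws 'I_m -> body}).
Proof.
apply: (@measurability _ _ (borel {ptws 'I_m -> body}) (borel {ptws 'I_m -> body}) setT
  (@polar_vector_body m) (@open {ptws 'I_m -> body})) => //.
move=> _ [A oA <-]; rewrite setTI; apply: sub_sigma_algebra.
apply: open_comp => // y _; exact: polar_vector_body_continuous.
Qed.

End wrapping_polar.

Section wrapping_families.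
Context {R : realType} {d : nat}.
Local Notation V := 'rV[R]_d.
Variable K : body0 R d.

Lemma polar_polar_shift n (x : V) : (0 < n)%N -> body_set K x ->
  polar (polar_shift K n x) = dilate n%:R (translate (- x) K).
Proof.
move=> n0 Kx; rewrite /polar_shift polar_dilate ?invr_gt0 ?ltr0n//.
by rewrite invrK bipolar_translate.
Qed.

Lemma polar_segment_pole (p : R * V) : 0 < p.1 ->
  polar (segment 0 (pole p)) = halfspace p.2 p.1.
Proof.
move=> t0; rewrite polar_segment; apply/seteqP; split=> x; rewrite /halfspace/= dotZr.
  by rewrite mulrC ler_pdivrMr// mul1r.
by rewrite mulrC ler_pdivrMr// mul1r.
Qed.

End wrapping_families.

Theorem theorem3p2 (R : realType) (d : nat) (d_gt0 : (0 < d)%N)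
  (K : body0 R d) (K_strict : strictly_convex K) (K_regular : regular K)
  (dO : measure_display) (Omega : measurableType dO) (P : probability Omega R)
  (xi : nat -> Omega -> borel 'rV[R]_d)
  (xi_meas : forall i, measurable_fun setT (xi i))
  (xi_indep : mutually_independent P xi)
  (xi_unif : forall i, uniformly_distributed P K (xi i))
  (dO' : measure_display) (Omega' : measurableType dO')
  (P' : probability Omega' R)
  (tu : nat -> Omega' -> measurableTypeR R * borel 'rV[R]_d)
  (tu_dom : forall i o, 0 < (tu i o).1 /\ enorm (tu i o).2 = 1)
  (tu_poisson : poisson_process P' (intensity K) tu)
  (m : nat) :
  cvg_in_law_bodies P P'
    (fun (n : nat) (o : Omega) (r : 'I_m) =>
       peeling `I_n
         (fun i => dilate n%:R^-1 (polar (translate (- xi i o) K))) r.+1)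
    (fun (o : Omega') (r : 'I_m) =>
       peeling [set (tu i o).1^-1 *: (tu i o).2 | i in [set: nat]]
         (fun x => segment 0 x) r.+1)
  /\
  cvg_in_law_bodies P P'
    (fun (n : nat) (o : Omega) (r : 'I_m) =>
       wrapping `I_n (fun i => dilate n%:R (translate (- xi i o) K)) r.+1)
    (fun (o : Omega') (r : 'I_m) =>
       wrapping [set: nat] (fun i => halfspace (tu i o).2 (tu i o).1) r.+1).
Proof.
have [K_fin K_gt0] := volume_fin_gt0 xi_unif.
(* The diameter of cells required by [positive_direction_cell]. These cells serve depth only and are
   distinct from the cells of times and directions in which points are counted. *)
have q0 : 0 < 4^-1 :> R by rewrite invr_gt0.
have [q [w [mw _ cover small]]] := dir_cells d_gt0 K_fin K_regular q0.
have w_pos := positive_direction_cell d_gt0 K_fin K_regular (fun i => (mw i).1) cover small.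
pose good := good_points K tu m w; pose proper := all_proper K xi.
have mgood : measurable good by exact: (measurable_good_points tu_poisson m mw).
have Pgood : P' good = 1%E.
  exact: (P_good_points d_gt0 K_regular K_fin K_gt0 tu_dom tu_poisson m mw).
have mproper : measurable proper by exact: measurable_all_proper.
have Pproper : P proper = 1%E by apply: P_setC1 => //; exact: all_proper_negligible.
have mY := measurable_zero_vector tu_dom tu_poisson.1 w_pos mgood.
have mY_ n (mn : (m.+1 <= n)%N) := measurable_sample_vector K xi_meas mn.
have law := cvg_mean_coupling mY_ mY
  (vectors_coupling d_gt0 K_regular xi_meas xi_indep xi_unif tu_dom tu_poisson m mw w_pos).
split.
  exists (fun n => sample_vector K xi (m := m) n), (zero_vector K tu w (m := m)); split.
  - exists m.+1 => // n /= mn; split; first exact: mY_.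
    apply: (ae_full mproper Pproper) => o po r.
    by rewrite (peeling_samples r mn po) (sample_vector_core r mn po).
  - split; first exact: mY.
    apply: (ae_full mgood Pgood) => o go r.
    by rewrite (peeling_points tu_dom _ go) (zero_vector_core tu_dom w_pos r go).
  - by move=> f f_cont [M fM]; exact: (law f M).
exists (fun n o => polar_vector_body (sample_vector K xi (m := m) n o)),
  (fun o => polar_vector_body (zero_vector K tu w (m := m) o)); split.
- exists m.+1 => // n /= mn; split.
    exact: (measurableT_comp (@measurable_polar_vector_body R d m) (mY_ n mn)).
  apply: (ae_full mproper Pproper) => o po r.
  have n0 : (0 < n)%N by exact: leq_ltn_trans mn.
  have -> : (fun i => dilate n%:R (translate (- xi i o) K)) =
      (fun i => polar (polar_shift K n (xi i o))).
    apply/funext => i; rewrite polar_polar_shift//; apply/gauge_le1/ltW.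
    exact: (po i Logic.I).2.
  rewrite wrappingE; last 2 first.
  - move=> i _; have [b b0 hb] := polar_shift_ball K; apply: hb => //.
      exact: ltW (po i Logic.I).2.
    by rewrite enorm0 divr_ge0// ltW.
  - by rewrite card_le_II; apply: leq_trans mn; rewrite ltnS ltn_ord.
  by rewrite (peeling_samples r mn po) -(sample_vector_core r mn po).
- split.
    exact: (measurableT_comp (@measurable_polar_vector_body R d m) mY).
  apply: (ae_full mgood Pgood) => o go r.
  have -> : (fun i => halfspace (tu i o).2 (tu i o).1) =
      (fun i => polar (segments (points tu o) i)).
    apply/funext => i; rewrite /segments polar_segment_pole//.
    exact: (tu_dom i o).1.
  have inf : (`I_r.+2 #<= [set: nat])%card by exact: card_leT.
  rewrite wrappingE//; last by move=> i _; exact: segment0.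
  rewrite peelingE//; last by move=> i _; exact: segment0.
  by rewrite -(zero_vector_core tu_dom w_pos r go).
(* Polarity is continuous, so composing the test function with it reduces the wrappings to the
   peelings. *)
- move=> f f_cont [M fM].
  apply: (law (f \o @polar_vector_body R d m) M) => [y|y]; last exact: fM.
  apply: continuous_comp; [exact: polar_vector_body_continuous|exact: f_cont].
Qed.
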